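(* There exist constants $c_1,c_2,C_1,C_2>0$ such that the following holds. Let $S\subseteq\{1,\dots,n\}$ with $|S|=s\le n/2$, let $x\in\mathbb{R}^n$ or $\mathbb{C}^n$ be supported on $S$ and satisfy the random sign assumption, let $A$ be the random sensing matrix of the setting with parameters $\Lambda(S,F)$ and $\Gamma(F)$, and let $y=Ax+\epsilon$ with $\|\epsilon\|_2\le\eta$. For every $0<\varepsilon<1$, if $$\Lambda(S,F)\ge c_1\,\Gamma(F)\ln(3n/\varepsilon)\quad\text{and}\quad m\ge c_2\,\Lambda(S,F)\ln\!\left(\tfrac{3n}{\varepsilon}\right),$$ then with probability at least $1-\varepsilon$ every minimizer $x^\sharp$ of (qBP) satisfies $\|x-x^\sharp\|_2\le(C_1+C_2\sqrt s)\eta$. In the noiseless case $\eta=0$, with $c_1=50$ and $c_2=100$, $x$ is the unique minimizer of (BP) with probability at least $1-\varepsilon$.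
   Context: Setting: Let $n,m\ge 1$. For $\ell=1,\dots,m$ let $F_\ell$ be a probability distribution on $\mathbb{C}^{p_\ell\times n}$ ($p_\ell\ge1$), $F=(F_\ell)_{\ell=1}^m$, let $B_1,\dots,B_m$ be independent random matrices with $B_\ell\sim F_\ell$, and $A=\frac{1}{\sqrt m}\begin{pmatrix}B_1\\ \vdots\\ B_m\end{pmatrix}$. Isotropy is assumed: $\mathbb{E}(A^*A)=\frac1m\sum_{\ell=1}^m\mathbb{E}(B_\ell^*B_\ell)=\mathrm{Id}_n$. For $S\subseteq\{1,\dots,n\}$, $P_S$ is the restriction $P_Sx=x_S$, $M_S:=MP_S^*$, $B_{\ell,S}=B_\ell P_S^*$. $\|M\|_{p\to q}=\sup_{\|v\|_p\le1}\|Mv\|_q$; $\|M\|_{1\to2}$ is the maximal $\ell^2$ norm of a column of $M$. $\Lambda(S,F)$ and $\Gamma(F)$ denote positive reals such that almost surely, for all $\ell$, $\|B_{\ell,S}^*B_{\ell,S}\|_{2\to2}\le\Lambda(S,F)$ and $\|B_\ell\|_{1\to2}^2=\max_{i}\|B_\ell e_i\|_2^2\le\Gamma(F)$. Random sign assumption: the vector $(x_i/|x_i|)_{i\in S}$ is a Rademacher sequence (independent uniform $\pm1$ entries) if $x$ is real, or a Steinhaus sequence (independent entries uniform on the complex unit circle) if $x$ is complex, independent of $A$. (BP): $\min_{z\in\mathbb{C}^n}\|z\|_1$ s.t. $Az=y$. (qBP): $\min_{z\in\mathbb{C}^n}\|z\|_1$ s.t. $\|y-Az\|_2\le\eta$.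 *)

(* Defs.v *)
From HB Require Import structures.
From mathcomp Require Import all_boot all_order all_algebra.
From mathcomp Require Import all_classical all_reals all_analysis.
From mathcomp Require Import complex.

Set Implicit Arguments.
Unset Strict Implicit.
Unset Printing Implicit Defensive.

Import Order.TTheory GRing.Theory Num.Theory.
Local Open Scope classical_set_scope.
Local Open Scope ring_scope.
Local Open Scope complex_scope.

Definition creal {R : realType} (z : R[i]) : R := let: Complex a _ := z in a.
Definition cimag {R : realType} (z : R[i]) : R := let: Complex _ b := z in b.
Definition cabs2 {R : realType} (z : R[i]) : R := creal z ^+ 2 + cimag z ^+ 2.
Definition cmod {R : realType} (z : R[i]) : R := Num.sqrt (cabs2 z).
Definition cconj {R : realType} (z : R[i]) : R[i] := creal z -i* cimag z.
Definition expi {R : realType} (t : R) : R[i] := cos t +i* sin t.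

Definition adjmx {R : realType} {p q : nat} (M : 'M[R[i]]_(p, q)) : 'M[R[i]]_(q, p) :=
  \matrix_(i, j) cconj (M j i).

Definition l2norm {R : realType} {k : nat} (v : 'cV[R[i]]_k) : R :=
  Num.sqrt (\sum_i cabs2 (v i 0)).
Definition l1norm {R : realType} {k : nat} (v : 'cV[R[i]]_k) : R :=
  \sum_i cmod (v i 0).

Definition opnorm22_le {R : realType} {p q : nat} (M : 'M[R[i]]_(p, q)) (L : R) : Prop :=
  forall v : 'cV[R[i]]_q, l2norm (M *m v) <= L * l2norm v.

(** ||M||_{1->2}^2 = max_i ||M e_i||_2^2 <= G *)
Definition colnorm12_sq_le {R : realType} {p q : nat} (M : 'M[R[i]]_(p, q)) (G : R) : Prop :=
  forall i : 'I_q, l2norm (col i M) ^+ 2 <= G.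

(** P_S : C^n -> C^S, x |-> x_S  (C^S is indexed by 'I_#|S| through enum_val) *)
Definition PS {R : realType} {n : nat} (S : {set 'I_n}) : 'M[R[i]]_(#|S|, n) :=
  \matrix_(j, i) (i == enum_val j)%:R.

Definition restrS {R : realType} {p n : nat} (S : {set 'I_n}) (M : 'M[R[i]]_(p, n))
  : 'M[R[i]]_(p, #|S|) := M *m adjmx (PS S).

Definition sensing {R : realType} {T : Type} {n m : nat} {p : 'I_m -> nat}
  (B : forall l : 'I_m, T -> 'M[R[i]]_(p l, n)) (w : T) : 'M[R[i]]_(\sum_l p l, n) :=
  ((Num.sqrt (m%:R))^-1)%:C *: \mxcol_l (B l w).

Definition BP_minimizer {R : realType} {N n : nat} (A : 'M[R[i]]_(N, n)) (y : 'cV[R[i]]_N)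
  (z : 'cV[R[i]]_n) : Prop :=
  A *m z = y /\ forall w : 'cV[R[i]]_n, A *m w = y -> l1norm z <= l1norm w.

Definition qBP_minimizer {R : realType} {N n : nat} (A : 'M[R[i]]_(N, n)) (y : 'cV[R[i]]_N)
  (eta : R) (z : 'cV[R[i]]_n) : Prop :=
  l2norm (y - A *m z) <= eta /\
  forall w : 'cV[R[i]]_n, l2norm (y - A *m w) <= eta -> l1norm z <= l1norm w.

Definition borelC (R : realType) : set (set R[i]) :=
  <<s [set E | exists A : set R, measurable A /\
                 (E = (@creal R) @^-1` A \/ E = (@cimag R) @^-1` A)] >>.

Definition gen_sigma {d} {T : measurableType d} {R : realType} {I : Type}
  (f : I -> T -> R) : set (set T) :=
  <<s [set E | exists (i : I) (A : set R), measurable A /\ E = f i @^-1` A] >>.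

Definition sigma_mx {d} {T : measurableType d} {R : realType} {p q : nat}
  (X : T -> 'M[R[i]]_(p, q)) : set (set T) :=
  gen_sigma (fun k : 'I_p * 'I_q * bool =>
     fun w => if k.2 then creal (X w k.1.1 k.1.2) else cimag (X w k.1.1 k.1.2)).

Definition sigma_vec {d} {T : measurableType d} {R : realType} {k : nat}
  (X : T -> 'I_k -> R[i]) : set (set T) :=
  gen_sigma (fun c : 'I_k * bool =>
     fun w => if c.2 then creal (X w c.1) else cimag (X w c.1)).

Definition sigma_cplx {d} {T : measurableType d} {R : realType}
  (X : T -> R[i]) : set (set T) :=
  gen_sigma (fun b : bool => fun w => if b then creal (X w) else cimag (X w)).

Definition mutually_independent {d} {T : measurableType d} {R : realType}
  (P : probability T R) (I : finType) (G : I -> set (set T)) : Prop :=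
  forall E : I -> set T, (forall i, G i (E i)) ->
    P (\bigcap_i E i) = (\prod_i P (E i))%E.

Definition independent2 {d} {T : measurableType d} {R : realType}
  (P : probability T R) (G1 G2 : set (set T)) : Prop :=
  forall E F, G1 E -> G2 F -> P (E `&` F) = (P E * P F)%E.

Definition measurable_cplx {d} {T : measurableType d} {R : realType} (X : T -> R[i]) : Prop :=
  measurable_fun setT (fun w => creal (X w)) /\ measurable_fun setT (fun w => cimag (X w)).

Definition cexpect {d} {T : measurableType d} {R : realType} (P : probability T R)
  (X : T -> R[i]) : R[i] :=
  Rintegral P setT (fun w => creal (X w)) +i* Rintegral P setT (fun w => cimag (X w)).

Definition rademacher_seq {d} {T : measurableType d} {R : realType} (P : probability T R)
  {k : nat} (sg : T -> 'I_k -> R[i]) : Prop :=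
  (forall j, measurable_cplx (fun w => sg w j)) /\
  (forall j, P [set w | sg w j = 1] = (2^-1)%:E /\ P [set w | sg w j = -1] = (2^-1)%:E) /\
  mutually_independent P (fun j => sigma_cplx (fun w => sg w j)).

(** Steinhaus sequence: independent, uniformly distributed on the unit circle
    (law of each entry = pushforward of the uniform law on [0, 2pi) by t |-> e^{it}) *)
Definition steinhaus_seq {d} {T : measurableType d} {R : realType} (P : probability T R)
  {k : nat} (sg : T -> 'I_k -> R[i]) : Prop :=
  (forall j, measurable_cplx (fun w => sg w j)) /\
  (forall j, forall E, borelC E ->
     P ((fun w => sg w j) @^-1` E) =
     (lebesgue_measure [set t : R | (0 <= t < pi *+ 2)%R /\ E (expi t)] *
      ((pi *+ 2)^-1)%:E)%E) /\
  mutually_independent P (fun j => sigma_cplx (fun w => sg w j)).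

Definition sensing_setting {d} {T : measurableType d} {R : realType} (P : probability T R)
  (n m : nat) (p : 'I_m -> nat) (S : {set 'I_n})
  (B : forall l : 'I_m, T -> 'M[R[i]]_(p l, n)) (Lam Gam : R) : Prop :=
  [/\ (1 <= n)%N, (1 <= m)%N & (forall l, 1 <= p l)%N] /\
  (forall l i j, measurable_cplx (fun w => B l w i j)) /\
  mutually_independent P (fun l => sigma_mx (B l)) /\
  (forall i j : 'I_n,
     cexpect P (fun w => (adjmx (sensing B w) *m sensing B w) i j) = (i == j)%:R) /\
  0 < Lam /\ 0 < Gam /\
  {ae P, forall w, forall l : 'I_m,
     opnorm22_le (adjmx (restrS S (B l w)) *m restrS S (B l w)) Lam /\
     colnorm12_sq_le (B l w) Gam}.

(** x supported on S with (deterministic) magnitudes r > 0 and random sign vector sg on S: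
    x = P_S^* (r_j sg_j)_j; random sign assumption: sg Rademacher (real case) or
    Steinhaus (complex case), independent of A. *)
Definition signal {R : realType} {T : Type} {n : nat} (S : {set 'I_n})
  (r : 'I_#|S| -> R) (sg : T -> 'I_#|S| -> R[i]) (w : T) : 'cV[R[i]]_n :=
  adjmx (PS S) *m \col_j ((r j)%:C * sg w j).

Definition random_sign_assumption {d} {T : measurableType d} {R : realType}
  (P : probability T R) (n m : nat) (p : 'I_m -> nat) (S : {set 'I_n})
  (B : forall l : 'I_m, T -> 'M[R[i]]_(p l, n)) (sg : T -> 'I_#|S| -> R[i]) : Prop :=
  (rademacher_seq P sg \/ steinhaus_seq P sg) /\
  independent2 P (sigma_mx (sensing B)) (sigma_vec sg).

(* Main.v *)
Require Import Defs.
From HB Require Import structures.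
From mathcomp Require Import all_boot all_order all_algebra.
From mathcomp Require Import all_classical all_reals all_analysis.
From mathcomp Require Import complex measurable_realfun.
From mathcomp Require Import zify ring lra.

Set Implicit Arguments.
Unset Strict Implicit.
Unset Printing Implicit Defensive.

Import Order.TTheory GRing.Theory Num.Theory.

(** All probabilities are estimated through even moments. Write A_S^* A_S as a normalised
    sum of independent positive matrices Z_l with |Z_l| <= K := Lam / m. Replacing one
    summand by an independent copy turns E <X - E X, phi> into half the mean of a product
    of increments, which yields the recursions E tr D^(2p+2) <= (2p+1) K (2 E tr D^(2p) +
    E tr D^(2p+1)) for D := A_S^* A_S - 1, and similar ones for |A_S^* A e_i|^(2p) with
    i outside S and for the sign sums <u, sigma>. Taking p the integer part of
    ln (3 n / eps) plus one and summing the three Markov bounds, outside an event of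
    probability eps, |D| <= 1/2, |A_S^* A e_i| <= 1 and |<u_i, sigma>| <= 9/10 for the
    solution u_i of A_S^* A_S u_i = A_S^* A e_i. These inequalities provide the dual
    certificate A^* A_S (A_S^* A_S)^-1 sigma, from which recovery and stability follow.
    Complex matrices are handled through their realification, and the signs are decoupled
    from the matrix because the u_i are functions of A only. *)

Local Open Scope ring_scope.

(** * Scalar inequalities *)

(** The hypothesis on [m] leaves room for one logarithm only. The sign sums already cost a factor
    [p] in their moments, so [|A_S^* A e_i|^2] has to be of order [K] without such a factor. This is
    why the cross vectors need a recursion of their own: there the factor [p] falls on the weak
    variance [Gam / m] alone, and the condition [50 Gam ln (3 n / eps) <= Lam] makes [p Gam / m]
    small against [K]. Traces of even powers stand in for the operator norm; since [34/100 < 1/e],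
    the order [p] makes [(34/100)^p] at most [eps / (3 n)], which pays for the dimension factor and
    for the sum over columns. Realification doubles the size of the support block, and [2 |S| <= n]
    compensates for it. The exchanged expressions are polynomials in variables attached to single
    blocks, so an independent copy needs no product space: monomials factor over the blocks. The
    price is that almost sure bounds must be made sure, hence the modifications on a null set and
    the notion [adapted], where measurability is asked only up to such a set. *)

Section Scalars.
Variable R : realFieldType.
Implicit Types (x y : R) (b : nat -> R).

(** The increments of [b] are nondecreasing, so the increment [s] at [i] dominates the mean slope to
    the left of [i] and is dominated by the mean slope to the right. Weighting the two estimates by
    [h - i] and [i] gives the chord. *)
Lemma convex_seq_chord b (h i : nat) :
  (forall j, (0 < j < h)%N -> 2 * b j <= b j.-1 + b j.+1) -> (i <= h)%N ->
  h%:R * b i <= (h - i)%:R * b 0%N + i%:R * b h.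
Proof.
move=> cvx ih.
have slope j k : (j <= k)%N -> (k < h)%N -> b j.+1 - b j <= b k.+1 - b k.
  elim: k => [|k IH]; first by rewrite leqn0 => /eqP->.
  rewrite leq_eqVlt => /predU1P[->//|]; rewrite ltnS => jk kh.
  have := cvx k.+1 kh; have := IH jk (ltnW kh) => /=; lra.
have [->|hi] := eqVneq i h; first by rewrite subnn; lra.
have {hi} ltih : (i < h)%N by rewrite ltn_neqAle hi.
set s := b i.+1 - b i.
have lo k : (k <= i)%N -> b k - b 0%N <= k%:R * s.
  elim: k => [|k IH] ki; first by lra.
  have := slope k i (ltnW ki) ltih; have := IH (ltnW ki).
  rewrite -/s -natr1; lra.
have hi k : (i + k <= h)%N -> k%:R * s <= b (i + k)%N - b i.
  elim: k => [|k IH]; first by rewrite addn0; lra.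
  rewrite addnS => kh.
  have := slope i (i + k)%N (leq_addr _ _) kh; have := IH (ltnW kh).
  rewrite -/s -natr1; lra.
have Hlo := lo i (leqnn i).
have := hi (h - i)%N; rewrite subnKC// => /(_ (leqnn _)) Hhi.
have eh : h%:R = (h - i)%:R + i%:R :> R by rewrite -natrD subnK.
have i0 : 0 <= i%:R :> R by [].
have hi0 : 0 <= (h - i)%:R :> R by [].
rewrite eh; clear slope lo hi eh cvx; move: Hlo Hhi i0 hi0; move: (h - i)%:R (i%:R) => A I.
move: @s (b i) (b h) (b 0%N) => s bi bh b0 Hlo Hhi I0 A0.
have := ler_wpM2l A0 Hlo; have := ler_wpM2l I0 Hhi. lra.
Qed.

(** Trapezoidal form of the Hermite-Hadamard inequality: the chord bounds at [i] and at [h - i]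
    together put weight [h] on each endpoint, so adding them makes [i] disappear. *)
Lemma sum_convex_seq b (h : nat) :
  (forall j, (0 < j < h)%N -> 2 * b j <= b j.-1 + b j.+1) ->
  2 * \sum_(i < h.+1) b i <= h.+1%:R * (b 0%N + b h).
Proof.
case: h => [|h] cvx; first by rewrite big_ord1; lra.
have s1 : h.+1%:R * \sum_(i < h.+2) b i <=
   \sum_(i < h.+2) ((h.+1 - i)%:R * b 0%N + i%:R * b h.+1).
  rewrite mulr_sumr; apply: ler_sum => i _; apply: convex_seq_chord => //.
  exact: leq_ord.
have s2 : h.+1%:R * \sum_(i < h.+2) b i <=
   \sum_(i < h.+2) (i%:R * b 0%N + (h.+1 - i)%:R * b h.+1).
  rewrite [X in _ * X](reindex_inj rev_ord_inj) mulr_sumr; apply: ler_sum => i _.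
  rewrite /= subSS.
  have := convex_seq_chord cvx (leq_subr i h.+1).
  by rewrite subKn// -ltnS.
have h0 : 0 < h.+1%:R :> R by [].
rewrite -(ler_pM2l h0).
have : h.+1%:R * \sum_(i < h.+2) b i + h.+1%:R * \sum_(i < h.+2) b i <=
   \sum_(i < h.+2) h.+1%:R * (b 0%N + b h.+1).
  apply: (le_trans (lerD s1 s2)); rewrite -big_split; apply: ler_sum => i _ /=.
  have -> : h.+1%:R = (h.+1 - i)%:R + i%:R :> R by rewrite -natrD subnK// -ltnS.
  by rewrite le_eqVlt; apply/orP; left; apply/eqP; ring.
rewrite sumr_const card_ord -mulr_natl.
set A := \sum_(_ < _) _; move=> ?; lra.
Qed.

(** Weighted AM-GM with integer weights, so that no real powers occur. Raising the exponent by one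
    leaves the nonnegative remainder [p.+1%:R * x ^+ p * (x - w) ^+ 2]. *)
Lemma young_expn (p : nat) (w x : R) : 0 <= w -> 0 <= x ->
  p.+1%:R * (w * x ^+ p) <= w ^+ p.+1 + p%:R * x ^+ p.+1.
Proof.
move=> w0 x0; elim: p => [|p IH]; first by rewrite expr0 expr1; lra.
have H1 := ler_wpM2l w0 IH.
have H2 : 0 <= p.+1%:R * x ^+ p * (x - w) ^+ 2.
  by apply: mulr_ge0; [rewrite mulr_ge0 ?exprn_ge0 | exact: sqr_ge0].
rewrite -subr_ge0.
have -> : w ^+ p.+2 + p.+1%:R * x ^+ p.+2 - p.+2%:R * (w * x ^+ p.+1) =
  (w * (w ^+ p.+1 + p%:R * x ^+ p.+1) - w * (p.+1%:R * (w * x ^+ p))) +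
   p.+1%:R * x ^+ p * (x - w) ^+ 2.
  by rewrite !exprS -!natr1; ring.
by rewrite addr_ge0// subr_ge0.
Qed.

(** The first [p] odd numbers have mean [p]. The induction comes down to
    [2 (p+1)^(p+1) <= (p+2)^(p+1)], which is [young_expn] at [w = p + 2], [x = p + 1]. The products
    arise from iterating the moment recursions. *)
Lemma prod_odd_le (p : nat) : \prod_(i < p) (i.*2.+1)%:R <= p%:R ^+ p :> R.
Proof.
elim: p => [|p IH]; first by rewrite big_ord0 expr0.
rewrite big_ord_recr/=.
case: p IH => [|p] IH; first by rewrite big_ord0 expr1 mul1r.
have [P0 Q0] : 0 <= p.+1%:R :> R /\ 0 <= p.+2%:R :> R by [].
have := young_expn p Q0 P0.
have e2 : p.+2%:R = p.+1%:R + 1 :> R by rewrite natr1.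
have e3 : (p.+1.*2.+1)%:R <= 2 * p.+2%:R :> R.
  by rewrite -natrM ler_nat -mul2n [leqRHS]mulnS.
have h0 : 0 <= p.+1%:R ^+ p.+1 :> R by rewrite exprn_ge0.
have H1 := ler_wpM2r h0 e3 => H2.
have H3 : 0 <= (p.+1.*2.+1)%:R :> R by [].
apply: (le_trans (ler_wpM2r _ IH)) => //.
apply: le_trans (_ : 2 * p.+2%:R * p.+1%:R ^+ p.+1 <= _).
  by rewrite mulrC.
rewrite (exprS _ p.+1) [2 * _]mulrC -mulrA ler_wpM2l//.
have e4 : p.+1%:R = p%:R + 1 :> R by rewrite natr1.
move: H2; rewrite mulrCA -exprS e2; set y := p.+1%:R ^+ p.+1; rewrite e4; lra.
Qed.

(** Log-convexity makes the ratios [m k.+1 / m k] nondecreasing. They are compared after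
    cross-multiplication because terms may vanish; as soon as [m k.+1] is positive, the hypothesis
    forces [m k] to be positive too. *)
Lemma logconvex_seq_pow (m : nat -> R) (p : nat) : (forall k, 0 <= m k) ->
  (forall k, m k.+1 ^+ 2 <= m k * m k.+2) ->
  m 1%N ^+ p.+1 <= m 0%N ^+ p * m p.+1.
Proof.
move=> m0 lc.
have ratio k : m 1%N * m k <= m 0%N * m k.+1.
  elim: k => [|k IH]; first by rewrite mulrC.
  have [z1|n1] := eqVneq (m k.+1) 0; first by rewrite z1 mulr0 mulr_ge0.
  have p1 : 0 < m k.+1 by rewrite lt_neqAle eq_sym n1 m0.
  have pk : 0 < m k.
    rewrite lt_neqAle eq_sym m0 andbT; apply/eqP => z.
    have := lc k; rewrite z mul0r => h.
    by have := exprn_gt0 2 p1; rewrite ltNge h.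
  have bc0 : 0 <= m 1%N * m k by rewrite mulr_ge0.
  have := ler_pM bc0 (sqr_ge0 _) IH (lc k).
  have -> : m 1%N * m k * m k.+1 ^+ 2 = (m k * m k.+1) * (m 1%N * m k.+1) by ring.
  have -> : m 0%N * m k.+1 * (m k * m k.+2) = (m k * m k.+1) * (m 0%N * m k.+2) by ring.
  by rewrite ler_pM2l// mulr_gt0.
elim: p => [|p IH]; first by rewrite expr0 mul1r expr1.
rewrite exprS; apply: (le_trans (ler_wpM2l (m0 1%N) IH)).
by rewrite mulrCA exprSr -mulrA ler_wpM2l ?exprn_ge0.
Qed.
(** Replacing 1, [a] and [b] by their maximum [M] keeps the base [c0 + c1 + c2] sharp. The exponent
    may be doubled since [1 <= M], and it is doubled because the deviations are controlled through
    their moments of order [2 p]. *)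
Lemma sum3_expn_le (c0 c1 c2 a b : R) (p : nat) : 0 <= c0 -> 0 <= c1 -> 0 <= c2 ->
  0 <= a -> 0 <= b ->
  (c0 + c1 * a + c2 * b) ^+ p <= (c0 + c1 + c2) ^+ p * (1 + a ^+ p.*2 + b ^+ p.*2).
Proof.
move=> c00 c10 c20 a0 b0.
pose M : R := Num.max 1 (Num.max a b).
have M1 : 1 <= M by rewrite le_max lexx.
have Ma : a <= M by rewrite !le_max lexx !orbT.
have Mb : b <= M by rewrite !le_max lexx !orbT.
have M0 : 0 <= M by apply: le_trans M1.
have a20 : 0 <= a ^+ p.*2 by exact: exprn_ge0.
have b20 : 0 <= b ^+ p.*2 by exact: exprn_ge0.
have MM : M ^+ p <= 1 + a ^+ p.*2 + b ^+ p.*2.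
  apply: le_trans (_ : M ^+ p.*2 <= _).
    by rewrite ler_weXn2l// -addnn leq_addr.
  rewrite /M /Num.max; case: ifPn => _; first by case: ifPn => _; lra.
  by rewrite expr1n; lra.
have H : c0 + c1 * a + c2 * b <= (c0 + c1 + c2) * M.
  have h0 := ler_wpM2l c00 M1; have h1 := ler_wpM2l c10 Ma; have h2 := ler_wpM2l c20 Mb.
  by clear -h0 h1 h2; move: M h0 h1 h2 => M; lra.
apply: le_trans (_ : ((c0 + c1 + c2) * M) ^+ p <= _).
  by rewrite lerXn2r// nnegrE ?(le_trans _ H)// !addr_ge0// mulr_ge0.
by rewrite exprMn ler_wpM2l// exprn_ge0// !addr_ge0.
Qed.

(** Absorption step for the cross vectors, to be used with [x = |V|^2], [b = <V, D V>],
    [th = tr D^(2p)] and [de] the deviation of the total weight. In units of [K] the left side is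
    close to [p w xi^(p-1)]; [young_expn] splits it into [w^p] and [(p-1) xi^p], and the latter can
    return to the left side of the recursion, whose coefficient is [p]. *)
Lemma weak_young (q : nat) (x b de th K g : R) : let p := q.+2 in
  0 < K -> 0 <= g -> 0 <= x -> 0 <= th ->
  q.+1%:R * g * 50 <= K -> q.+1%:R * g <= 1 / 2500 ->
  b ^+ p.*2 <= x ^+ p.*2 * th ->
  p%:R * (4 * g * q.+1%:R * (2 * x + b) * x ^+ q + 4 * K ^+ 2 * g * q.+1%:R * (2 + de) * x ^+ q
     + K * (2 + de) * x ^+ q.+1) <=
  K ^+ p * ((10 / 3) ^+ p * (1 + (2 * de) ^+ p.*2 + th / 64 ^+ p) +
    p%:R * (1 / 625) * (3 + de ^+ p.*2)) + q.+1%:R * x ^+ p.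
Proof.
move=> p K0 g0 x0 th0 gK gs bx.
have Kp0 : 0 <= K ^+ p by rewrite exprn_ge0// ltW.
have Kn : K != 0 by rewrite gt_eqF.
pose xi : R := x / K; have xi0 : 0 <= xi by rewrite divr_ge0// ltW.
have xE : x = K * xi by rewrite /xi mulrC divfK.
pose om : R := `|b| / x.
have om0 : 0 <= om by rewrite divr_ge0.
have [ob oth] : b <= om * x /\ om ^+ p.*2 <= th.
  (* At [x = 0] the quotient [om] takes the default value 0, and the hypothesis on [b] forces
     [b = 0]. *)
  have [xz|xn] := eqVneq x 0.
    have -> : om = 0 by rewrite /om xz invr0 mulr0.
    have := bx; rewrite xz expr0n/= mul0r => b0.
    have : b ^+ p.*2 == 0 by rewrite eq_le b0/= -mul2n exprM exprn_ge0// sqr_ge0.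
    by rewrite expf_eq0/= => /eqP ->; rewrite mul0r.
  have x1 : 0 < x by rewrite lt_neqAle eq_sym xn.
  rewrite /om divfK//; split; first exact: ler_norm.
  rewrite expr_div_n ler_pdivrMr ?exprn_gt0// mulrC.
  by rewrite -mul2n exprM real_normK ?num_real// -exprM mul2n.
pose e : R := `|de|; have e0 : 0 <= e by rewrite normr_ge0.
have dee : de <= e by exact: ler_norm.
have eX : e ^+ p.*2 = de ^+ p.*2.
  by rewrite -mul2n !exprM real_normK ?num_real.
clearbody e om.
(* The estimates [t1] and [t2] below produce the coefficients [2 + 4/25 + 2/625], [1 + 1/625] and
   [2/25], rounded up here. In terms of [2 e] and [om / 8] they add up to less than [10/3]; the 8
   becomes [64 ^+ p] at the exponent [2 p]. *)
pose w : R := 13 / 6 + 51 / 50 * e + 2 / 25 * om.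
have w0 : 0 <= w by rewrite /w; lra.
have wp : w ^+ p <= (10 / 3) ^+ p * (1 + (2 * de) ^+ p.*2 + th / 64 ^+ p).
  have -> : w = 13 / 6 + 51 / 100 * (2 * e) + 16 / 25 * (om / 8).
    by rewrite /w; lra.
  have h8 : 0 <= om / 8 by rewrite divr_ge0.
  have h2e : 0 <= 2 * e by rewrite mulr_ge0.
  apply: le_trans (sum3_expn_le _ _ _ _ h2e h8) _; try exact: divr_ge0.
  have h1 : (13 / 6 + 51 / 100 + 16 / 25) ^+ p <= (10 / 3) ^+ p :> R.
    by rewrite lerXn2r ?nnegrE//; clear; lra.
  have h2 : 1 + (2 * e) ^+ p.*2 + (om / 8) ^+ p.*2 <=
      1 + (2 * de) ^+ p.*2 + th / 64 ^+ p.
    have e8 : 8 ^+ p.*2 = 64 ^+ p :> R.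
      by rewrite -mul2n exprM; congr (_ ^+ _); rewrite expr2 -natrM.
    by rewrite [(2 * e) ^+ _]exprMn [(2 * de) ^+ _]exprMn eX expr_div_n e8 lerD2l
      ler_wpM2r// invr_ge0 exprn_ge0.
  apply: ler_pM; [by apply: exprn_ge0; clear; lra|by rewrite !addr_ge0// exprn_ge0|exact: h1|exact: h2].
have Y := young_expn q.+1 w0 xi0.
have pE : p%:R = q.+1%:R + 1 :> R by rewrite /p natr1.
have xq0 : 0 <= xi ^+ q by rewrite exprn_ge0.
have xq1 : 0 <= xi ^+ q.+1 by rewrite exprn_ge0.
have xq : xi ^+ q <= 1 + xi ^+ q.+1.
  have [x1|x1] := leP xi 1; first by have := exprn_ile1 q xi0 x1; lra.
  have : xi ^+ q <= xi ^+ q.+1 by rewrite ler_weXn2l// ltW.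
  lra.
pose A : R := g * q.+1%:R.
have A0 : 0 <= A by rewrite mulr_ge0.
have AK : A / K <= 1 / 50.
  by rewrite ler_pdivrMr// /A mulrC; lra.
have As : A <= 1 / 2500 by rewrite /A mulrC.
have step : 4 * g * q.+1%:R * (2 * x + b) * x ^+ q + 4 * K ^+ 2 * g * q.+1%:R * (2 + de) * x ^+ q
     + K * (2 + de) * x ^+ q.+1 <= K ^+ p * (w * xi ^+ q.+1 + 1 / 625 * (2 + e)).
  have -> : 4 * g * q.+1%:R * (2 * x + b) * x ^+ q +
      4 * K ^+ 2 * g * q.+1%:R * (2 + de) * x ^+ q + K * (2 + de) * x ^+ q.+1 =
    K ^+ p * (4 * (A / K) * (2 * xi + b / K) * xi ^+ q + 4 * A * (2 + de) * xi ^+ q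
      + (2 + de) * xi ^+ q.+1).
    rewrite xE !exprMn /p !exprS /A; field; exact: Kn.
  rewrite ler_wpM2l//.
  have bK : b / K <= om * xi by rewrite ler_pdivrMr// -mulrA [xi * K]mulrC -xE.
  have t1 : 4 * (A / K) * (2 * xi + b / K) * xi ^+ q <= 2 / 25 * (2 + om) * xi ^+ q.+1.
    rewrite [xi ^+ q.+1]exprS [leRHS]mulrA ler_wpM2r//.
    apply: le_trans (_ : 4 * (A / K) * (2 * xi + om * xi) <= _).
      have AK0 : 0 <= 4 * (A / K) by rewrite mulr_ge0// divr_ge0// ltW.
      by rewrite ler_wpM2l// lerD2l.
    have : 0 <= 2 * xi + om * xi by apply: addr_ge0; exact: mulr_ge0.
    move=> h; have := ler_wpM2r h AK; lra.
  have t2 : 4 * A * (2 + de) * xi ^+ q <= 1 / 625 * (2 + e) * (1 + xi ^+ q.+1).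
    apply: le_trans (_ : 4 * A * (2 + e) * xi ^+ q <= _).
      by rewrite ler_wpM2r// ler_wpM2l ?mulr_ge0// lerD2l.
    apply: ler_pM => //; first by rewrite mulr_ge0 ?mulr_ge0// addr_ge0.
    by rewrite ler_wpM2r ?addr_ge0//; lra.
  have t3 := ler_wpM2r xq1 dee; have t4 := mulr_ge0 e0 xq1.
  move: t1 t2 t3 t4 xq1; rewrite /w; set y1 := 4 * (A / K) * _ * _; set y2 := _ * (2 + de) * _.
  move: (xi ^+ q.+1) y1 y2 => z y1 y2; clear. lra.
have p0 : 0 <= p%:R :> R by [].
apply: le_trans (ler_wpM2l p0 step) _.
have -> : x ^+ p = K ^+ p * xi ^+ p by rewrite xE exprMn.
have e3 : 2 + e <= 3 + de ^+ p.*2.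
  have [e1|e1] := leP e 1.
    by have : 0 <= de ^+ p.*2 by [rewrite -mul2n exprM exprn_ge0// sqr_ge0]; lra.
  have : e ^+ 1 <= e ^+ p.*2 by rewrite ler_weXn2l// ltW.
  by rewrite eX expr1; lra.
rewrite mulrCA [q.+1%:R * (_ * _)]mulrCA -mulrDr ler_wpM2l//.
have := ler_wpM2l p0 e3; move: Y wp; rewrite -/p.
set u := w ^+ p; set v := xi ^+ p; set z := xi ^+ q.+1; set r := (10 / 3) ^+ p * _.
move: (p%:R : R) (q.+1%:R : R) => P Q; lra.
Qed.
End Scalars.

(** * Vectors, symmetric matrices and traces *)

Section RealMatrices.
Variable R : realFieldType.

Definition dotc (k : nat) (u v : 'cV[R]_k) : R := (u^T *m v) 0 0.
Definition nsq (k : nat) (v : 'cV[R]_k) : R := dotc v v.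

Lemma dotcE k (u v : 'cV[R]_k) : dotc u v = \sum_i u i 0 * v i 0.
Proof. by rewrite /dotc mxE; apply: eq_bigr => i _; rewrite mxE. Qed.

Lemma dotcC k (u v : 'cV[R]_k) : dotc u v = dotc v u.
Proof. by rewrite !dotcE; apply: eq_bigr => i _; rewrite mulrC. Qed.

Lemma dotcDl k (u v w : 'cV[R]_k) : dotc (u + v) w = dotc u w + dotc v w.
Proof. by rewrite /dotc linearD/= mulmxDl mxE. Qed.

Lemma dotcDr k (u v w : 'cV[R]_k) : dotc w (u + v) = dotc w u + dotc w v.
Proof. by rewrite /dotc mulmxDr mxE. Qed.

Lemma dotcNl k (u v : 'cV[R]_k) : dotc (- u) v = - dotc u v.
Proof. by rewrite /dotc linearN/= mulNmx mxE. Qed.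

Lemma dotcNr k (u v : 'cV[R]_k) : dotc u (- v) = - dotc u v.
Proof. by rewrite dotcC dotcNl dotcC. Qed.

Lemma dotcZl k a (u v : 'cV[R]_k) : dotc (a *: u) v = a * dotc u v.
Proof. by rewrite /dotc linearZ/= -scalemxAl mxE. Qed.

Lemma dotcZr k a (u v : 'cV[R]_k) : dotc u (a *: v) = a * dotc u v.
Proof. by rewrite dotcC dotcZl dotcC. Qed.

Lemma dotc_mulmx k l (A : 'M[R]_(k, l)) u v : dotc u (A *m v) = dotc (A^T *m u) v.
Proof. by rewrite /dotc trmx_mul trmxK mulmxA. Qed.

Lemma dotc_suml k (I : Type) (r : seq I) (P : pred I) (F : I -> 'cV[R]_k) v :
  dotc (\sum_(i <- r | P i) F i) v = \sum_(i <- r | P i) dotc (F i) v.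
Proof. by rewrite /dotc linear_sum/= mulmx_suml summxE. Qed.

Lemma nsqE k (v : 'cV[R]_k) : nsq v = \sum_i v i 0 ^+ 2.
Proof. by rewrite /nsq dotcE. Qed.

Lemma nsq_ge0 k (v : 'cV[R]_k) : 0 <= nsq v.
Proof. by rewrite nsqE sumr_ge0// => i _; rewrite sqr_ge0. Qed.

Lemma nsq_eq0 k (v : 'cV[R]_k) : (nsq v == 0) = (v == 0).
Proof.
apply/idP/eqP => [|->]; last by rewrite /nsq /dotc mulmx0 mxE.
rewrite nsqE psumr_eq0 => [/allP h|i _]; last exact: sqr_ge0.
apply/colP => i; rewrite mxE; apply/eqP.
by have := h i (mem_index_enum _); rewrite sqrf_eq0.
Qed.

Lemma nsqN k (v : 'cV[R]_k) : nsq (- v) = nsq v.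
Proof. by rewrite /nsq dotcNl dotcNr opprK. Qed.

Lemma nsqZ k a (v : 'cV[R]_k) : nsq (a *: v) = a ^+ 2 * nsq v.
Proof. by rewrite /nsq dotcZl dotcZr mulrA. Qed.

Lemma nsqD k (u v : 'cV[R]_k) : nsq (u + v) = nsq u + 2 * dotc u v + nsq v.
Proof. by rewrite /nsq !dotcDl !dotcDr (dotcC v u); ring. Qed.

Lemma nsqB k (u v : 'cV[R]_k) : nsq (u - v) = nsq u - 2 * dotc u v + nsq v.
Proof. by rewrite nsqD nsqN dotcNr; ring. Qed.

Lemma nsqD_le k (u v : 'cV[R]_k) : nsq (u + v) <= 2 * (nsq u + nsq v).
Proof. by have := nsq_ge0 (u - v); rewrite nsqB nsqD; lra. Qed.

Lemma nsqB_le k (u v : 'cV[R]_k) : nsq (u - v) <= 2 * (nsq u + nsq v).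
Proof. by rewrite -(nsqN v) nsqD_le. Qed.

Lemma cauchy_schwarz k (u v : 'cV[R]_k) : dotc u v ^+ 2 <= nsq u * nsq v.
Proof.
have [->|v0] := eqVneq v 0.
  by rewrite /nsq /dotc !mulmx0 mxE expr0n mulr0.
have nv : 0 < nsq v by rewrite lt_neqAle eq_sym nsq_eq0 v0 nsq_ge0.
have := nsq_ge0 (nsq v *: u - dotc u v *: v).
rewrite nsqB !nsqZ dotcZl dotcZr.
set a := nsq u; set b := nsq v; set c := dotc u v => h.
rewrite -subr_ge0 -(pmulr_rge0 _ nv) -/b.
by apply: le_trans h _; rewrite le_eqVlt; apply/orP; left; apply/eqP; ring.
Qed.

Lemma vec_exchange_identity k (a b : 'cV[R]_k) (x y : R) (q : nat) :
  x = nsq a -> y = nsq b ->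
  2 * dotc (a - b) (x ^+ q *: a - y ^+ q *: b) =
    (x - y) * (x ^+ q - y ^+ q) + nsq (a - b) * (x ^+ q + y ^+ q).
Proof.
move=> hx hy; rewrite nsqB -hx -hy dotcDr dotcNr !dotcZr !dotcDl !dotcNl.
by rewrite -!/(nsq _) -hx -hy (dotcC b a); ring.
Qed.

(** Once [x - y] is factored out of [x^k - y^k], multiplication by [x + y] lets the monomials be
    paired with their mirror images, and [x^i y^j + x^j y^i <= x^(i+j) + y^(i+j)] because powers are
    increasing. *)
Lemma pow_diff_strong (x y : R) (k : nat) : 0 <= x -> 0 <= y ->
  (x + y) * ((x - y) * (x ^+ k - y ^+ k)) <= k%:R * (x - y) ^+ 2 * (x ^+ k + y ^+ k).
Proof.
move=> x0 y0; case: k => [|k]; first by rewrite !expr0 subrr; lra.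
rewrite subrXX mulrA; set S := \sum_(_ < _) _.
suff H : (x + y) * S <= k.+1%:R * (x ^+ k.+1 + y ^+ k.+1).
  have := ler_wpM2l (sqr_ge0 (x - y)) H; lra.
rewrite /S mulr_sumr mulr_natl -[X in _ *+ X]card_ord -sumr_const.
have hs : \sum_(i < k.+1) (x + y) * (x ^+ (k.+1.-1 - i) * y ^+ i) =
   \sum_(i < k.+1) (x ^+ (k - i).+1 * y ^+ i + x ^+ i * y ^+ (k - i).+1).
  rewrite big_split/= [X in _ = _ + X](reindex_inj rev_ord_inj)/= -big_split/=.
  apply: eq_bigr => i _; rewrite subSS subKn; last exact: leq_ord.
  by rewrite exprS [y ^+ i.+1]exprS; ring.
rewrite hs; apply: ler_sum => i _.
have ik : (i <= k)%N by exact: leq_ord.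
have e (z : R) : z ^+ k.+1 = z ^+ i * z ^+ (k - i).+1.
  by rewrite -exprD addnS subnKC.
rewrite !e; set u := x ^+ i; set v := y ^+ i.
set u' := x ^+ _; set v' := y ^+ _.
suff : 0 <= (u - v) * (u' - v') by lra.
have [xy|/ltW yx] := leP x y.
- by rewrite mulr_le0// subr_le0 lerXn2r.
- by rewrite mulr_ge0// subr_ge0 lerXn2r.
Qed.

(** The pairing of [pow_diff_strong] without the factor [x + y]: the exponent on the right drops by
    one, and [(x - y) ^+ 2] stays available for a bound by the weak variance. *)
Lemma pow_diff_weak (x y : R) (k : nat) : 0 <= x -> 0 <= y ->
  2 * ((x - y) * (x ^+ k.+1 - y ^+ k.+1)) <=
    k.+1%:R * (x - y) ^+ 2 * (x ^+ k + y ^+ k).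
Proof.
move=> x0 y0; rewrite subrXX mulrA; set S := \sum_(_ < _) _.
suff H : 2 * S <= k.+1%:R * (x ^+ k + y ^+ k).
  have := ler_wpM2l (sqr_ge0 (x - y)) H; lra.
rewrite (_ : k.+1%:R * _ = \sum_(i < k.+1) (x ^+ k + y ^+ k)); last first.
  by rewrite sumr_const card_ord mulr_natl.
have hs : 2 * S = \sum_(i < k.+1) (x ^+ (k - i) * y ^+ i + x ^+ i * y ^+ (k - i)).
  rewrite big_split/= [X in _ = _ + X](reindex_inj rev_ord_inj)/= /S.
  rewrite mulr2n mulrDl mul1r; congr (_ + _).
  by apply: eq_bigr => i _; rewrite subSS subKn//; exact: leq_ord.
rewrite hs; apply: ler_sum => i _.
have ik : (i <= k)%N by exact: leq_ord.
have e (z : R) : z ^+ k = z ^+ i * z ^+ (k - i) by rewrite -exprD subnKC.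
rewrite !e; set u := x ^+ i; set v := y ^+ i.
set u' := x ^+ _; set v' := y ^+ _.
suff : 0 <= (u - v) * (u' - v') by lra.
have [xy|/ltW yx] := leP x y.
- by rewrite mulr_le0// subr_le0 lerXn2r.
- by rewrite mulr_ge0// subr_ge0 lerXn2r.
Qed.

Lemma mxtr_gram_ge0 k l (A : 'M[R]_(k, l)) : 0 <= \tr (A^T *m A).
Proof.
rewrite /mxtrace sumr_ge0// => i _; rewrite mxE sumr_ge0// => j _.
by rewrite mxE -expr2 sqr_ge0.
Qed.

Lemma mxtr_gramE k l (A : 'M[R]_(k, l)) : \tr (A^T *m A) = \sum_j nsq (col j A).
Proof.
rewrite /mxtrace; apply: eq_bigr => j _; rewrite mxE nsqE.
by apply: eq_bigr => i _; rewrite !mxE.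
Qed.

Lemma mxtr_gram_cross k l (A B : 'M[R]_(k, l)) :
  2 * \tr (A^T *m B) <= \tr (A^T *m A) + \tr (B^T *m B).
Proof.
have := mxtr_gram_ge0 (A - B).
rewrite [(A - B)^T]linearB/= mulmxBl !mulmxBr !linearB/= -[\tr (B^T *m A)]mxtrace_tr.
by rewrite trmx_mul trmxK; lra.
Qed.

Variable d : nat.
Implicit Types (W Y H D : 'M[R]_d).

Lemma trmxX W k : (W ^+ k)^T = W^T ^+ k.
Proof.
elim: k => [|k IH]; first by rewrite !expr0 trmx1.
by rewrite exprS exprSr -mulmxE trmx_mul IH.
Qed.

(** With [M i = W^i H Y^(h-i)], the terms are trace inner products: [a (i + j) = <M i, M j>].
    Even-indexed terms are therefore squared norms forming a convex sequence, and an odd term is at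
    most the mean of its even neighbours. [W] and [Y] may be indefinite, so the whole sequence need
    not be convex; this is why the two parities are treated apart. *)
Lemma trace_interpolation W Y H (h : nat) : W^T = W -> Y^T = Y -> H^T = H ->
  2 * \sum_(q < h.*2.+1) \tr (H * W ^+ q * H * Y ^+ (h.*2 - q)) <=
  h.*2.+1%:R * (\tr (H * H * W ^+ h.*2) + \tr (H * H * Y ^+ h.*2)).
Proof.
move=> Ws Ys Hs.
pose a q := \tr (H * W ^+ q * H * Y ^+ (h.*2 - q)).
pose M i := W ^+ i * H * Y ^+ (h - i).
have MM i j : (i <= h)%N -> (j <= h)%N -> \tr ((M i)^T *m M j) = a (i + j)%N.
  move=> ih jh; rewrite /M -!mulmxE !trmx_mul !trmxX Ws Ys Hs !mulmxE.
  rewrite -!mulrA -!mulmxE mxtrace_mulC !mulmxE /a !mulrA.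
  have -> : (h.*2 - (i + j) = (h - j) + (h - i))%N.
    by lia.
  by rewrite !exprD !mulrA.
have odd_a i : (i < h)%N -> 2 * a i.*2.+1 <= a i.*2 + a i.+1.*2.
  move=> ih; have := mxtr_gram_cross (M i) (M i.+1).
  by rewrite !MM ?ih// ?(ltnW ih)// addnn addnS addnn addSn addnS addnn doubleS.
have even_a j : (0 < j < h)%N -> 2 * a j.*2 <= a j.-1.*2 + a j.+1.*2.
  case: j => [//|j] /= jh; have := mxtr_gram_cross (M j) (M j.+2).
  rewrite !MM// ?(ltnW jh)// ?(ltnW (ltnW jh))// !addSn !addnS !addnn.
  by rewrite doubleS.
have S2 := sum_convex_seq even_a.
(* Each inner even term serves two odd neighbours, but an end term only one; adding [a 0 + a (2h)]
   makes up for the difference. *)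
have hsum : 2 * \sum_(q < h.*2.+1) a q + (a 0%N + a h.*2) <= 4 * \sum_(i < h.+1) a i.*2.
  have : forall r, (r <= h)%N -> 2 * \sum_(q < r.*2.+1) a q + (a 0%N + a r.*2) <=
            4 * \sum_(i < r.+1) a i.*2.
    elim=> [|r IH] rh; first by rewrite !big_ord1; lra.
    rewrite doubleS 2!big_ord_recr [X in _ <= _ * X]big_ord_recr /= doubleS.
    have := IH (ltnW rh); have := odd_a r rh; rewrite doubleS; lra.
  exact.
have a0 : a 0%N = \tr (H * H * Y ^+ h.*2) by rewrite /a expr0 mulr1 subn0.
have ah : a h.*2 = \tr (H * H * W ^+ h.*2).
  by rewrite /a subnn expr0 mulr1 -!mulmxE mxtrace_mulC mulmxA.
rewrite -a0 -ah; rewrite -/a in hsum S2 *.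
have e : h.*2.+1%:R + 1 = 2 * h.+1%:R :> R.
  by rewrite natr1 -natrM mul2n doubleS.
have := ler_wpM2r (_ : 0 <= 1) S2.
move: S2 hsum; rewrite double0.
set A := \sum_(q < _) _; set B := \sum_(i < _) _ => S2 hsum _.
have e' : h.*2.+1%:R = 2 * h.+1%:R - 1 :> R by lra.
rewrite e'; lra.
Qed.

Lemma subr_expr_noncomm W Y (N : nat) :
  W ^+ N - Y ^+ N = \sum_(q < N) W ^+ q * (W - Y) * Y ^+ (N.-1 - q).
Proof.
elim: N => [|N IH]; first by rewrite big_ord0 subrr.
rewrite big_ord_recr/= subnn expr0 mulr1 mulrBr -exprSr.
have -> : \sum_(i < N) W ^+ i * (W - Y) * Y ^+ (N - i) = (W ^+ N - Y ^+ N) * Y.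
  rewrite IH mulr_suml; apply: eq_bigr => i _.
  rewrite -[RHS]mulrA -exprSr; congr (_ * Y ^+ _).
  by have := ltn_ord i; lia.
by rewrite mulrBl -exprSr; rewrite addrC addrA subrK.
Qed.

(** Noncommutative counterpart of the mean value estimate for [t^(2h+1)]: telescoping the difference
    of powers produces exactly the interpolated traces. The exponent is odd so that the right side
    contains only even powers, which are positive. *)
Lemma trace_exchange W Y (h : nat) : W^T = W -> Y^T = Y ->
  2 * \tr ((W - Y) * (W ^+ h.*2.+1 - Y ^+ h.*2.+1)) <=
  h.*2.+1%:R * (\tr ((W - Y) * (W - Y) * W ^+ h.*2) +
                \tr ((W - Y) * (W - Y) * Y ^+ h.*2)).
Proof.
move=> Ws Ys; set H := W - Y.
have Hs : H^T = H by rewrite /H linearB/= Ws Ys.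
apply: le_trans (trace_interpolation h Ws Ys Hs).
rewrite le_eqVlt; apply/orP; left; apply/eqP; congr (_ * _).
rewrite subr_expr_noncomm mulr_sumr linear_sum/=.
by apply: eq_bigr => i _; rewrite !mulrA.
Qed.

Lemma mxtr_odd_le D (h : nat) : D^T = D ->
  2 * \tr (D ^+ h.*2.+1) <= \tr (D ^+ h.*2) + \tr (D ^+ h.+1.*2).
Proof.
move=> Ds; have := mxtr_gram_cross (D ^+ h) (D ^+ h.+1).
rewrite !trmxX Ds !mulmxE -!exprD !addSn !addnS !addnn doubleS//.
Qed.

Lemma mxtr_even_ge0 D (h : nat) : D^T = D -> 0 <= \tr (D ^+ h.*2).
Proof.
by move=> Ds; have := mxtr_gram_ge0 (D ^+ h); rewrite trmxX Ds mulmxE -exprD addnn.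
Qed.

Lemma nsq_gram_le k l (A : 'M[R]_(k, l)) v : nsq (A *m v) <= \tr (A^T *m A) * nsq v.
Proof.
have -> : \tr (A^T *m A) = \sum_i nsq (col i A^T).
  by rewrite mxtrace_mulC -{1}[A]trmxK mxtr_gramE.
rewrite nsqE mulr_suml; apply: ler_sum => i _.
have -> : (A *m v) i 0 = dotc (col i A^T) v.
  by rewrite mxE dotcE; apply: eq_bigr => j _; rewrite !mxE.
exact: cauchy_schwarz.
Qed.

(* The moments <v, D^(2k) v> are log-convex in k, hence so is the operator norm bound. *)
Lemma nsq_mul_trace_pow D (p : nat) v : D^T = D ->
  nsq (D *m v) ^+ p.+1 <= nsq v ^+ p.+1 * \tr (D ^+ p.+1.*2).
Proof.
move=> Ds; pose m k := nsq (D ^+ k *m v).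
have mS j k : dotc (D ^+ j *m v) (D ^+ k *m v) = dotc v (D ^+ (j + k) *m v).
  by rewrite [LHS]dotcC dotc_mulmx trmxX Ds mulmxA mulmxE -exprD dotcC.
have H := @logconvex_seq_pow R m p (fun k => nsq_ge0 _) _.
have m0 : m 0%N = nsq v by rewrite /m expr0 mul1mx.
have m1 : m 1%N = nsq (D *m v) by rewrite /m expr1.
rewrite -m1 -m0; apply: le_trans (H _) _.
  move=> k; rewrite {1}/m /nsq mS.
  have := cauchy_schwarz (D ^+ k *m v) (D ^+ k.+2 *m v).
  by rewrite mS !addnS addSn.
rewrite [leRHS]mulrC exprS mulrA [leRHS]mulrC ler_wpM2l ?exprn_ge0 ?nsq_ge0//.
(* The remaining norm of [D^(p+1) v] is bounded through the Hilbert-Schmidt norm of [D^(p+1)], so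
   eigenvalues never appear. *)
have := nsq_gram_le (D ^+ p.+1) v.
by rewrite trmxX Ds mulmxE -exprD addnn -m0.
Qed.

(** Testing [Z] on the columns of [D ^+ h] reduces trace inequalities against an even power to
    inequalities between quadratic forms at single vectors; no order on matrices is introduced. *)
Lemma mxtr_mul_pow_even (Z D : 'M[R]_d) h : D^T = D ->
  \tr (Z * D ^+ h.*2) = \sum_j dotc (col j (D ^+ h)) (Z *m col j (D ^+ h)).
Proof.
move=> Ds; rewrite -addnn exprD mulrA -!mulmxE mxtrace_mulC /mxtrace.
have As : (D ^+ h)^T = D ^+ h by rewrite trmxX Ds.
apply: eq_bigr => j _; rewrite dotcE mxE; apply: eq_bigr => i _.
rewrite -{1}As !mxE; congr (_ * _).
by apply: eq_bigr => k _; rewrite !mxE.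
Qed.

(** On each test vector [(Z - Z')^2] is at most [2 Z^2 + 2 Z'^2], and the two hypotheses are
    [Z^2 <= K Z] and [Z'^2 <= K Z'] written as quadratic forms. *)
Lemma trace_sq_diff_le (Z Z' D : 'M[R]_d) (K : R) h : Z^T = Z -> Z'^T = Z' -> D^T = D ->
  (forall v, nsq (Z *m v) <= K * dotc v (Z *m v)) ->
  (forall v, nsq (Z' *m v) <= K * dotc v (Z' *m v)) ->
  \tr ((Z - Z') * (Z - Z') * D ^+ h.*2) <= 2 * K * \tr ((Z + Z') * D ^+ h.*2).
Proof.
move=> Zs Zs' Ds hZ hZ'; rewrite !mxtr_mul_pow_even// mulr_sumr.
apply: ler_sum => j _; set v := col j _.
rewrite -mulmxE -mulmxA dotc_mulmx [(Z - Z')^T]linearB/= Zs Zs' -/(nsq _) mulmxBl.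
rewrite mulmxDl dotcDr; have := nsqB_le (Z *m v) (Z' *m v).
have := hZ v; have := hZ' v; lra.
Qed.

(** The increment [nsq a - nsq b = <a - b, a + b>] is bounded by Cauchy-Schwarz at the price of the
    full norm of [a - b]; [pow_diff_strong] cancels the factor [nsq a + nsq b] created in this
    way. *)
Lemma vec_exchange_strong k (a b : 'cV[R]_k) (q : nat) :
  2 * dotc (a - b) (nsq a ^+ q *: a - nsq b ^+ q *: b) <=
    q.*2.+1%:R * nsq (a - b) * (nsq a ^+ q + nsq b ^+ q).
Proof.
rewrite (vec_exchange_identity q (erefl (nsq a)) (erefl (nsq b))).
have xy2 : (nsq a - nsq b) ^+ 2 <= nsq (a - b) * (2 * (nsq a + nsq b)).
  have -> : nsq a - nsq b = dotc (a - b) (a + b).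
    by rewrite /nsq !dotcDl !dotcDr !dotcNl (dotcC b a); lra.
  apply: le_trans (cauchy_schwarz _ _) _; rewrite ler_wpM2l ?nsq_ge0 ?nsqD_le//.
have [x0 y0] := (nsq_ge0 a, nsq_ge0 b); have D0 := nsq_ge0 (a - b).
have := pow_diff_strong q x0 y0.
move: (nsq a) (nsq b) (nsq (a - b)) x0 y0 D0 xy2 => x y D x0 y0 D0 xy2 H.
have S0 : 0 <= x ^+ q + y ^+ q by rewrite addr_ge0// exprn_ge0.
have e : q.*2.+1%:R = 2 * q%:R + 1 :> R by rewrite -natr1 -muln2 natrM mulrC.
suff : (x - y) * (x ^+ q - y ^+ q) <= 2 * q%:R * D * (x ^+ q + y ^+ q).
  by rewrite e; lra.
have [xy0|xy0] := eqVneq (x + y) 0.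
  have [-> ->] : x = 0 /\ y = 0 by lra.
  by rewrite subrr mul0r !mulr_ge0// addr_ge0// exprn_ge0.
have p0 : 0 < x + y by rewrite lt_neqAle eq_sym xy0 addr_ge0.
rewrite -(ler_pM2l p0); apply: le_trans H _.
have := ler_wpM2r S0 (ler_wpM2l (ler0n R q) xy2); lra.
Qed.

(** The factor [q.+1] falls only on the squared increment of [nsq], which the weak variance
    controls. The full norm of [a - b] appears with a constant factor, and this is what keeps the
    order of the moment away from [K]. *)
Lemma vec_exchange_weak k (a b : 'cV[R]_k) (q : nat) :
  4 * dotc (a - b) (nsq a ^+ q.+1 *: a - nsq b ^+ q.+1 *: b) <=
    q.+1%:R * (nsq a - nsq b) ^+ 2 * (nsq a ^+ q + nsq b ^+ q) +
    2 * nsq (a - b) * (nsq a ^+ q.+1 + nsq b ^+ q.+1).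
Proof.
have := vec_exchange_identity q.+1 (erefl (nsq a)) (erefl (nsq b)).
have := pow_diff_weak q (nsq_ge0 a) (nsq_ge0 b); lra.
Qed.

(** The increment equals [2 <u - u', v> - |u - u'|^2]. The first part is bounded by the weak
    variance [g]. In the square of the second part one factor is bounded by [2 K (t + t')] and the
    other one uniformly by [4 K g], so both parts gain a factor [g]. *)
Lemma nsq_increment_le k (u u' v : 'cV[R]_k) (z z' t t' g K : R) :
  0 <= g -> 0 <= K -> 0 <= t <= g -> 0 <= t' <= g ->
  nsq u <= K * t -> nsq u' <= K * t' ->
  dotc u v ^+ 2 <= g * z -> dotc u' v ^+ 2 <= g * z' ->
  (nsq v - nsq (v - (u - u'))) ^+ 2 <= 16 * g * (z + z') + 16 * K ^+ 2 * g * (t + t').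
Proof.
move=> g0 K0 /andP[t0 tg] /andP[t0' tg'] hu hu' hz hz'.
set D := nsq (u - u'); set c := dotc (u - u') v.
have -> : nsq v - nsq (v - (u - u')) = 2 * c - D by rewrite nsqB dotcC /c /D; ring.
have c2 : c ^+ 2 <= 2 * g * (z + z').
  rewrite /c dotcDl dotcNl; have := sqr_ge0 (dotc u v + dotc u' v); lra.
have D1 : D <= 2 * K * (t + t') by have := nsqB_le u u'; rewrite /D; lra.
have D2 : D <= 4 * K * g.
  by have := ler_wpM2l K0 tg; have := ler_wpM2l K0 tg'; lra.
have D0 : 0 <= D := nsq_ge0 _.
have DD : D ^+ 2 <= (2 * K * (t + t')) * (4 * K * g) by rewrite expr2 ler_pM.
have := sqr_ge0 (2 * c + D); lra.
Qed.

End RealMatrices.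

(** * Algebras of random variables *)

Section FunctionAlgebra.
Variables (R : comNzRingType) (A : Type) (Q : (A -> R) -> Prop).

(** These closure properties are shared by bounded variables, adapted variables, polynomial
    functions of three sample points and measurable functions, so each matrix expression is treated
    once for all four. *)
Record fun_subalg : Prop := FunSubalg {
  fun_subalg_cst : forall c, Q (fun=> c);
  fun_subalgD : forall f g, Q f -> Q g -> Q (fun x => f x + g x);
  fun_subalgM : forall f g, Q f -> Q g -> Q (fun x => f x * g x) }.

Hypothesis Qalg : fun_subalg.

Lemma fun_subalg_ext f g : (forall x, f x = g x) -> Q f -> Q g.
Proof. by move=> /funext ->. Qed.

Lemma fun_subalgZ c f : Q f -> Q (fun x => c * f x).
Proof. by move=> Qf; apply: (fun_subalgM Qalg) => //; exact: (fun_subalg_cst Qalg). Qed.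

Lemma fun_subalgN f : Q f -> Q (fun x => - f x).
Proof. by move=> /(fun_subalgZ (-1)); apply: fun_subalg_ext => x; rewrite mulN1r. Qed.

Lemma fun_subalgB f g : Q f -> Q g -> Q (fun x => f x - g x).
Proof. by move=> Qf /fun_subalgN; exact: (fun_subalgD Qalg). Qed.

Lemma fun_subalgX f n : Q f -> Q (fun x => f x ^+ n).
Proof.
move=> Qf; elim: n => [|n IH]; first exact: (fun_subalg_cst Qalg).
by apply: fun_subalg_ext (fun_subalgM Qalg Qf IH) => x; rewrite exprS.
Qed.

Lemma fun_subalg_sum (I : Type) (r : seq I) (P : pred I) (F : I -> A -> R) :
  (forall i, P i -> Q (F i)) -> Q (fun x => \sum_(i <- r | P i) F i x).
Proof.
move=> QF; elim: r => [|i r IH].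
  by apply: fun_subalg_ext (fun_subalg_cst Qalg 0) => x; rewrite big_nil.
case Pi: (P i); last by apply: fun_subalg_ext IH => x; rewrite big_cons Pi.
by apply: fun_subalg_ext (fun_subalgD Qalg (QF _ Pi) IH) => x; rewrite big_cons Pi.
Qed.

Lemma fun_subalg_prod (I : Type) (r : seq I) (P : pred I) (F : I -> A -> R) :
  (forall i, P i -> Q (F i)) -> Q (fun x => \prod_(i <- r | P i) F i x).
Proof.
move=> QF; elim: r => [|i r IH].
  by apply: fun_subalg_ext (fun_subalg_cst Qalg 1) => x; rewrite big_nil.
case Pi: (P i); last by apply: fun_subalg_ext IH => x; rewrite big_cons Pi.
by apply: fun_subalg_ext (fun_subalgM Qalg (QF _ Pi) IH) => x; rewrite big_cons Pi.
Qed.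

Definition mx_in_subalg a b (F : A -> 'M[R]_(a, b)) : Prop :=
  forall i j, Q (fun x => F x i j).

Lemma mx_subalg_cst a b (M : 'M[R]_(a, b)) : mx_in_subalg (fun=> M).
Proof. by move=> i j; exact: (fun_subalg_cst Qalg). Qed.

Lemma mx_subalgD a b (F H : A -> 'M[R]_(a, b)) :
  mx_in_subalg F -> mx_in_subalg H -> mx_in_subalg (fun x => F x + H x).
Proof.
move=> QF QH i j; apply: fun_subalg_ext (fun_subalgD Qalg (QF i j) (QH i j)) => x.
by rewrite mxE.
Qed.

Lemma mx_subalgN a b (F : A -> 'M[R]_(a, b)) :
  mx_in_subalg F -> mx_in_subalg (fun x => - F x).
Proof. by move=> QF i j; apply: fun_subalg_ext (fun_subalgN (QF i j)) => x; rewrite mxE. Qed.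

Lemma mx_subalgB a b (F H : A -> 'M[R]_(a, b)) :
  mx_in_subalg F -> mx_in_subalg H -> mx_in_subalg (fun x => F x - H x).
Proof. by move=> QF /mx_subalgN; exact: mx_subalgD. Qed.

Lemma mx_subalgZ a b (f : A -> R) (F : A -> 'M[R]_(a, b)) :
  Q f -> mx_in_subalg F -> mx_in_subalg (fun x => f x *: F x).
Proof.
by move=> Qf QF i j; apply: fun_subalg_ext (fun_subalgM Qalg Qf (QF i j)) => x; rewrite mxE.
Qed.

Lemma mx_subalgM a b c (F : A -> 'M[R]_(a, b)) (H : A -> 'M[R]_(b, c)) :
  mx_in_subalg F -> mx_in_subalg H -> mx_in_subalg (fun x => F x *m H x).
Proof.
move=> QF QH i j.
have h k : true -> Q (fun x => F x i k * H x k j) by move=> _; exact: (fun_subalgM Qalg).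
by apply: fun_subalg_ext (fun_subalg_sum (index_enum _) h) => x; rewrite mxE.
Qed.

Lemma mx_subalgX a (F : A -> 'M[R]_a) n :
  mx_in_subalg F -> mx_in_subalg (fun x => F x ^+ n).
Proof.
move=> QF; elim: n => [|n IH]; first exact: mx_subalg_cst.
move=> i j; apply: fun_subalg_ext (mx_subalgM QF IH i j) => x.
by rewrite exprS mulmxE.
Qed.

Lemma mx_subalgT a b (F : A -> 'M[R]_(a, b)) :
  mx_in_subalg F -> mx_in_subalg (fun x => (F x)^T).
Proof. by move=> QF i j; apply: fun_subalg_ext (QF j i) => x; rewrite mxE. Qed.

Lemma mx_subalg_sum a b (I : Type) (r : seq I) (P : pred I) (F : I -> A -> 'M[R]_(a, b)) :
  (forall i, P i -> mx_in_subalg (F i)) ->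
  mx_in_subalg (fun x => \sum_(i <- r | P i) F i x).
Proof.
move=> QF i j; have h k : P k -> Q (fun x => F k x i j) by move=> Pk; exact: QF.
by apply: fun_subalg_ext (fun_subalg_sum r h) => x; rewrite summxE.
Qed.

Lemma mx_subalg_tr a (F : A -> 'M[R]_a) : mx_in_subalg F -> Q (fun x => \tr (F x)).
Proof. by move=> QF; apply: fun_subalg_sum => i _; exact: QF. Qed.

(** Determinants and adjugates are polynomial in the entries; through Cramer's rule this makes the
    solution of a linear system measurable. *)
Lemma mx_subalg_det a (F : A -> 'M[R]_a) : mx_in_subalg F -> Q (fun x => \det (F x)).
Proof.
move=> QF; apply: fun_subalg_sum => s _; apply: fun_subalgZ.
by apply: fun_subalg_prod => i _; exact: QF.
Qed.

Lemma mx_subalg_adj a (F : A -> 'M[R]_a) :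
  mx_in_subalg F -> mx_in_subalg (fun x => \adj (F x)).
Proof.
move=> QF i j.
have h : mx_in_subalg (fun x => row' j (col' i (F x))).
  move=> k l; apply: fun_subalg_ext (QF (lift j k) (lift i l)) => x.
  by rewrite !mxE.
apply: fun_subalg_ext (fun_subalgZ ((-1) ^+ (j + i)) (mx_subalg_det h)) => x.
by rewrite mxE.
Qed.

End FunctionAlgebra.

Local Open Scope classical_set_scope.
Local Open Scope ring_scope.

(** * Expectations of bounded random variables *)

Section Mean.
Context {d : measure_display} {T : measurableType d} {R : realType}.
Variable P : probability T R.
Implicit Types (f g h u : T -> R).

Definition mean f : R := Rintegral P setT f.

(** The bound holds at every point and not just almost surely: functions are later evaluated at two
    unrelated sample points, and a pointwise bound keeps every iterated mean meaningful. *)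
Definition bounded_rv f : Prop :=
  measurable_fun setT f /\ exists M : R, forall w, `|f w| <= M.

Lemma bounded_rv_integrable f : bounded_rv f -> P.-integrable setT (EFin \o f).
Proof.
move=> [mf [M bf]]; apply: measurable_bounded_integrable => //.
  by rewrite (le_lt_trans (probability_le1 P measurableT))// ltry.
exists M; split; first by rewrite num_real.
by move=> x Mx w _; apply: le_trans (bf w) (ltW Mx).
Qed.

Lemma bounded_rv_cst (c : R) : bounded_rv (fun=> c).
Proof. by split; [exact: measurable_cst|exists `|c|]. Qed.

Lemma bounded_rvD f g : bounded_rv f -> bounded_rv g -> bounded_rv (fun w => f w + g w).
Proof.
move=> [mf [M Mf]] [mg [N Ng]]; split; first exact: measurable_funD.
by exists (M + N) => w; apply: le_trans (ler_normD _ _) _; apply: lerD.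
Qed.

Lemma bounded_rvM f g : bounded_rv f -> bounded_rv g -> bounded_rv (fun w => f w * g w).
Proof.
move=> [mf [M Mf]] [mg [N Ng]]; split; first exact: measurable_funM.
by exists (M * N) => w; rewrite normrM; apply: ler_pM.
Qed.

Lemma bounded_rvZ c f : bounded_rv f -> bounded_rv (fun w => c * f w).
Proof. by move=> bf; apply: bounded_rvM => //; exact: bounded_rv_cst. Qed.

Lemma bounded_rvN f : bounded_rv f -> bounded_rv (fun w => - f w).
Proof.
by move=> bf; rewrite (_ : (fun w => _) = (fun w => -1 * f w));
  [exact: bounded_rvZ|apply/funext => w; rewrite mulN1r].
Qed.

Lemma bounded_rvX f n : bounded_rv f -> bounded_rv (fun w => f w ^+ n).
Proof.
move=> bf; elim: n => [|n IH]; first exact: bounded_rv_cst.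
rewrite (_ : (fun w => _) = (fun w => f w * f w ^+ n)); first exact: bounded_rvM.
by apply/funext => w; rewrite exprS.
Qed.

Lemma bounded_rv_sum (I : Type) (r : seq I) (Q : pred I) (F : I -> T -> R) :
  (forall i, Q i -> bounded_rv (F i)) -> bounded_rv (fun w => \sum_(i <- r | Q i) F i w).
Proof.
move=> bF; elim: r => [|i r IH].
  rewrite [X in bounded_rv X](_ : _ = fun=> 0); first exact: bounded_rv_cst.
  by apply/funext => w; rewrite big_nil.
rewrite [X in bounded_rv X](_ : _ =
  fun w => if Q i then F i w + \sum_(i <- r | Q i) F i w else \sum_(i <- r | Q i) F i w); last first.
  by apply/funext => w; rewrite big_cons.
by case Qi: (Q i) => //; apply: bounded_rvD => //; exact: bF.
Qed.

Lemma bounded_rv_prod (I : Type) (r : seq I) (Q : pred I) (F : I -> T -> R) :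
  (forall i, Q i -> bounded_rv (F i)) -> bounded_rv (fun w => \prod_(i <- r | Q i) F i w).
Proof.
move=> bF; elim: r => [|i r IH].
  rewrite [X in bounded_rv X](_ : _ = fun=> 1); first exact: bounded_rv_cst.
  by apply/funext => w; rewrite big_nil.
rewrite [X in bounded_rv X](_ : _ =
  fun w => if Q i then F i w * \prod_(i <- r | Q i) F i w else \prod_(i <- r | Q i) F i w); last first.
  by apply/funext => w; rewrite big_cons.
by case Qi: (Q i) => //; apply: bounded_rvM => //; exact: bF.
Qed.

Lemma bounded_rv_indic (A : set T) : measurable A -> bounded_rv (\1_A).
Proof.
move=> mA; split; first exact: measurable_indic.
by exists 1 => w; rewrite indicE; case: (_ \in _); rewrite ?normr1 ?normr0.
Qed.

Lemma mean_cst c : mean (fun=> c) = c.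
Proof.
rewrite /mean Rintegral_cst//.
by rewrite (_ : fine _ = 1) ?mulr1// -[RHS]/(fine 1); congr fine; exact: probability_setT.
Qed.

Lemma meanD f g : bounded_rv f -> bounded_rv g ->
  mean (fun w => f w + g w) = mean f + mean g.
Proof. by move=> bf bg; apply: RintegralD => //; exact: bounded_rv_integrable. Qed.

Lemma meanZ c f : bounded_rv f -> mean (fun w => c * f w) = c * mean f.
Proof. by move=> bf; apply: RintegralZl => //; exact: bounded_rv_integrable. Qed.

Lemma meanN f : bounded_rv f -> mean (fun w => - f w) = - mean f.
Proof.
by move=> bf; rewrite -mulN1r -meanZ//; congr mean; apply/funext => w; rewrite mulN1r.
Qed.

Lemma meanB f g : bounded_rv f -> bounded_rv g ->
  mean (fun w => f w - g w) = mean f - mean g.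
Proof. by move=> bf bg; rewrite meanD ?meanN//; exact: bounded_rvN. Qed.

Lemma mean_sum (I : Type) (r : seq I) (Q : pred I) (F : I -> T -> R) :
  (forall i, Q i -> bounded_rv (F i)) ->
  mean (fun w => \sum_(i <- r | Q i) F i w) = \sum_(i <- r | Q i) mean (F i).
Proof.
move=> bF; elim: r => [|i r IH].
  rewrite big_nil -[RHS]mean_cst; congr mean.
  by apply/funext => w; rewrite big_nil.
rewrite big_cons [X in mean X](_ : _ = fun w => if Q i then
  F i w + \sum_(i <- r | Q i) F i w else \sum_(i <- r | Q i) F i w); last first.
  by apply/funext => w; rewrite big_cons.
case Qi: (Q i) => //; rewrite meanD ?IH//; first exact: bF.
exact: bounded_rv_sum.
Qed.

Lemma mean_ge0 f : (forall w, 0 <= f w) -> 0 <= mean f.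
Proof. by move=> f0; apply: Rintegral_ge0. Qed.

Lemma mean_le f g : bounded_rv f -> bounded_rv g -> (forall w, f w <= g w) ->
  mean f <= mean g.
Proof. by move=> bf bg fg; apply: le_Rintegral => //; exact: bounded_rv_integrable. Qed.

Lemma mean_indic (A : set T) : measurable A -> (mean (\1_A))%:E = P A.
Proof.
move=> mA; rewrite /mean /Rintegral fineK.
  by rewrite integral_indic// setIT.
by rewrite integral_indic// setIT fin_num_measure.
Qed.

Lemma prob_ge_le_mean f (c : R) : bounded_rv f -> (forall w, 0 <= f w) -> 0 < c ->
  (P [set w | (c <= f w)%R] <= (mean f / c)%:E)%E.
Proof.
move=> bf f0 c0.
have mA : measurable [set w | c <= f w].
  rewrite -[X in measurable X]setTI.
  have := @measurable_fun_ler _ _ _ setT (fun=> c) f (measurable_cst _) bf.1.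
  by move=> /(_ measurableT [set true]); apply.
rewrite -mean_indic// lee_fin ler_pdivlMr// mulrC -meanZ; last exact: bounded_rv_indic.
apply: mean_le => //; first by apply: bounded_rvZ; exact: bounded_rv_indic.
move=> w; rewrite indicE; case: (boolP (w \in _)) => [|_]; last by rewrite mulr0.
by rewrite inE/= mulr1.
Qed.

Lemma eq_mean_as (G : set T) f g : measurable G -> P G = 1%E -> measurable_fun setT f ->
  measurable_fun setT g -> (forall w, G w -> f w = g w) -> mean f = mean g.
Proof.
move=> mG PG mf mg fg; rewrite /mean /Rintegral; congr fine.
apply: ae_eq_integral => //; try exact/measurable_EFinP.
exists (~` G); split; first exact: measurableC.
- by have : P (~` G) = 0%E by rewrite probability_setC// PG subee.
- by move=> w /=; apply: contra_not => Gw _; rewrite fg.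
Qed.

Lemma mean_le_as (G : set T) f g : measurable G -> P G = 1%E -> bounded_rv f ->
  bounded_rv g -> (forall w, G w -> f w <= g w) -> mean f <= mean g.
Proof.
move=> mG PG bf bg fg.
have bG : bounded_rv (\1_G) by exact: bounded_rv_indic.
rewrite (@eq_mean_as G f (fun w => f w * \1_G w))//; last 3 first.
- exact: bf.1.
- exact: (bounded_rvM bf bG).1.
- by move=> w Gw; rewrite indicE mem_set// mulr1.
rewrite (@eq_mean_as G g (fun w => g w * \1_G w))//; last 3 first.
- exact: bg.1.
- exact: (bounded_rvM bg bG).1.
- by move=> w Gw; rewrite indicE mem_set// mulr1.
apply: mean_le; try exact: bounded_rvM.
move=> w; rewrite indicE; have [/set_mem Gw|_] := boolP (w \in G).
  by rewrite !mulr1 fg.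
by rewrite !mulr0.
Qed.

End Mean.

(** The sum counts the positive integers up to [y], so it is the integer part of [y]. It serves as
    the staircase that approximates a variable by indicators of its level sets. *)
Lemma sum_levels (R : realType) (y : R) (N : nat) : 0 <= y -> y <= N%:R ->
  let S := \sum_(i < N) ((i.+1%:R <= y)%R%:R : R) in S <= y <= S + 1.
Proof.
move=> y0; have full k : k%:R <= y -> \sum_(i < k) ((i.+1%:R <= y)%R%:R : R) = k%:R.
  move=> ky; rewrite (eq_bigr (fun=> 1)) ?sumr_const ?card_ord// => i _.
  by rewrite (le_trans _ ky)// ler_nat.
elim: N => [|N IH] yN /=; first by rewrite big_ord0 add0r y0 (le_trans yN).
rewrite big_ord_recr/=; have [Ny|yN1] := boolP (N.+1%:R <= y).
  rewrite full; last by rewrite (le_trans _ Ny)// ler_nat.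
  by rewrite /= natr1 Ny/= (le_trans yN)// lerDl.
have [yN'|Ny] := leP y N%:R; first by rewrite /= addr0; exact: IH.
by rewrite full ?(ltW Ny)//= addr0 (ltW Ny) natr1.
Qed.

(** * From independent events to independent variables *)

Section Decoupling.
Context {d : measure_display} {T : measurableType d} {R : realType}.
Variable P : probability T R.
Variable G : set T.
Hypotheses (mG : measurable G) (PG : P G = 1%E).

(** The set [G] where the almost sure bounds hold need not belong to the sigma-algebra generated by
    [C], so a variable truncated off [G] may fail to be measurable for it. Agreement on [G] with a
    measurable [u'] suffices for means, whereas boundedness is asked of [u] itself. *)
Definition adapted (C : set (set T)) (u : T -> R) : Prop :=
  bounded_rv u /\ exists2 u' : T -> R,
    measurable_fun setT (u' : g_sigma_algebraType C -> R) & forall w, G w -> u w = u' w.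

Lemma adapted_cst C c : adapted C (fun=> c).
Proof. by split; [exact: bounded_rv_cst|exists (fun=> c) => //; exact: measurable_cst]. Qed.

Lemma adaptedD C u v : adapted C u -> adapted C v -> adapted C (fun w => u w + v w).
Proof.
move=> [bu [u' mu uu']] [bv [v' mv vv']]; split; first exact: bounded_rvD.
exists (fun w => u' w + v' w) => [|w Gw]; last by rewrite uu'// vv'.
exact: (@measurable_funD _ (g_sigma_algebraType C)).
Qed.

Lemma adaptedM C u v : adapted C u -> adapted C v -> adapted C (fun w => u w * v w).
Proof.
move=> [bu [u' mu uu']] [bv [v' mv vv']]; split; first exact: bounded_rvM.
exists (fun w => u' w * v' w) => [|w Gw]; last by rewrite uu'// vv'.
exact: (@measurable_funM _ (g_sigma_algebraType C)).
Qed.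

(** Both sides are linear in [u] and agree on indicators of sets of [<<s C >>]. On [G], [u] lies
    within [2 M / N] of a staircase with [N] levels, so the two sides differ by [O(1/N)] for every
    [N]. *)
Lemma decoupled_adapted C (h : T -> R) (c : R) : <<s C >> `<=` measurable ->
  bounded_rv h -> (forall A, <<s C >> A -> mean P (fun w => h w * \1_A w) = c * mean P (\1_A)) ->
  forall u, adapted C u -> mean P (fun w => h w * u w) = c * mean P u.
Proof.
move=> Cm bh hA u [bu [u' mu uu']].
have [_ [M0 Mu]] := bu; have [_ [H0 Hh]] := bh.
pose M := `|M0| + 1; pose H := `|H0|.
have M_gt0 : 0 < M by rewrite ltr_wpDl.
have Mu' w : `|u w| <= M by rewrite (le_trans (Mu w))// (le_trans (ler_norm _))// lerDl.
have Hh' w : `|h w| <= H by rewrite (le_trans (Hh w))// ler_norm.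
have key N : (0 < N)%N ->
    `|mean P (fun w => h w * u w) - c * mean P u| <= (2 * M * (H + `|c|)) / N%:R.
  move=> N0.
  have N0' : 0 < N%:R :> R by rewrite ltr0n.
  pose s := 2 * M / N%:R; have s0 : 0 < s by rewrite divr_gt0// mulr_gt0.
  (* The level sets are those of [u']; the level sets of [u] need not lie in [<<s C >>]. *)
  pose A (i : nat) := [set w | - M + s * i.+1%:R <= u' w].
  have CA i : <<s C >> (A i).
    rewrite -[A i]setTI.
    have := @measurable_fun_ler _ (g_sigma_algebraType C) _ setT
      (fun=> - M + s * i.+1%:R) u' (measurable_cst _) mu.
    by move=> /(_ measurableT [set true]); apply.
  have mA i : measurable (A i) by apply: Cm.
  pose v w := - M + \sum_(i < N) s * \1_(A i) w.
  have bA i : bounded_rv (\1_(A i) : T -> R) by exact: bounded_rv_indic.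
  have bv : bounded_rv v.
    by apply: bounded_rvD; [exact: bounded_rv_cst|apply: bounded_rv_sum => i _; exact: bounded_rvZ].
  have vu w : G w -> `|u w - v w| <= s.
    move=> Gw; pose y := (u w + M) / s.
    have y0 : 0 <= y.
      by rewrite divr_ge0 ?(ltW s0)//; have := Mu' w; rewrite ler_norml; lra.
    have yN : y <= N%:R.
      rewrite ler_pdivrMr// /s mulrCA divff ?gt_eqF// mulr1.
      by have := Mu' w; rewrite ler_norml; lra.
    have := sum_levels y0 yN; rewrite /=.
    have -> : \sum_(i < N) ((i.+1%:R <= y)%R%:R : R) = \sum_(i < N) \1_(A i) w.
      apply: eq_bigr => i _; rewrite indicE; congr (_%:R); congr nat_of_bool.
      rewrite ler_pdivlMr//; apply/idP/idP.
        by move=> h1; rewrite inE /A/= -uu'//; lra.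
      by rewrite inE /A/= -uu'//; lra.
    rewrite /v -mulr_sumr; set S := \sum_(_ < _) _ => /andP[h1 h2].
    have uy : u w = s * y - M by rewrite /y mulrC divfK ?gt_eqF// addrK.
    have h3 := ler_wpM2l (ltW s0) h1; have h4 := ler_wpM2l (ltW s0) h2.
    by rewrite uy ler_norml; apply/andP; split; lra.
  have hv : mean P (fun w => h w * v w) = c * mean P v.
    have -> : (fun w => h w * v w) = (fun w => - M * (h w * \1_setT w) + \sum_(i < N) s * (h w * \1_(A i) w)).
      apply/funext => w; rewrite /v indicT mulr1 mulrDr mulr_sumr mulrC; congr (_ + _).
      by apply: eq_bigr => i _; rewrite mulrCA.
    have bT : bounded_rv (\1_setT : T -> R) by exact: bounded_rv_indic.
    rewrite meanD; first last.
    - by apply: bounded_rv_sum => i _; apply: bounded_rvZ; exact: bounded_rvM.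
    - by apply: bounded_rvZ; exact: bounded_rvM.
    rewrite meanZ; last exact: bounded_rvM.
    rewrite mean_sum; last by move=> i _; apply: bounded_rvZ; exact: bounded_rvM.
    rewrite hA; last first.
      have [h0 hC _] := smallest_sigma_algebra setT C.
      by have := hC _ h0; rewrite setD0.
    have -> : mean P (\1_setT) = 1 :> R.
      by rewrite -(mean_cst P 1); congr mean; apply/funext => w; rewrite indicT.
    have -> : mean P v = - M + \sum_(i < N) s * mean P (\1_(A i)).
      rewrite meanD; first last.
      - by apply: bounded_rv_sum => i _; exact: bounded_rvZ.
      - exact: bounded_rv_cst.
      rewrite mean_cst mean_sum; last by move=> i _; exact: bounded_rvZ.
      by congr (_ + _); apply: eq_bigr => i _; rewrite meanZ.
    rewrite mulrDr mulr_sumr mulr1 mulrC; congr (_ + _); apply: eq_bigr => i _.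
    by rewrite meanZ ?hA//; [rewrite mulrCA|exact: bounded_rvM].
  have bd : bounded_rv (fun w => u w - v w) by apply: bounded_rvD => //; exact: bounded_rvN.
  have small k (K : R) : bounded_rv k -> (forall w, `|k w| <= K) ->
      `|mean P (fun w => k w * (u w - v w))| <= K * s.
    move=> bk kK; have bkd := bounded_rvM bk bd.
    have kd w : G w -> `|k w * (u w - v w)| <= K * s.
      by move=> Gw; rewrite normrM; apply: ler_pM => //; exact: vu.
    rewrite ler_norml; apply/andP; split.
      rewrite -[X in X <= _](mean_cst P); apply: (mean_le_as mG PG) => //.
        exact: bounded_rv_cst.
      by move=> w /kd; rewrite ler_norml => /andP[].
    rewrite -[X in _ <= X](mean_cst P); apply: (mean_le_as mG PG) => //.
      exact: bounded_rv_cst.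
    by move=> w /kd; rewrite ler_norml => /andP[].
  have -> : mean P (fun w => h w * u w) - c * mean P u =
     mean P (fun w => h w * (u w - v w)) - mean P (fun w => c * (u w - v w)).
    have -> : (fun w => h w * (u w - v w)) = (fun w => h w * u w - h w * v w).
      by apply/funext => w; rewrite mulrBr.
    rewrite meanB; try exact: bounded_rvM.
    by rewrite meanZ// meanB// hv; lra.
  apply: le_trans (ler_normB _ _) _.
  have -> : 2 * M * (H + `|c|) / N%:R = H * s + `|c| * s by rewrite /s; ring.
  apply: lerD; first exact: small.
  by apply: small => //; exact: bounded_rv_cst.
apply/eqP; rewrite -subr_eq0 -normr_le0; apply/ler_addgt0Pr => e e0; rewrite add0r.
pose K := 2 * M * (H + `|c|).
have K0 : 0 <= K by apply: mulr_ge0; [apply: mulr_ge0 => //; exact: ltW|rewrite addr_ge0 /H].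
have [N hN] : exists N : nat, K / e <= N.+1%:R.
  exists (Num.truncn (K / e)); exact/ltW/truncnS_gt.
apply: le_trans (key N.+1 isT) _.
by rewrite ler_pdivrMr ?ltr0n// -ler_pdivrMl// mulrC.
Qed.

End Decoupling.

(** * Exchanging an independent copy *)

Section Exchange.
Context {d : measure_display} {T : measurableType d} {R : realType}.
Variable P : probability T R.
Variable G : set T.
Hypotheses (mG : measurable G) (PG : P G = 1%E).
Variables (I : finType) (C : I -> set (set T)).
Hypothesis Cm : forall i, <<s C i >> `<=` measurable.
Hypothesis Cind : mutually_independent P (fun i => <<s C i >>).
Local Notation adapted := (adapted G).
Local Notation mean := (mean P).

(** Induction on a list [s] outside which the factors are indicators. When all factors are
    indicators the claim is the definition of independence; freeing one factor is
    [decoupled_adapted], with the product of the other factors in the role of [h]. *)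
Lemma mean_prod (u : I -> T -> R) : (forall i, adapted (C i) (u i)) ->
  mean (fun w => \prod_i u i w) = \prod_i mean (u i).
Proof.
move=> hu.
suff H (s : seq I) : forall v : I -> T -> R, (forall i, i \in s -> adapted (C i) (v i)) ->
    (forall i, i \notin s -> exists2 E, <<s C i >> E & v i = \1_E) ->
    mean (fun w => \prod_i v i w) = \prod_i mean (v i).
  by apply: (H (index_enum I)) => [i _|i]; [exact: hu|rewrite mem_index_enum].
elim: s => [|i s IH] v vA vE.
  have {}vE i : exists E, <<s C i >> E /\ v i = \1_E.
    by have [E ? ?] := vE i isT; exists E.
  have [E hE] := choice vE.
  have mE i : measurable (E i) by exact: Cm (hE i).1.
  have -> : (fun w => \prod_i v i w) = \1_(\bigcap_i E i).
    apply/funext => w; rewrite indicE.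
    have [wE|wE] := boolP (w \in _).
      rewrite big1// => i _; rewrite (hE i).2 indicE mem_set//.
      by move: wE; rewrite inE => /(_ i); exact.
    have [i niE] : exists i, ~ E i w.
      apply: contrapT => h; move/negP: wE; apply; rewrite inE => i _.
      by apply: contrapT => nE; apply: h; exists i.
    by rewrite (bigD1 i)//= (hE i).2 indicE memNset// mul0r.
  apply: EFin_inj; rewrite mean_indic; last by apply: fin_bigcap_measurable => [|i _]; [exact: finite_finset|exact: mE].
  rewrite Cind; last by move=> i; exact: (hE i).1.
  rewrite -prodEFin; apply: eq_bigr => i _.
  by rewrite (hE i).2 (mean_indic P (mE i)).
have [si|nsi] := boolP (i \in s).
  by apply: IH => j js; [apply: vA|apply: vE]; rewrite inE ?js ?orbT// negb_or js andbT; apply: contraNneq js => ->.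
rewrite (bigD1 i)//=.
have bv j : bounded_rv (v j).
  have [js|js] := boolP (j \in i :: s); first by have [] := vA j js.
  by have [E CE ->] := vE j js; apply: bounded_rv_indic; exact: Cm CE.
pose h w := \prod_(j | j != i) v j w.
have -> : (fun w => \prod_j v j w) = (fun w => h w * v i w).
  by apply/funext => w; rewrite (bigD1 i)//= mulrC.
rewrite mulrC; apply: (decoupled_adapted mG PG (@Cm i)) => //.
- by apply: bounded_rv_prod => j _.
- move=> A CA; pose v' j := if j == i then \1_A else v j.
  have v'i : v' i = \1_A by rewrite /v' eqxx.
  have v'j j : j != i -> v' j = v j by move=> /negPf ji; rewrite /v' ji.
  have := IH v'; rewrite (bigD1 i)//= v'i.
  have -> : (fun w => \prod_j v' j w) = (fun w => h w * \1_A w).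
    apply/funext => w; rewrite (bigD1 i)//= v'i mulrC; congr (_ * _).
    by apply: eq_bigr => j /v'j ->.
  move=> ->; first by rewrite mulrC; congr (_ * _); apply: eq_bigr => j /v'j ->.
  + move=> j js; rewrite v'j; last by apply: contraNneq nsi => <-.
    by apply: vA; rewrite inE js orbT.
  + move=> j js; have [->|ji] := eqVneq j i; first by exists A.
    by rewrite v'j//; apply: vE; rewrite inE negb_or ji.
- by apply: vA; rewrite inE eqxx.
Qed.


(** [w0] feeds the blocks other than [l], [w1] feeds block [l], and [w2] an independent copy of
    block [l]. The copy is a further sample point of the same space; the restriction to polynomials
    lets independence do the work of a product measure, since each monomial separates into one
    factor per block. *)
Inductive polyadm (l : I) : (T -> T -> T -> R) -> Prop :=
| polyadm_cst c : polyadm l (fun _ _ _ => c)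
| polyadm0 k u : k != l -> adapted (C k) u -> polyadm l (fun w0 _ _ => u w0)
| polyadm1 u : adapted (C l) u -> polyadm l (fun _ w1 _ => u w1)
| polyadm2 u : adapted (C l) u -> polyadm l (fun _ _ w2 => u w2)
| polyadmD F H : polyadm l F -> polyadm l H ->
    polyadm l (fun w0 w1 w2 => F w0 w1 w2 + H w0 w1 w2)
| polyadmM F H : polyadm l F -> polyadm l H ->
    polyadm l (fun w0 w1 w2 => F w0 w1 w2 * H w0 w1 w2).

Lemma polyadm_normal_form l F : polyadm l F ->
  exists (J : finType) (a : J -> I -> T -> R) (c : J -> T -> R),
    [/\ forall t i, adapted (C i) (a t i), forall t, adapted (C l) (c t) &
      F = fun w0 w1 w2 =>
        \sum_t (\prod_(k | k != l) a t k w0) * a t l w1 * c t w2].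
Proof.
elim => {F} [c|k u kl hu|u hu|u hu|F H _ [J1 [a1 [c1 [ha1 hc1 ->]]]] _ [J2 [a2 [c2 [ha2 hc2 ->]]]]
  |F H _ [J1 [a1 [c1 [ha1 hc1 ->]]]] _ [J2 [a2 [c2 [ha2 hc2 ->]]]]].
- exists unit, (fun _ _ _ => 1), (fun _ _ => c); split=> *; try exact: adapted_cst.
  apply/funext => w0; apply/funext => w1; apply/funext => w2.
  by rewrite (big_pred1 tt)//= big1// !mul1r.
- exists unit, (fun _ j => if j == k then u else fun=> 1), (fun _ _ => 1).
  split=> [t i|*|]; try exact: adapted_cst.
    by case: eqP => [->//|_]; exact: adapted_cst.
  apply/funext => w0; apply/funext => w1; apply/funext => w2.
  rewrite (big_pred1 tt)//= (bigD1 k)//= eqxx big1 => [|i /andP[_ /negPf ->]//].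
  by rewrite eq_sym (negPf kl) !mulr1.
- exists unit, (fun _ j => if j == l then u else fun=> 1), (fun _ _ => 1).
  split=> [t i|*|]; try exact: adapted_cst.
    by case: eqP => [->//|_]; exact: adapted_cst.
  apply/funext => w0; apply/funext => w1; apply/funext => w2.
  by rewrite (big_pred1 tt)//= eqxx big1 ?mul1r ?mulr1// => i /negPf ->.
- exists unit, (fun _ _ _ => 1), (fun _ => u); split=> *; try exact: adapted_cst; try exact: hu.
  apply/funext => w0; apply/funext => w1; apply/funext => w2.
  by rewrite (big_pred1 tt)//= big1// !mul1r.
- exists (J1 + J2)%type, (fun t => match t with inl t => a1 t | inr t => a2 t end),
    (fun t => match t with inl t => c1 t | inr t => c2 t end).
  split=> [[]//|[]//|]; apply/funext => w0; apply/funext => w1; apply/funext => w2.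
  by rewrite big_sumType.
- exists (J1 * J2)%type, (fun t k w => a1 t.1 k w * a2 t.2 k w),
    (fun t w => c1 t.1 w * c2 t.2 w).
  split=> [t i|t|]; try exact: adaptedM.
  apply/funext => w0; apply/funext => w1; apply/funext => w2.
  rewrite big_distrlr/= pair_bigA/=; apply: eq_bigr => t _.
  by rewrite big_split/=; ring.
Qed.

(** The first two arguments are taken at the same sample because all original blocks are read there;
    only the copy is read at the free point. *)
Definition mean3 (F : T -> T -> T -> R) : R :=
  mean (fun w => mean (fun w' => F w w w')).

Lemma adapted_bounded (u : T -> R) i : adapted (C i) u -> bounded_rv u.
Proof. by case. Qed.

Lemma polyadm_bounded2 l F : polyadm l F -> forall w0 w1, bounded_rv (F w0 w1).
Proof.
move=> /polyadm_normal_form[J [a [c [ha hc ->]]]] w0 w1.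
by apply: bounded_rv_sum => t _; apply: bounded_rvZ; have [] := hc t.
Qed.

Lemma polyadm_nf_mean2 l F : polyadm l F ->
  exists (J : finType) (a : J -> I -> T -> R) (c : J -> T -> R),
    [/\ forall t i, adapted (C i) (a t i), forall t, adapted (C l) (c t),
      F = (fun w0 w1 w2 => \sum_t (\prod_(k | k != l) a t k w0) * a t l w1 * c t w2),
      forall w0 w1, mean (F w0 w1) =
        \sum_t (\prod_(k | k != l) a t k w0) * a t l w1 * mean (c t) &
      mean3 F = \sum_t (\prod_k mean (a t k)) * mean (c t)].
Proof.
move=> /polyadm_normal_form[J [a [c [ha hc ->]]]]; exists J, a, c.
have bc t : bounded_rv (c t) by have [] := hc t.
have ba t i : bounded_rv (a t i) by have [] := ha t i.
have E2 w0 w1 : mean (fun w2 =>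
     \sum_t (\prod_(k | k != l) a t k w0) * a t l w1 * c t w2) =
   \sum_t (\prod_(k | k != l) a t k w0) * a t l w1 * mean (c t).
  by rewrite mean_sum => [|t _]; [apply: eq_bigr => t _; rewrite meanZ|exact: bounded_rvZ].
split => //; rewrite /mean3.
have -> : (fun w => mean (fun w' =>
     \sum_t (\prod_(k | k != l) a t k w) * a t l w * c t w')) =
   (fun w => \sum_t mean (c t) * \prod_k a t k w).
  apply/funext => w; rewrite E2.
  by apply: eq_bigr => t _; rewrite [in RHS](bigD1 l)//= [RHS]mulrC; congr (_ * _); rewrite mulrC.
have bp t : bounded_rv (fun w => \prod_k a t k w) by apply: bounded_rv_prod.
rewrite mean_sum => [|t _]; last exact: bounded_rvZ.
by apply: eq_bigr => t _; rewrite meanZ// mean_prod// mulrC.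
Qed.

Lemma polyadm_bounded1 l F : polyadm l F -> bounded_rv (fun w => mean (F w w)).
Proof.
move=> /polyadm_nf_mean2[J [a [c [ha hc FE E2 _]]]].
under eq_fun do rewrite E2.
apply: bounded_rv_sum => t _; apply: bounded_rvM; last exact: bounded_rv_cst.
by apply: bounded_rvM; [apply: bounded_rv_prod => i _|]; apply: adapted_bounded.
Qed.

(** Exchangeability of block [l] and its copy: [c t] is adapted to block [l] as well and may take
    the place of [a t l], so on each monomial both sides are the same product of means. *)
Lemma mean3_swap l F : polyadm l F -> mean3 F = mean3 (fun w0 w1 w2 => F w0 w2 w1).
Proof.
move=> hF; have [J [a [c [ha hc FE E2 E3]]]] := polyadm_nf_mean2 hF.
have bc t : bounded_rv (c t) by have [] := hc t.
have ba t i : bounded_rv (a t i) by have [] := ha t i.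
rewrite E3 FE /mean3.
pose a' t k := if k == l then c t else a t k.
have ha' t k : adapted (C k) (a' t k) by rewrite /a'; case: eqP => [->|].
have ba' t k : bounded_rv (a' t k) by have [] := ha' t k.
have a'l t : a' t l = c t by rewrite /a' eqxx.
have a'k t k : k != l -> a' t k = a t k by move=> /negPf kl; rewrite /a' kl.
have -> : (fun w => mean (fun w' =>
     \sum_t (\prod_(k | k != l) a t k w) * a t l w' * c t w)) =
   (fun w => \sum_t mean (a t l) * \prod_k a' t k w).
  apply/funext => w; rewrite (_ : (fun w' => _) = (fun w' =>
     \sum_t (\prod_(k | k != l) a t k w * c t w) * a t l w')); last first.
    by apply/funext => w'; apply: eq_bigr => t _; ring.
  rewrite mean_sum => [|t _]; last exact: bounded_rvZ.
  apply: eq_bigr => t _; rewrite meanZ// [in RHS](bigD1 l)//= a'l mulrC; congr (_ * _).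
  by rewrite mulrC; congr (_ * _); apply: eq_bigr => k /a'k ->.
have bp t : bounded_rv (fun w => \prod_k a' t k w) by apply: bounded_rv_prod.
rewrite mean_sum => [|t _]; last exact: bounded_rvZ.
apply: eq_bigr => t _; rewrite meanZ// mean_prod// (bigD1 l)//= [in RHS](bigD1 l)//=.
rewrite a'l -mulrA; congr (_ * _); rewrite mulrC; congr (_ * _).
by apply: eq_bigr => k /a'k ->.
Qed.

Lemma mean3_nodep l (F : T -> T -> R) : polyadm l (fun w0 w1 _ => F w0 w1) ->
  mean3 (fun w0 w1 _ => F w0 w1) = mean (fun w => F w w).
Proof. by move=> hF; congr mean; apply/funext => w; rewrite mean_cst. Qed.

(** Fubini for independent blocks: [F] ignores the copy, and after the swap block [l] is the one
    read at the free sample point. *)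
Lemma mean_decouple l (F : T -> T -> R) : polyadm l (fun w0 w1 _ => F w0 w1) ->
  mean (fun w => F w w) = mean (fun w0 => mean (F w0)).
Proof.
by move=> hF; rewrite -(mean3_nodep hF) (mean3_swap hF).
Qed.

Lemma mean3_le l F H : polyadm l F -> polyadm l H ->
  (forall w w', F w w w' <= H w w w') -> mean3 F <= mean3 H.
Proof.
move=> hF hH FH.
apply: mean_le => [||w]; [exact: polyadm_bounded1 hF|exact: polyadm_bounded1 hH|].
by apply: mean_le => //; [exact: polyadm_bounded2 hF _ _|exact: polyadm_bounded2 hH _ _].
Qed.

Lemma mean3D l F H : polyadm l F -> polyadm l H ->
  mean3 (fun w0 w1 w2 => F w0 w1 w2 + H w0 w1 w2) = mean3 F + mean3 H.
Proof.
move=> hF hH; rewrite /mean3 -(meanD P (polyadm_bounded1 hF) (polyadm_bounded1 hH)).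
congr mean; apply/funext => w.
by rewrite (meanD P (polyadm_bounded2 hF _ _) (polyadm_bounded2 hH _ _)).
Qed.

Lemma mean3Z l c F : polyadm l F ->
  mean3 (fun w0 w1 w2 => c * F w0 w1 w2) = c * mean3 F.
Proof.
move=> hF; rewrite /mean3 -(meanZ P _ (polyadm_bounded1 hF)).
by congr mean; apply/funext => w; rewrite (meanZ P _ (polyadm_bounded2 hF _ _)).
Qed.

Lemma polyadmZ l c F : polyadm l F -> polyadm l (fun w0 w1 w2 => c * F w0 w1 w2).
Proof. by move=> hF; apply: polyadmM => //; exact: polyadm_cst. Qed.

Lemma polyadm_ext l F H : (forall w0 w1 w2, F w0 w1 w2 = H w0 w1 w2) ->
  polyadm l F -> polyadm l H.
Proof.
move=> FH; suff -> : F = H by [].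
by apply/funext => w0; apply/funext => w1; apply/funext => w2.
Qed.

Lemma polyadmN l F : polyadm l F -> polyadm l (fun w0 w1 w2 => - F w0 w1 w2).
Proof. by move=> /(polyadmZ (-1)); apply: polyadm_ext => *; rewrite mulN1r. Qed.

Lemma polyadmB l F H : polyadm l F -> polyadm l H ->
  polyadm l (fun w0 w1 w2 => F w0 w1 w2 - H w0 w1 w2).
Proof. by move=> hF /polyadmN hH; exact: polyadmD. Qed.

Lemma polyadmX l F n : polyadm l F -> polyadm l (fun w0 w1 w2 => F w0 w1 w2 ^+ n).
Proof.
move=> hF; elim: n => [|n IH]; first exact: (polyadm_cst l 1).
by apply: polyadm_ext (polyadmM hF IH) => *; rewrite exprS.
Qed.

Lemma polyadm_sum l (J : Type) (r : seq J) (Q : pred J) (F : J -> T -> T -> T -> R) :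
  (forall j, Q j -> polyadm l (F j)) ->
  polyadm l (fun w0 w1 w2 => \sum_(j <- r | Q j) F j w0 w1 w2).
Proof.
move=> hF; elim: r => [|j r IH].
  by apply: polyadm_ext (polyadm_cst l 0) => *; rewrite big_nil.
case Qj: (Q j); last by apply: polyadm_ext IH => *; rewrite big_cons Qj.
by apply: polyadm_ext (polyadmD (hF _ Qj) IH) => *; rewrite big_cons Qj.
Qed.

Lemma polyadm_swap l F : polyadm l F -> polyadm l (fun w0 w1 w2 => F w0 w2 w1).
Proof.
elim => {F}; [exact: polyadm_cst|exact: polyadm0|exact: polyadm2|exact: polyadm1
  |by move=> *; exact: polyadmD|by move=> *; exact: polyadmM].
Qed.

(** Centring [u] amounts to subtracting its value at the copy. The swap changes the sign of that
    difference, so the mean is also given by the form antisymmetrised in [phi], which counts it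
    twice. *)
Lemma mean_cov_exchange l (u : T -> R) (phi : T -> T -> R) : adapted (C l) u ->
  polyadm l (fun w0 w1 _ => phi w0 w1) ->
  2 * mean (fun w => (u w - mean u) * phi w w) =
  mean3 (fun w0 w1 w2 => (u w1 - u w2) * (phi w0 w1 - phi w0 w2)).
Proof.
move=> hu hphi.
have hd : polyadm l (fun _ w1 w2 => u w1 - u w2).
  by apply: polyadmB; [exact: polyadm1|exact: polyadm2].
have h1 := polyadmM hd hphi.
have h2 := polyadmM hd (polyadm_swap hphi).
have e1 : mean (fun w => (u w - mean u) * phi w w) =
    mean3 (fun w0 w1 w2 => (u w1 - u w2) * phi w0 w1).
  congr mean; apply/funext => w.
  have bu : bounded_rv u by have [] := hu.
  have bd : bounded_rv (fun w' => u w - u w').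
    by apply: bounded_rvD; [exact: bounded_rv_cst|exact: bounded_rvN].
  rewrite (_ : (fun w' => _) = (fun w' => phi w w * (u w - u w'))); last first.
    by apply/funext => w'; rewrite mulrC.
  rewrite meanZ// meanB ?mean_cst//; last exact: bounded_rv_cst.
  by rewrite mulrC.
have e2 : mean3 (fun w0 w1 w2 => (u w1 - u w2) * phi w0 w1) =
   - mean3 (fun w0 w1 w2 => (u w1 - u w2) * phi w0 w2).
  rewrite (mean3_swap h1) -mulN1r -(mean3Z (-1) h2); congr mean3.
  by apply/funext => w0; apply/funext => w1; apply/funext => w2; rewrite mulN1r; ring.
have -> : (fun w0 w1 w2 => (u w1 - u w2) * (phi w0 w1 - phi w0 w2)) =
    (fun w0 w1 w2 => (u w1 - u w2) * phi w0 w1 + (-1) * ((u w1 - u w2) * phi w0 w2)).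
  by apply/funext => w0; apply/funext => w1; apply/funext => w2; ring.
by rewrite (mean3D h1 (polyadmZ (-1) h2)) (mean3Z (-1) h2) -e1 mulN1r; lra.
Qed.

End Exchange.

(** * Moments of sums of independent matrices and vectors *)

Section MatrixMean.
Context {d : measure_display} {T : measurableType d} {R : realType}.
Variable P : probability T R.

Lemma bounded_rv_alg : fun_subalg (@bounded_rv d T R).
Proof. by split; [exact: bounded_rv_cst|exact: bounded_rvD|exact: bounded_rvM]. Qed.

Lemma adapted_alg (G : set T) C : fun_subalg (@adapted d T R G C).
Proof. by split; [exact: adapted_cst|exact: adaptedD|exact: adaptedM]. Qed.

Definition mxmean a b (F : T -> 'M[R]_(a, b)) : 'M[R]_(a, b) :=
  \matrix_(i, j) mean P (fun w => F w i j).

Lemma mean_trM a b (M : 'M[R]_(a, b)) (F : T -> 'M[R]_(b, a)) :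
  mx_in_subalg (@bounded_rv d T R) F ->
  mean P (fun w => \tr (M *m F w)) = \tr (M *m mxmean F).
Proof.
move=> bF; rewrite /mxtrace; under eq_fun do under eq_bigr do rewrite mxE.
rewrite mean_sum => [|i _]; last first.
  by apply: bounded_rv_sum => j _; apply: bounded_rvZ; exact: bF.
apply: eq_bigr => i _; rewrite mean_sum => [|j _]; last by apply: bounded_rvZ; exact: bF.
by rewrite mxE; apply: eq_bigr => j _; rewrite meanZ ?mxE//; exact: bF.
Qed.

End MatrixMean.

Lemma mxtr_pairE (R : realType) a b (A B : 'M[R]_(a, b)) :
  \tr (A^T *m B) = \sum_j \sum_i A i j * B i j.
Proof.
by apply: eq_bigr => j _; rewrite mxE; apply: eq_bigr => i _; rewrite mxE.
Qed.

Section MomentRecursions.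
Context {d : measure_display} {T : measurableType d} {R : realType}.
Variable P : probability T R.
Variable G : set T.
Hypotheses (mG : measurable G) (PG : P G = 1%E).
Variables (I : finType) (C : I -> set (set T)).
Hypothesis Cm : forall i, <<s C i >> `<=` measurable.
Hypothesis Cind : mutually_independent P (fun i => <<s C i >>).
Local Notation adapted := (adapted G).
Local Notation mean := (mean P).
Local Notation mean3 := (mean3 P).
Local Notation polyadm := (polyadm G C).
Local Notation mxmean := (mxmean P).
Local Notation bounded_mx := (mx_in_subalg (@bounded_rv d T R)).

Definition polyadm3 l (F : T * T * T -> R) : Prop :=
  polyadm l (fun w0 w1 w2 => F (w0, w1, w2)).

Lemma polyadm_alg l : fun_subalg (polyadm3 l).
Proof.
by split=> [c|f g|f g]; [exact: polyadm_cst|exact: polyadmD|exact: polyadmM].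
Qed.

Lemma mean3_sum l (J : Type) (r : seq J) (F : J -> T -> T -> T -> R) :
  (forall j, polyadm l (F j)) ->
  mean3 (fun w0 w1 w2 => \sum_(j <- r) F j w0 w1 w2) = \sum_(j <- r) mean3 (F j).
Proof.
move=> hF; elim: r => [|j r IH].
  rewrite big_nil -[RHS](mean_cst P); congr mean; apply/funext => w.
  by rewrite -[RHS](mean_cst P); congr mean; apply/funext => w'; rewrite big_nil.
rewrite big_cons -IH.
rewrite -(mean3D mG PG Cm Cind (hF j) (polyadm_sum r (fun j _ => hF j))).
congr mean3; apply/funext => w0; apply/funext => w1; apply/funext => w2.
by rewrite big_cons.
Qed.

Section IndependentSum.
Variables (a b : nat) (X : I -> T -> 'M[R]_(a, b)) (M : 'M[R]_(a, b)).
Hypothesis hX : forall k, mx_in_subalg (adapted (C k)) (X k).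
Hypothesis hM : \sum_k mxmean (X k) = M.

Definition centered_sum w := \sum_k X k w - M.
Definition split_sum l w0 w1 := \sum_(k | k != l) X k w0 + X l w1 - M.

Lemma split_sum_diag l w : split_sum l w w = centered_sum w.
Proof. by rewrite /centered_sum (bigD1 l)//= addrC [X in X - _]addrC addrC. Qed.

Lemma split_sumB l w0 w1 w2 : split_sum l w0 w1 - split_sum l w0 w2 = X l w1 - X l w2.
Proof. by rewrite /split_sum opprB addrA subrK opprD addrACA subrr add0r. Qed.

Lemma bounded_summand k : bounded_mx (X k).
Proof. by move=> i j; have [] := hX k i j. Qed.

Lemma bounded_centered_sum : bounded_mx centered_sum.
Proof.
apply: (mx_subalgB bounded_rv_alg); last exact: (mx_subalg_cst bounded_rv_alg).
by apply: (mx_subalg_sum bounded_rv_alg) => k _; exact: bounded_summand.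
Qed.

Lemma polyadm_summand1 l : mx_in_subalg (polyadm3 l) (fun x => X l x.1.2).
Proof. by move=> i j; exact: (polyadm1 (hX l i j)). Qed.

Lemma polyadm_summand2 l : mx_in_subalg (polyadm3 l) (fun x => X l x.2).
Proof. by move=> i j; exact: (polyadm2 (hX l i j)). Qed.

Lemma polyadm_split_sum l : mx_in_subalg (polyadm3 l) (fun x => split_sum l x.1.1 x.1.2).
Proof.
apply: (mx_subalgB (polyadm_alg l)); last exact: (mx_subalg_cst (polyadm_alg l)).
apply: (mx_subalgD (polyadm_alg l)); last exact: polyadm_summand1.
apply: (mx_subalg_sum (polyadm_alg l)) => k kl i j.
exact: (polyadm0 kl (hX k i j)).
Qed.

(** Each summand is centred at its own mean, and only the total [M] of these means enters. The
    covariance identity is applied to every block and every entry and then summed. *)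
Lemma mean_pair_exchange (Phi : 'M[R]_(a, b) -> 'M[R]_(a, b)) :
  (forall l, mx_in_subalg (polyadm3 l) (fun x => Phi (split_sum l x.1.1 x.1.2))) ->
  bounded_mx (fun w => Phi (centered_sum w)) ->
  2 * mean (fun w => \tr ((centered_sum w)^T *m Phi (centered_sum w))) =
  \sum_l mean3 (fun w0 w1 w2 => \tr ((X l w1 - X l w2)^T *m
     (Phi (split_sum l w0 w1) - Phi (split_sum l w0 w2)))).
Proof.
move=> hPhi bPhi.
have hd l i j : polyadm l (fun _ w1 w2 => X l w1 i j - X l w2 i j).
  by apply: polyadmB; [exact: (polyadm_summand1 l i j)|exact: (polyadm_summand2 l i j)].
have hp l i j : polyadm l (fun w0 w1 w2 =>
    Phi (split_sum l w0 w1) i j - Phi (split_sum l w0 w2) i j).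
  by apply: polyadmB; [exact: (hPhi l i j)|exact: (polyadm_swap (hPhi l i j))].
have hdp l i j := polyadmM (hd l i j) (hp l i j).
transitivity (\sum_l \sum_j \sum_i mean3 (fun w0 w1 w2 =>
   (X l w1 i j - X l w2 i j) *
   (Phi (split_sum l w0 w1) i j - Phi (split_sum l w0 w2) i j))); last first.
  apply: eq_bigr => l _.
  have hs j : polyadm l (fun w0 w1 w2 => \sum_i (X l w1 i j - X l w2 i j) *
     (Phi (split_sum l w0 w1) i j - Phi (split_sum l w0 w2) i j)).
    by apply: polyadm_sum => i _; exact: hdp.
  rewrite (_ : (fun w0 w1 w2 : T => \tr _) = (fun w0 w1 w2 => \sum_j \sum_i
     (X l w1 i j - X l w2 i j) *
     (Phi (split_sum l w0 w1) i j - Phi (split_sum l w0 w2) i j))).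
    rewrite (mean3_sum _ hs); apply: eq_bigr => j _.
    by rewrite (mean3_sum _ (fun i => hdp l i j)).
  apply/funext => w0; apply/funext => w1; apply/funext => w2; rewrite mxtr_pairE.
  by apply: eq_bigr => j _; apply: eq_bigr => i _; rewrite !mxE.
have bX k i j : bounded_rv (fun w => X k w i j) by exact: bounded_summand.
have bc k i j : bounded_rv (fun w => X k w i j - mean (fun w => X k w i j)).
  by apply: bounded_rvD => //; exact: bounded_rv_cst.
have bt k i j : bounded_rv (fun w => (X k w i j - mean (fun w => X k w i j)) *
    Phi (centered_sum w) i j).
  by apply: bounded_rvM => //; exact: bPhi.
have -> : (fun w => \tr ((centered_sum w)^T *m Phi (centered_sum w))) =
   (fun w => \sum_l \sum_j \sum_i (X l w i j - mean (fun w => X l w i j)) *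
      Phi (centered_sum w) i j).
  apply/funext => w; rewrite mxtr_pairE [RHS]exchange_big/=; apply: eq_bigr => j _.
  rewrite [RHS]exchange_big/=; apply: eq_bigr => i _; rewrite -mulr_suml; congr (_ * _).
  rewrite {1}/centered_sum -hM !mxE !summxE -sumrB; apply: eq_bigr => k _.
  by rewrite mxE.
rewrite mean_sum => [|l _]; last by do 2 (apply: bounded_rv_sum => ? _).
rewrite mulr_sumr; apply: eq_bigr => l _.
rewrite mean_sum => [|j _]; last by apply: bounded_rv_sum => ? _.
rewrite mulr_sumr; apply: eq_bigr => j _.
rewrite mean_sum => [|i _//].
rewrite mulr_sumr; apply: eq_bigr => i _.
rewrite -(mean_cov_exchange mG PG Cm Cind (phi := fun w0 w1 => Phi (split_sum l w0 w1) i j)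
  (hX l i j) (hPhi l i j)).
congr (_ * mean _); apply/funext => w; by rewrite /= split_sum_diag.
Qed.

End IndependentSum.

Lemma centered_sum_sym n (Z : I -> T -> 'M[R]_n) M : M^T = M ->
  (forall k w, (Z k w)^T = Z k w) -> forall w, (centered_sum Z M w)^T = centered_sum Z M w.
Proof.
move=> Ms Zs w; rewrite /centered_sum linearB/= linear_sum/= Ms; congr (_ - _).
by apply: eq_bigr => k _; rewrite Zs.
Qed.

Lemma split_sum_sym n (Z : I -> T -> 'M[R]_n) M l : M^T = M ->
  (forall k w, (Z k w)^T = Z k w) ->
  forall w0 w1, (split_sum Z M l w0 w1)^T = split_sum Z M l w0 w1.
Proof.
move=> Ms Zs w0 w1; rewrite /split_sum linearB/= linearD/= linear_sum/= Ms Zs.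
by congr (_ + _ - _); apply: eq_bigr => k _; rewrite Zs.
Qed.

Section TraceMoments.
Variables (n : nat) (Z : I -> T -> 'M[R]_n) (K : R).
Hypothesis hZ : forall k, mx_in_subalg (adapted (C k)) (Z k).
Hypothesis Zsym : forall k w, (Z k w)^T = Z k w.
Hypothesis ZK : forall k w v, nsq (Z k w *m v) <= K * dotc v (Z k w *m v).
Hypothesis EZ : \sum_k mxmean (Z k) = 1.
Local Notation D := (centered_sum Z 1).

Lemma bounded_trace_pow k : bounded_rv (fun w => \tr (D w ^+ k)).
Proof.
apply: (mx_subalg_tr bounded_rv_alg); apply: (mx_subalgX bounded_rv_alg).
exact: bounded_centered_sum.
Qed.

(** Exchange with [Phi M = M^(2h+1)]: [trace_exchange] turns the increments into squares of
    [Z l w1 - Z l w2], and [trace_sq_diff_le] makes these linear in [Z], so that the sum over the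
    blocks can be evaluated. *)
Lemma trace_moment_rec h :
  mean (fun w => \tr (D w ^+ h.+1.*2)) <= h.*2.+1%:R * K *
    (2 * mean (fun w => \tr (D w ^+ h.*2)) + mean (fun w => \tr (D w ^+ h.*2.+1))).
Proof.
have T1 : (1 : 'M[R]_n)^T = 1 by exact: trmx1.
have Ds := centered_sum_sym T1 Zsym.
have Ss l := split_sum_sym l T1 Zsym.
pose N := h.*2.+1.
have pS l := polyadm_split_sum (1 : 'M[R]_n) hZ l.
have pSX l k := mx_subalgX (polyadm_alg l) k (pS l).
have bD := bounded_centered_sum (1 : 'M[R]_n) hZ.
have bDX k := mx_subalgX bounded_rv_alg k bD.
have ex := mean_pair_exchange hZ EZ (Phi := fun M => M ^+ N) (fun l => pSX l N) (bDX N).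
pose H l := fun w0 w1 w2 : T =>
  \tr ((Z l w1 + Z l w2) * split_sum Z 1 l w0 w1 ^+ h.*2).
have p1 l := polyadm_summand1 hZ l.
have p2 l := polyadm_summand2 hZ l.
have pDel l := mx_subalgB (polyadm_alg l) (p1 l) (p2 l).
have pH l : polyadm l (H l) := mx_subalg_tr (polyadm_alg l)
  (mx_subalgM (polyadm_alg l) (mx_subalgD (polyadm_alg l) (p1 l) (p2 l)) (pSX l h.*2)).
pose F l := fun w0 w1 w2 : T =>
  \tr ((Z l w1 - Z l w2) * (Z l w1 - Z l w2) * split_sum Z 1 l w0 w1 ^+ h.*2).
have pF l : polyadm l (F l) := mx_subalg_tr (polyadm_alg l)
  (mx_subalgM (polyadm_alg l) (mx_subalgM (polyadm_alg l) (pDel l) (pDel l)) (pSX l h.*2)).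
pose L l := fun w0 w1 w2 : T => \tr ((Z l w1 - Z l w2)^T *m
     (split_sum Z 1 l w0 w1 ^+ N - split_sum Z 1 l w0 w2 ^+ N)).
have pS2 l : mx_in_subalg (polyadm3 l) (fun x => split_sum Z 1 l x.1.1 x.2 ^+ N).
  by move=> i j; exact: (polyadm_swap (pSX l N i j)).
have pL l : polyadm l (L l) := mx_subalg_tr (polyadm_alg l)
  (mx_subalgM (polyadm_alg l) (mx_subalgT (pDel l))
    (mx_subalgB (polyadm_alg l) (pSX l N) (pS2 l))).
have bZ l := bounded_summand hZ l.
have bZD l : bounded_rv (fun w => \tr (Z l w * D w ^+ h.*2)) :=
  mx_subalg_tr bounded_rv_alg (mx_subalgM bounded_rv_alg (bZ l) (bDX h.*2)).
have bcD (M : 'M[R]_n) : bounded_rv (fun w => \tr (M * D w ^+ h.*2)) :=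
  mx_subalg_tr bounded_rv_alg
    (mx_subalgM bounded_rv_alg (mx_subalg_cst bounded_rv_alg M) (bDX h.*2)).
(* The two traces on the right of [trace_exchange] are images of each other under the swap and have
   equal means, so [F] need only be considered at [split_sum] read at [w0], [w1]. *)
have step l : mean3 (L l) <= N%:R * K * (2 * mean3 (H l)).
  have pFs := polyadm_swap (pF l).
  have h1 : 2 * mean3 (L l) <= N%:R * (mean3 (F l) + mean3 (F l)).
    rewrite [X in _ * (_ + X)](mean3_swap mG PG Cm Cind (pF l)).
    rewrite -(mean3D mG PG Cm Cind (pF l) pFs).
    rewrite -(mean3Z mG PG Cm Cind _ (pL l)).
    rewrite -(mean3Z mG PG Cm Cind _ (polyadmD (pF l) pFs)).
    apply: (mean3_le mG PG Cm Cind (polyadmZ 2 (pL l))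
      (polyadmZ N%:R (polyadmD (pF l) pFs))) => w w'.
    rewrite /L /F -(split_sumB _ 1 _ w w w').
    have sB : (split_sum Z 1 l w w - split_sum Z 1 l w w')^T =
       split_sum Z 1 l w w - split_sum Z 1 l w w'.
      by rewrite linearB/= !Ss.
    rewrite sB; apply: le_trans (trace_exchange h (Ss l w w) (Ss l w w')) _.
    rewrite [X in _ <= _ * (_ + \tr (X * _))](_ : _ =
      (split_sum Z 1 l w w - split_sum Z 1 l w w') *
      (split_sum Z 1 l w w - split_sum Z 1 l w w'))//.
    by rewrite split_sumB -mulrNN !opprB.
  have h2 : mean3 (F l) <= 2 * K * mean3 (H l).
    rewrite -(mean3Z mG PG Cm Cind _ (pH l)).
    apply: (mean3_le mG PG Cm Cind (pF l) (polyadmZ (2 * K) (pH l))) => w w'.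
    exact: trace_sq_diff_le.
  have N0 : 0 <= N%:R :> R by [].
  move: h1 h2 N0; move: (mean3 (L l)) (mean3 (F l)) (mean3 (H l)) (N%:R : R).
  by move=> xL xF xH xN h1 h2 N0; have := ler_wpM2l N0 h2; lra.
have HE l : mean3 (H l) = mean (fun w => \tr (Z l w * D w ^+ h.*2)) +
     mean (fun w => \tr (mxmean (Z l) * D w ^+ h.*2)).
  rewrite -meanD//; congr mean; apply/funext => w; rewrite /H split_sum_diag.
  rewrite (_ : (fun w' => _) = (fun w' => \tr (Z l w * D w ^+ h.*2) +
     \tr (D w ^+ h.*2 *m Z l w'))); last first.
    by apply/funext => w'; rewrite mulrDl mxtraceD [X in _ + X]mxtrace_mulC mulmxE.
  rewrite meanD ?mean_cst ?mean_trM//; first by congr (_ + _); exact: mxtrace_mulC.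
    exact: bounded_rv_cst.
  exact: (mx_subalg_tr bounded_rv_alg (mx_subalgM bounded_rv_alg
    (mx_subalg_cst bounded_rv_alg _) (bZ l))).
(* The matrices [Z l] add up to [D + 1] at the sample, and their means, which come from the copy,
   add up to 1. *)
have sumH : \sum_l mean3 (H l) =
    2 * mean (fun w => \tr (D w ^+ h.*2)) + mean (fun w => \tr (D w ^+ h.*2.+1)).
  under eq_bigr do rewrite HE.
  rewrite big_split/= -!mean_sum; try by [].
  rewrite [X in _ + X](_ : _ = mean (fun w => \tr (D w ^+ h.*2))); last first.
    congr mean; apply/funext => w; rewrite -linear_sum/= -mulr_suml.
    by rewrite EZ mul1r.
  rewrite (_ : (fun w => \sum_l _) = (fun w => \tr (D w ^+ h.*2.+1) + \tr (D w ^+ h.*2))).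
    rewrite meanD; try exact: bounded_trace_pow.
    set x := mean _; set y := mean _.
    by move: x y => x y; lra.
  apply/funext => w; rewrite -linear_sum/= -mulr_suml.
  have -> : \sum_l Z l w = D w + 1 by rewrite /centered_sum subrK.
  by rewrite mulrDl mul1r mxtraceD -exprS.
have hL : \sum_l mean3 (L l) <= N%:R * K * (2 * \sum_l mean3 (H l)).
  by rewrite !mulr_sumr; apply: ler_sum => l _; exact: step.
have -> : mean (fun w => \tr (D w ^+ h.+1.*2)) = mean (fun w => \tr ((D w)^T *m D w ^+ N)).
  by congr mean; apply/funext => w; rewrite Ds mulmxE -exprS doubleS.
by rewrite -(@ler_pM2l _ 2)// ex -sumH mulrCA.
Qed.

End TraceMoments.

End MomentRecursions.

Section MomentBounds.
Context {d : measure_display} {T : measurableType d} {R : realType}.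
Variable P : probability T R.
Variable G : set T.
Hypotheses (mG : measurable G) (PG : P G = 1%E).
Variables (I : finType) (C : I -> set (set T)).
Hypothesis Cm : forall i, <<s C i >> `<=` measurable.
Hypothesis Cind : mutually_independent P (fun i => <<s C i >>).
Local Notation adapted := (adapted G).
Local Notation mean := (mean P).
Local Notation mean3 := (mean3 P).
Local Notation polyadm := (polyadm G C).
Local Notation mxmean := (mxmean P).
Local Notation bounded_mx := (mx_in_subalg (@bounded_rv d T R)).

(** Bounding the odd moment by the half sum of its neighbours leaves
    [mu j.+1 <= x (5/2 mu j + 1/2 mu j.+1)] with [x = (2j+1) K <= 2 p K <= 1/25]. Since
    [(5/2) / (1 - 1/50) < 64/25], the recursion closes with the constant [64/25]. *)
Lemma trace_moment_bound n (Z : I -> T -> 'M[R]_n) (K : R) (p : nat) :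
  (forall k, mx_in_subalg (adapted (C k)) (Z k)) ->
  (forall k w, (Z k w)^T = Z k w) ->
  (forall k w v, nsq (Z k w *m v) <= K * dotc v (Z k w *m v)) ->
  \sum_k mxmean (Z k) = 1 -> 0 <= K -> p%:R * K <= 1 / 50 ->
  mean (fun w => \tr (centered_sum Z 1 w ^+ p.*2)) <= n%:R * (64 / 25 * p%:R * K) ^+ p.
Proof.
move=> hZ Zs ZK EZ K0 pK.
pose mu j := mean (fun w => \tr (centered_sum Z 1 w ^+ j.*2)).
have T1 : (1 : 'M[R]_n)^T = 1 by exact: trmx1.
have Ds := centered_sum_sym T1 Zs.
have mu0 j : 0 <= mu j by apply: mean_ge0 => w; apply: mxtr_even_ge0.
have bT k := bounded_trace_pow hZ k.
have rec j : (j < p)%N -> mu j.+1 <= j.*2.+1%:R * (64 / 25 * K) * mu j.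
  move=> jp; have := trace_moment_rec mG PG Cm Cind hZ Zs ZK EZ j.
  have : 2 * mean (fun w => \tr (centered_sum Z 1 w ^+ j.*2.+1)) <= mu j + mu j.+1.
    rewrite /mu -meanD//; rewrite -meanZ//; apply: mean_le.
    - exact: bounded_rvZ.
    - exact: bounded_rvD.
    - by move=> w; exact: mxtr_odd_le.
  rewrite -/(mu j) -/(mu j.+1); set o := mean _.
  have : j.*2.+1%:R * K <= 1 / 25.
    apply: le_trans (_ : (2 * p%:R) * K <= _); last by move: pK; set y := _ * K; rewrite -mulrA -/y; lra.
    by rewrite ler_wpM2r// -natrM ler_nat mul2n; lia.
  have x0 : 0 <= j.*2.+1%:R * K by rewrite mulr_ge0.
  have -> : j.*2.+1%:R * (64 / 25 * K) * mu j = 64 / 25 * (j.*2.+1%:R * K) * mu j.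
    by ring.
  move: (mu0 j) (mu0 j.+1) x0.
  move: (j.*2.+1%:R * K) (mu j) (mu j.+1) o => x m m' o m0 m0' x0 x4 ho hr.
  have h1 := ler_wpM2r m0' x4.
  have h2 := ler_wpM2l x0 ho.
  have h3 : 0 <= x * m by rewrite mulr_ge0.
  lra.
have main j : (j <= p)%N -> mu j <= n%:R * (64 / 25 * K) ^+ j * \prod_(i < j) i.*2.+1%:R.
  elim: j => [|j IH] jp.
    rewrite big_ord0 expr0 !mulr1 /mu double0.
    by rewrite (_ : (fun w => _) = fun=> n%:R) ?mean_cst//; apply/funext => w; rewrite expr0 mxtrace1.
  apply: le_trans (rec j jp) _; rewrite big_ord_recr/= exprS.
  have c0 : 0 <= j.*2.+1%:R * (64 / 25 * K) by rewrite !mulr_ge0.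
  have := ler_wpM2l c0 (IH (ltnW jp)); lra.
apply: le_trans (main p (leqnn p)) _.
have -> : n%:R * (64 / 25 * p%:R * K) ^+ p = n%:R * (64 / 25 * K) ^+ p * p%:R ^+ p.
  by rewrite -[RHS]mulrA -exprMn; congr (_ * _ ^+ _); ring.
rewrite ler_wpM2l ?prod_odd_le//.
by rewrite mulr_ge0// exprn_ge0// mulr_ge0.
Qed.


Lemma mean_quadratic n (F : T -> 'M[R]_n) (v : 'cV[R]_n) : bounded_mx F ->
  mean (fun w => dotc v (F w *m v)) = dotc v (mxmean F *m v).
Proof.
move=> bF; have e (M : 'M[R]_n) : dotc v (M *m v) = \tr ((v *m v^T) *m M).
  by rewrite -mulmxA mxtrace_mulC /dotc mulmxA [RHS]big_ord1.
under eq_fun do rewrite e.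
by rewrite mean_trM// e.
Qed.

Section Vectors.
Variables (n : nat) (X : I -> T -> 'cV[R]_n).
Hypothesis hX : forall k, mx_in_subalg (adapted (C k)) (X k).
Hypothesis EX : \sum_k mxmean (X k) = 0.
Local Notation V := (centered_sum X 0).
Local Notation V1 l := (split_sum X 0 l).

(** Up to the factor [2 q + 2], the gradient of [|v|^(2q+2)]. *)
Definition powv q (v : 'cV[R]_n) := nsq v ^+ q *: v.

Lemma fun_subalg_dotc (A : Type) (Q : (A -> R) -> Prop) (F H : A -> 'cV[R]_n) :
  fun_subalg Q -> mx_in_subalg Q F -> mx_in_subalg Q H -> Q (fun x => dotc (F x) (H x)).
Proof. by move=> Qa QF QH; exact: (mx_subalgM Qa (mx_subalgT QF) QH 0 0). Qed.

Lemma fun_subalg_nsqX (A : Type) (Q : (A -> R) -> Prop) (F : A -> 'cV[R]_n) q :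
  fun_subalg Q -> mx_in_subalg Q F -> Q (fun x => nsq (F x) ^+ q).
Proof. by move=> Qa QF; apply: (fun_subalgX Qa); exact: fun_subalg_dotc. Qed.

Lemma bounded_nsqX q : bounded_rv (fun w => nsq (V w) ^+ q).
Proof.
apply: (fun_subalg_nsqX q bounded_rv_alg); exact: bounded_centered_sum.
Qed.

Lemma nsq_moment_exchange q :
  2 * mean (fun w => nsq (V w) ^+ q.+1) = \sum_l mean3 (fun w0 w1 w2 =>
    dotc (X l w1 - X l w2) (powv q (V1 l w0 w1) - powv q (V1 l w0 w2))).
Proof.
have pS l := polyadm_split_sum 0 hX l.
have bV := bounded_centered_sum 0 hX.
have h l := mx_subalgZ (polyadm_alg G C l) (fun_subalg_nsqX q (polyadm_alg G C l) (pS l)) (pS l).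
have b := mx_subalgZ bounded_rv_alg (fun_subalg_nsqX q bounded_rv_alg bV) bV.
have := mean_pair_exchange mG PG Cm Cind hX EX (Phi := powv q) h b.
have tr1 (u v : 'cV[R]_n) : \tr (u^T *m v) = dotc u v by rewrite /mxtrace big_ord1.
rewrite (_ : (fun w => \tr _) = (fun w => nsq (V w) ^+ q.+1)); last first.
  by apply/funext => w; rewrite tr1 /powv dotcZr exprSr.
move=> ->; apply: eq_bigr => l _; congr mean3.
by apply/funext => w0; apply/funext => w1; apply/funext => w2; rewrite tr1.
Qed.

Section StrongVariance.
Variable (s : I -> R).
Hypothesis EX0 : forall k, mxmean (X k) = 0.
Hypothesis Xs : forall k w, nsq (X k w) = s k.

(** As the summands have constant length, [|X l w - X l w'|^2] equals [2 s l - 2 <X l w, X l w'>],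
    and the inner product has mean zero in [w']. No random variance factor survives. *)
Lemma strong_moment_rec q : mean (fun w => nsq (V w) ^+ q.+1) <=
  q.*2.+1%:R * (\sum_k s k) * mean (fun w => nsq (V w) ^+ q).
Proof.
have pS l := polyadm_split_sum 0 hX l.
have p1 l := polyadm_summand1 hX l.
have p2 l := polyadm_summand2 hX l.
have pD l := mx_subalgB (polyadm_alg G C l) (p1 l) (p2 l).
pose F l := fun w0 w1 w2 : T => nsq (X l w1 - X l w2) * nsq (V1 l w0 w1) ^+ q.
have pF l : polyadm l (F l) := fun_subalgM (polyadm_alg G C l)
  (fun_subalg_dotc (polyadm_alg G C l) (pD l) (pD l)) (fun_subalg_nsqX q (polyadm_alg G C l) (pS l)).
pose L l := fun w0 w1 w2 =>
    dotc (X l w1 - X l w2) (powv q (V1 l w0 w1) - powv q (V1 l w0 w2)).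
have pp l := mx_subalgZ (polyadm_alg G C l) (fun_subalg_nsqX q (polyadm_alg G C l) (pS l)) (pS l).
have pp2 l : mx_in_subalg (polyadm3 G C l) (fun x => powv q (V1 l x.1.1 x.2)).
  by move=> i j; exact: (polyadm_swap (pp l i j)).
have pL l : polyadm l (L l) := fun_subalg_dotc (polyadm_alg G C l) (pD l)
  (mx_subalgB (polyadm_alg G C l) (pp l) (pp2 l)).
have step l : mean3 (L l) <= q.*2.+1%:R * mean3 (F l).
  have pFs := polyadm_swap (pF l).
  have : 2 * mean3 (L l) <= q.*2.+1%:R * (mean3 (F l) + mean3 (F l)).
    rewrite [X in _ * (_ + X)](mean3_swap mG PG Cm Cind (pF l)).
    rewrite -(mean3D mG PG Cm Cind (pF l) pFs).
    rewrite -(mean3Z mG PG Cm Cind _ (pL l)).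
    rewrite -(mean3Z mG PG Cm Cind _ (polyadmD (pF l) pFs)).
    apply: (mean3_le mG PG Cm Cind (polyadmZ 2 (pL l))
      (polyadmZ _ (polyadmD (pF l) pFs))) => w w'.
    rewrite /L /F -(split_sumB _ 0 _ w w w').
    apply: le_trans (vec_exchange_strong _ _ q) _.
    rewrite -mulrA mulrDr split_sumB ler_wpM2l// lerD2l.
    by rewrite -(nsqN (X l w' - _)) opprB.
  move: (mean3 (L l)) (mean3 (F l)) (q.*2.+1%:R : R) => x y z; lra.
have FE l : mean3 (F l) = 2 * s l * mean (fun w => nsq (V w) ^+ q).
  rewrite -meanZ; last exact: bounded_nsqX.
  congr mean; apply/funext => w; rewrite /F split_sum_diag.
  have bX := bounded_summand hX l.
  rewrite (_ : (fun w' => _) = (fun w' => nsq (V w) ^+ q * (2 * s l) +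
    (- 2 * nsq (V w) ^+ q) * dotc (X l w) (X l w'))); last first.
    by apply/funext => w'; rewrite nsqB !Xs; ring.
  have bd : bounded_rv (fun w' => dotc (X l w) (X l w')).
    by apply: (fun_subalg_dotc bounded_rv_alg) => //; exact: (mx_subalg_cst bounded_rv_alg).
  rewrite meanD; [|exact: bounded_rv_cst|exact: bounded_rvZ].
  rewrite mean_cst meanZ//.
  have -> : mean (fun w' => dotc (X l w) (X l w')) = 0.
    have := @mean_trM _ _ _ P _ _ (X l w)^T (X l) bX.
    rewrite EX0 mulmx0 mxtrace0 => h; rewrite -[RHS]h; congr mean.
    by apply/funext => w'; rewrite /mxtrace big_ord1.
  by rewrite mulr0 addr0 mulrC.
have hA : 2 * mean (fun w => nsq (V w) ^+ q.+1) = \sum_l mean3 (L l) :=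
  nsq_moment_exchange q.
have : \sum_l mean3 (L l) <= \sum_l q.*2.+1%:R * mean3 (F l).
  by apply: ler_sum => l _; exact: step.
rewrite -hA; under [X in _ <= X]eq_bigr do rewrite FE.
rewrite -mulr_sumr -mulr_suml -mulr_sumr.
move: (mean _) (mean _) (\sum_i _) (q.*2.+1%:R : R) => x y S N; lra.
Qed.

(** A Khintchine inequality: the recursion yields the Gaussian constant [(2p-1)!!], rounded up to
    [p^p]. *)
Lemma strong_moment_bound p :
  mean (fun w => nsq (V w) ^+ p) <= (p%:R * \sum_k s k) ^+ p.
Proof.
have s0 k : 0 <= s k.
  by rewrite -(mean_cst P (s k)); apply: mean_ge0 => w; rewrite -(Xs k w) nsq_ge0.
have S0 : 0 <= \sum_k s k by apply: sumr_ge0.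
have main j : mean (fun w => nsq (V w) ^+ j) <= (\sum_k s k) ^+ j * \prod_(i < j) i.*2.+1%:R.
  elim: j => [|j IH].
    rewrite big_ord0 expr0 mulr1 (_ : (fun w => _) = fun=> 1) ?mean_cst//.
  apply: le_trans (strong_moment_rec j) _; rewrite big_ord_recr/= exprS.
  have c0 : 0 <= j.*2.+1%:R * \sum_k s k by rewrite mulr_ge0.
  have := ler_wpM2l c0 IH; set x := mean _; lra.
apply: le_trans (main p) _; rewrite exprMn mulrC ler_wpM2r ?prod_odd_le//.
exact: exprn_ge0.
Qed.

End StrongVariance.

End Vectors.

End MomentBounds.

(** * Moments of vector sums with small weak variance *)

Section WeakVariance.
Context {d : measure_display} {T : measurableType d} {R : realType}.
Variable P : probability T R.
Variable G : set T.
Hypotheses (mG : measurable G) (PG : P G = 1%E).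
Variables (I : finType) (C : I -> set (set T)).
Hypothesis Cm : forall i, <<s C i >> `<=` measurable.
Hypothesis Cind : mutually_independent P (fun i => <<s C i >>).
Local Notation adapted := (adapted G).
Local Notation mean := (mean P).
Local Notation mean3 := (mean3 P).
Local Notation polyadm := (polyadm G C).
Local Notation mxmean := (mxmean P).
Local Notation bounded_mx := (mx_in_subalg (@bounded_rv d T R)).

Variables (n : nat) (X : I -> T -> 'cV[R]_n) (Z : I -> T -> 'M[R]_n) (t : I -> T -> R).
Variables (K g : R).
Hypothesis hX : forall k, mx_in_subalg (adapted (C k)) (X k).
Hypothesis hZ : forall k, mx_in_subalg (adapted (C k)) (Z k).
Hypothesis ht : forall k, adapted (C k) (t k).
Hypothesis EX : \sum_k mxmean (X k) = 0.
Hypothesis EZ : \sum_k mxmean (Z k) = 1.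
Hypothesis Et : \sum_k mean (t k) = 1.
Hypothesis g0 : 0 <= g.
Hypothesis K0 : 0 < K.
Hypothesis tg : forall k w, 0 <= t k w <= g.
Hypothesis XK : forall k w, nsq (X k w) <= K * t k w.
Hypothesis Xg : forall k w v, dotc (X k w) v ^+ 2 <= g * dotc v (Z k w *m v).
Hypothesis Zsym : forall k w, (Z k w)^T = Z k w.
Hypothesis ZK : forall k w v, nsq (Z k w *m v) <= K * dotc v (Z k w *m v).
Local Notation V := (centered_sum X 0).
Local Notation V1 l := (split_sum X 0 l).
Local Notation D := (centered_sum Z 1).
Local Notation de w := (\sum_k t k w - 1).

(** Adding the contributions of the sample and of the copy, the quadratic forms of the [Z l] sum to
    [2 |V|^2 + <V, D V>] and the weights to [2 + de]. The terms that carry [q.+1] also carry [g];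
    the term with [K] alone does not. *)
Lemma weak_moment_rec q :
  mean (fun w => nsq (V w) ^+ q.+2) <= mean (fun w =>
    4 * g * q.+1%:R * (2 * nsq (V w) + dotc (V w) (D w *m V w)) * nsq (V w) ^+ q
    + 4 * K ^+ 2 * g * q.+1%:R * (2 + de w) * nsq (V w) ^+ q
    + K * (2 + de w) * nsq (V w) ^+ q.+1).
Proof.
have pS l := polyadm_split_sum 0 hX l.
have p1 l := polyadm_summand1 hX l.
have p2 l := polyadm_summand2 hX l.
have z1 l := polyadm_summand1 hZ l.
have z2 l := polyadm_summand2 hZ l.
have pD l := mx_subalgB (polyadm_alg G C l) (p1 l) (p2 l).
have pn k l := fun_subalg_nsqX k (polyadm_alg G C l) (pS l).
have pn2 k l : polyadm l (fun w0 w1 w2 => nsq (V1 l w0 w2) ^+ k).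
  exact: (polyadm_swap (pn k l)).
have bV := bounded_centered_sum 0 hX.
have bn k := fun_subalg_nsqX k bounded_rv_alg bV.
have bt k : bounded_rv (t k) by have [] := ht k.
have bZ k := bounded_summand hZ k.
pose a (v : 'cV[R]_n) := 4 * q.+1%:R * g * nsq v ^+ q.
pose b (v : 'cV[R]_n) := 4 * q.+1%:R * K ^+ 2 * g * nsq v ^+ q + K * nsq v ^+ q.+1.
pose H l := fun w0 w1 w2 => a (V1 l w0 w1) *
     (dotc (V1 l w0 w1) (Z l w1 *m V1 l w0 w1) + dotc (V1 l w0 w1) (Z l w2 *m V1 l w0 w1)) +
   b (V1 l w0 w1) * (t l w1 + t l w2).
have pH l : polyadm l (H l).
  have pa := polyadmZ (4 * q.+1%:R * g) (pn q l).
  have pb := polyadmD (polyadmZ (4 * q.+1%:R * K ^+ 2 * g) (pn q l)) (polyadmZ K (pn q.+1 l)).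
  have pz1 : polyadm l (fun w0 w1 w2 => dotc (V1 l w0 w1) (Z l w1 *m V1 l w0 w1)) :=
    fun_subalg_dotc (polyadm_alg G C l) (pS l) (mx_subalgM (polyadm_alg G C l) (z1 l) (pS l)).
  have pz2 : polyadm l (fun w0 w1 w2 => dotc (V1 l w0 w1) (Z l w2 *m V1 l w0 w1)) :=
    fun_subalg_dotc (polyadm_alg G C l) (pS l) (mx_subalgM (polyadm_alg G C l) (z2 l) (pS l)).
  exact: (polyadmD (polyadmM pa (polyadmD pz1 pz2))
    (polyadmM pb (polyadmD (polyadm1 (ht l)) (polyadm2 (ht l))))).
pose L l := fun w0 w1 w2 =>
    dotc (X l w1 - X l w2) (powv q.+1 (V1 l w0 w1) - powv q.+1 (V1 l w0 w2)).
have pp l := mx_subalgZ (polyadm_alg G C l) (pn q.+1 l) (pS l).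
have pp2 l : mx_in_subalg (polyadm3 G C l) (fun x => powv q.+1 (V1 l x.1.1 x.2)).
  by move=> i j; exact: (polyadm_swap (pp l i j)).
have pL l : polyadm l (L l) := fun_subalg_dotc (polyadm_alg G C l) (pD l)
  (mx_subalgB (polyadm_alg G C l) (pp l) (pp2 l)).
pose F l := fun w0 w1 w2 : T =>
  q.+1%:R * (nsq (V1 l w0 w1) - nsq (V1 l w0 w2)) ^+ 2 * nsq (V1 l w0 w1) ^+ q +
  2 * nsq (X l w1 - X l w2) * nsq (V1 l w0 w1) ^+ q.+1.
have pF l : polyadm l (F l).
  have pd : polyadm l (fun w0 w1 w2 => nsq (V1 l w0 w1) - nsq (V1 l w0 w2)).
    exact: (polyadmB (pn 1%N l) (pn2 1%N l)).
  exact: (polyadmD (polyadmM (polyadmZ q.+1%:R (polyadmX 2 pd)) (pn q l))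
    (polyadmM (polyadmZ 2 (fun_subalg_dotc (polyadm_alg G C l) (pD l) (pD l))) (pn q.+1 l))).
have V2E l w w' : V1 l w w' = V1 l w w - (X l w - X l w').
  by rewrite -(split_sumB _ 0 _ w) opprB addrC subrK.
have LF l : 2 * mean3 (L l) <= mean3 (F l).
  have pFs := polyadm_swap (pF l).
  have : 4 * mean3 (L l) <= mean3 (F l) + mean3 (F l).
    rewrite [X in _ <= _ + X](mean3_swap mG PG Cm Cind (pF l)).
    rewrite -(mean3D mG PG Cm Cind (pF l) pFs).
    rewrite -(mean3Z mG PG Cm Cind _ (pL l)).
    apply: (mean3_le mG PG Cm Cind (polyadmZ 4 (pL l)) (polyadmD (pF l) pFs)) => w w'.
    rewrite /L /F -(nsqN (X l w' - _)) opprB -(split_sumB _ 0 _ w w w').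
    apply: le_trans (vec_exchange_weak _ _ q) _.
    move: (nsq (V1 l w w)) (nsq (V1 l w w')) (nsq _) (q.+1%:R : R) => x y e N.
    by rewrite le_eqVlt; apply/orP; left; apply/eqP; ring.
  move: (mean3 (L l)) (mean3 (F l)) => x y; lra.
have FH l : mean3 (F l) <= 4 * mean3 (H l).
  rewrite -(mean3Z mG PG Cm Cind _ (pH l)).
  apply: (mean3_le mG PG Cm Cind (pF l) (polyadmZ 4 (pH l))) => w w'.
  rewrite /F /H /a /b.
  have h1 := nsq_increment_le g0 (ltW K0) (tg l w) (tg l w') (XK l w) (XK l w')
    (Xg l w (V1 l w w)) (Xg l w' (V1 l w w)).
  have h2 : nsq (X l w - X l w') <= 2 * K * (t l w + t l w').
    have := nsqB_le (X l w) (X l w'); have := XK l w; have := XK l w'.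
    by move: (nsq _) (nsq _) (nsq _) => x y z; lra.
  rewrite (V2E l w w'); move: h1 h2.
  have x0 := nsq_ge0 (V1 l w w).
  have c0 : 0 <= q.+1%:R * nsq (V1 l w w) ^+ q by rewrite mulr_ge0// exprn_ge0.
  have c1 : 0 <= 2 * nsq (V1 l w w) ^+ q.+1 by rewrite mulr_ge0// exprn_ge0.
  move=> /(ler_wpM2l c0) h1 /(ler_wpM2l c1) h2.
  have := lerD h1 h2; rewrite -subr_ge0 => h3; rewrite -subr_ge0; apply: le_trans h3 _.
  by rewrite le_eqVlt; apply/orP; left; apply/eqP; ring.
have HE l : mean3 (H l) = mean (fun w => a (V w) * (dotc (V w) (Z l w *m V w) +
     dotc (V w) (mxmean (Z l) *m V w)) + b (V w) * (t l w + mean (t l))).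
  congr mean; apply/funext => w; rewrite /H split_sum_diag.
  set v := V w; rewrite (_ : (fun w' => _) = (fun w' =>
    (a v * dotc v (Z l w *m v) + b v * t l w) + (a v * dotc v (Z l w' *m v) + b v * t l w'))).
    have bq : bounded_rv (fun w' => dotc v (Z l w' *m v)).
      have hc : bounded_mx (fun=> v) := mx_subalg_cst bounded_rv_alg v.
      exact: (fun_subalg_dotc bounded_rv_alg hc (mx_subalgM bounded_rv_alg (bZ l) hc)).
    rewrite meanD; [|exact: bounded_rv_cst|by apply: bounded_rvD; exact: bounded_rvZ].
    rewrite mean_cst meanD; [|exact: bounded_rvZ|exact: bounded_rvZ].
    rewrite (meanZ _ _ bq) (meanZ _ _ (bt l)) (mean_quadratic _ _ (bZ l)).
    by ring.
  by apply/funext => w'; ring.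
have ex : 2 * mean (fun w => nsq (V w) ^+ q.+2) = \sum_l mean3 (L l) :=
  nsq_moment_exchange mG PG Cm Cind hX EX q.+1.
have le1 : 2 * mean (fun w => nsq (V w) ^+ q.+2) <= 2 * \sum_l mean3 (H l).
  rewrite ex mulr_sumr; apply: ler_sum => l _; have := LF l; have := FH l.
  by move: (mean3 (L l)) (mean3 (H l)) (mean3 (F l)) => x y z; lra.
rewrite -(ler_pM2l (_ : 0 < 2))//; apply: le_trans le1 _; rewrite ler_pM2l//.
have bq l : bounded_rv (fun w => a (V w) * (dotc (V w) (Z l w *m V w) +
     dotc (V w) (mxmean (Z l) *m V w)) + b (V w) * (t l w + mean (t l))).
  have ba := bounded_rvZ (4 * q.+1%:R * g) (bn q).
  have bb := bounded_rvD (bounded_rvZ (4 * q.+1%:R * K ^+ 2 * g) (bn q)) (bounded_rvZ K (bn q.+1)).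
  have d1 := fun_subalg_dotc bounded_rv_alg bV (mx_subalgM bounded_rv_alg (bZ l) bV).
  have d2 := fun_subalg_dotc bounded_rv_alg bV
    (mx_subalgM bounded_rv_alg (mx_subalg_cst bounded_rv_alg (mxmean (Z l))) bV).
  exact: (bounded_rvD (bounded_rvM ba (bounded_rvD d1 d2))
     (bounded_rvM bb (bounded_rvD (bt l) (bounded_rv_cst _)))).
under eq_bigr do rewrite HE.
rewrite -mean_sum//; rewrite le_eqVlt; apply/orP; left; apply/eqP.
congr mean; apply/funext => w; rewrite big_split/= -!mulr_sumr !big_split/= Et.
have qs (M : I -> 'M[R]_n) v : \sum_l dotc v (M l *m v) = dotc v ((\sum_l M l) *m v).
  by rewrite mulmx_suml dotcC dotc_suml; apply: eq_bigr => l _; rewrite dotcC.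
rewrite !qs EZ mul1mx.
have -> : \sum_l Z l w = D w + 1 by rewrite /centered_sum subrK.
rewrite mulmxDl mul1mx dotcDr -/(nsq _) /a /b exprS; ring.
Qed.

(** The weights are nonnegative matrices of size one, so the trace bound applies with [g] in place
    of [K]. *)
Lemma mean_total_weight_dev p : p%:R * g <= 1 / 50 ->
  mean (fun w => de w ^+ p.*2) <= (64 / 25 * p%:R * g) ^+ p.
Proof.
move=> pg; pose Z1 k w : 'M[R]_1 := (t k w)%:M.
have hZ1 k : mx_in_subalg (adapted (C k)) (Z1 k).
  by move=> i j; apply: fun_subalg_ext (ht k) => w; rewrite !ord1 mxE.
have Z1s k w : (Z1 k w)^T = Z1 k w by rewrite tr_scalar_mx.
have Z1K k w v : nsq (Z1 k w *m v) <= g * dotc v (Z1 k w *m v).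
  rewrite mul_scalar_mx nsqZ dotcZr -/(nsq v) mulrA ler_wpM2r ?nsq_ge0//.
  by have /andP[t0 t1] := tg k w; rewrite expr2 ler_wpM2r.
have EZ1 : \sum_k mxmean (Z1 k) = 1.
  apply/matrixP => i j; rewrite !ord1 summxE !mxE -Et; apply: eq_bigr => k _.
  by rewrite mxE; congr mean; apply/funext => w; rewrite mxE.
have := trace_moment_bound mG PG Cm Cind hZ1 Z1s Z1K EZ1 g0 pg.
rewrite mul1r; apply: le_trans.
rewrite le_eqVlt; apply/orP; left; apply/eqP; congr mean; apply/funext => w.
have -> : centered_sum Z1 1 w = (de w)%:M.
  apply/matrixP => i j; rewrite !ord1 !mxE summxE; congr (_ - _).
  by apply: eq_bigr => k _; rewrite mxE.
have -> (x : R) k : (x%:M : 'M[R]_1) ^+ k = (x ^+ k)%:M.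
  elim: k => [|k IH]; first by rewrite !expr0.
  by rewrite exprS IH -mulmxE -scalar_mxM exprS.
by rewrite mxtrace_scalar.
Qed.

(** In contrast with [trace_moment_bound], the base of the power contains no factor [p]: the term of
    the recursion without [g] is absorbed by [weak_young], and the others are small by the
    hypotheses on [g]. *)
Lemma weak_moment_bound q : let p := q.+2 in
  p%:R * K <= 1 / 50 -> q.+1%:R * g * 50 <= K -> p%:R * g <= 1 / 2500 ->
  n%:R * (34 / 100) ^+ p <= 1 / 3 :> R ->
  mean (fun w => nsq (V w) ^+ p) <= (34 / 10 * K) ^+ p.
Proof.
move=> p pK qg pg np.
have Ds := centered_sum_sym (trmx1 _ _) Zsym.
have p0 : 0 <= p%:R :> R by [].
have bV := bounded_centered_sum 0 hX.
have bD := bounded_centered_sum 1 hZ.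
have bn k := fun_subalg_nsqX k bounded_rv_alg bV.
have bT := bounded_trace_pow hZ p.*2.
have bt k : bounded_rv (t k) by have [] := ht k.
have bde : bounded_rv (fun w => de w).
  by apply: bounded_rvD; [exact: bounded_rv_sum|exact: bounded_rv_cst].
have bdeX k := bounded_rvX k bde.
have bdV := fun_subalg_dotc bounded_rv_alg bV (mx_subalgM bounded_rv_alg bD bV).
set rhs := (fun w => 4 * g * q.+1%:R * (2 * nsq (V w) + dotc (V w) (D w *m V w)) * nsq (V w) ^+ q
    + 4 * K ^+ 2 * g * q.+1%:R * (2 + de w) * nsq (V w) ^+ q
    + K * (2 + de w) * nsq (V w) ^+ q.+1).
have brhs : bounded_rv rhs.
  have b2 := bounded_rvD (bounded_rv_cst 2) bde.
  have b1 := bounded_rvD (bounded_rvZ 2 (bn 1%N)) bdV.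
  exact: (bounded_rvD (bounded_rvD (bounded_rvM (bounded_rvZ (4 * g * q.+1%:R) b1) (bn q))
    (bounded_rvM (bounded_rvZ (4 * K ^+ 2 * g * q.+1%:R) b2) (bn q)))
    (bounded_rvM (bounded_rvZ K b2) (bn q.+1))).
pose c1 : R := K ^+ p * (10 / 3) ^+ p; pose c2 : R := K ^+ p * (p%:R * (1 / 625)).
pose rh2 w := c1 + c2 * 3 + (c1 * 2 ^+ p.*2 + c2) * de w ^+ p.*2 +
  c1 / 64 ^+ p * \tr (D w ^+ p.*2) + q.+1%:R * nsq (V w) ^+ p.
have brh2 : bounded_rv rh2.
  by repeat first [exact: bounded_rv_cst | exact: bT | exact: bdeX | exact: bn |
    apply: bounded_rvD | apply: bounded_rvZ].
(* After averaging, the last term of [rh2] moves to the left, where the moment has coefficient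
   [p = q.+1 + 1]; exactly one copy of it remains. *)
have pt w : p%:R * rhs w <= rh2 w.
  have := @weak_young R q (nsq (V w)) (dotc (V w) (D w *m V w)) (de w)
    (\tr (D w ^+ p.*2)) K g K0 g0 (nsq_ge0 _) (mxtr_even_ge0 _ (Ds w)) qg.
  move=> /(_ _ _)/le_trans; apply.
  - by apply: le_trans pg; rewrite ler_wpM2r// ler_nat.
  - rewrite -/p -mul2n exprM.
    apply: le_trans (_ : (nsq (V w) * nsq (D w *m V w)) ^+ p <= _).
      by rewrite lerXn2r ?nnegrE ?sqr_ge0 ?mulr_ge0 ?nsq_ge0// cauchy_schwarz.
    have -> : nsq (V w) ^+ (2 * p) = nsq (V w) ^+ p * nsq (V w) ^+ p.
      by rewrite mul2n -addnn exprD.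
    rewrite exprMn -[leRHS]mulrA ler_wpM2l ?exprn_ge0 ?nsq_ge0// mul2n.
    exact: nsq_mul_trace_pow.
  rewrite -/p /rh2 /c1 /c2 [(2 * de w) ^+ _]exprMn le_eqVlt; apply/orP; left; apply/eqP; ring.
have A := weak_moment_rec q; rewrite -/p -/rhs in A.
have B : p%:R * mean rhs <= mean rh2.
  by rewrite -meanZ//; apply: mean_le => //; exact: bounded_rvZ.
have Erh2 : mean rh2 = c1 + c2 * 3 + (c1 * 2 ^+ p.*2 + c2) * mean (fun w => de w ^+ p.*2) +
  c1 / 64 ^+ p * mean (fun w => \tr (D w ^+ p.*2)) + q.+1%:R * mean (fun w => nsq (V w) ^+ p).
  rewrite /rh2 meanD; [|by repeat first [exact: bounded_rv_cst | exact: bT | exact: bdeX |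
     apply: bounded_rvD | apply: bounded_rvZ]|exact: bounded_rvZ].
  rewrite meanD; [|by repeat first [exact: bounded_rv_cst | exact: bdeX |
     apply: bounded_rvD | apply: bounded_rvZ]|exact: bounded_rvZ].
  rewrite meanD; [|exact: bounded_rv_cst|exact: bounded_rvZ].
  by rewrite mean_cst !meanZ.
have T20 : 0 <= mean (fun w => \tr (D w ^+ p.*2)).
  by apply: mean_ge0 => w; exact: mxtr_even_ge0.
have d20 : 0 <= mean (fun w => de w ^+ p.*2).
  by apply: mean_ge0 => w; rewrite -mul2n exprM exprn_ge0// sqr_ge0.
have small (y : R) : 0 <= y <= 1 -> y ^+ p <= y.
  by move=> /andP[y0 y1]; rewrite exprS ler_piMr// exprn_ile1.
have Mde : 2 ^+ p.*2 * mean (fun w => de w ^+ p.*2) <= 1 / 200.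
  have h : mean (fun w => de w ^+ p.*2) <= (64 / 25 * p%:R * g) ^+ p.
    by apply: mean_total_weight_dev; move: (_ * g) pg => y; lra.
  apply: le_trans (_ : 2 ^+ p.*2 * (64 / 25 * p%:R * g) ^+ p <= _).
    by rewrite ler_wpM2l// exprn_ge0.
  rewrite -mul2n exprM -exprMn.
  have y0 : 0 <= p%:R * g by rewrite mulr_ge0.
  have e : 2 ^+ 2 * (64 / 25 * p%:R * g) <= 1 / 200.
    by rewrite -[64 / 25 * _ * _]mulrA expr2; move: (p%:R * g) pg => y; lra.
  have e' : 0 <= 2 ^+ 2 * (64 / 25 * p%:R * g) by rewrite mulr_ge0// -mulrA mulr_ge0.
  apply: (le_trans _ e); apply: small; rewrite e'/=; apply: (le_trans e); lra.
(* The dimension [n] enters here through the trace. Division by [64 ^+ p] turns the base into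
   [p K / 25 <= 1/1250], which is below [34/100 * 1/400]; by [np], the power of the first factor
   absorbs [n]. *)
have MT : mean (fun w => \tr (D w ^+ p.*2)) / 64 ^+ p <= 1 / 500.
  have h := trace_moment_bound mG PG Cm Cind hZ Zsym ZK EZ (ltW K0) pK.
  rewrite ler_pdivrMr ?exprn_gt0//; apply: le_trans h _.
  rewrite -ler_pdivrMr ?exprn_gt0// -[leLHS]mulrA -expr_div_n.
  have y0 : 0 <= p%:R * K by rewrite mulr_ge0// ltW.
  have e : 64 / 25 * p%:R * K / 64 <= 34 / 100 * (1 / 400).
    by rewrite -[64 / 25 * _ * _]mulrA; move: (p%:R * K) pK => y; lra.
  have e' : 0 <= 64 / 25 * p%:R * K / 64 by rewrite divr_ge0// -mulrA mulr_ge0.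
  apply: le_trans (_ : n%:R * (34 / 100 * (1 / 400)) ^+ p <= _).
    by rewrite ler_wpM2l// lerXn2r// nnegrE; apply: le_trans e' e.
  rewrite exprMn mulrA; apply: le_trans (_ : 1 / 3 * (1 / 400) <= _); last by lra.
  have h4 : 0 <= 1 / 400 :> R by apply: divr_ge0; [exact: ler01|exact: ler0n].
  apply: ler_pM; [|exact: exprn_ge0|exact: np|].
    by apply: mulr_ge0 => //; apply: exprn_ge0; rewrite divr_ge0.
  by apply: small; rewrite h4/=; lra.
have Kp0 : 0 <= K ^+ p by rewrite exprn_ge0// ltW.
have A1 : 2%:R ^+ p <= (10 / 3) ^+ p :> R by rewrite lerXn2r ?nnegrE//; lra.
have A2 : p%:R <= (10 / 3) ^+ p :> R.
  by apply: le_trans A1; rewrite -natrX ler_nat ltnW// ltn_expl.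
(* [34/10] exceeds [10/3] by the factor [51/50], whose square is at least [104/100]; this uses
   [2 <= p]. The margin pays for the deviations and for the term linear in [p]. *)
have A3 : 104 / 100 * (10 / 3) ^+ p <= (34 / 10) ^+ p :> R.
  have -> : 34 / 10 = 51 / 50 * (10 / 3) :> R by lra.
  rewrite [(51 / 50 * (10 / 3)) ^+ p]exprMn ler_wpM2r ?exprn_ge0 ?divr_ge0//.
  have h : (51 / 50) ^+ 2 <= (51 / 50) ^+ p :> R by rewrite ler_weXn2l//; lra.
  by apply: le_trans h; rewrite expr2; lra.
have pE : p%:R = q.+1%:R + 1 :> R by rewrite /p natr1.
have one2 : 1 <= 2 ^+ p.*2 :> R by rewrite exprn_ege1// ler1n.
have Mde' : mean (fun w => de w ^+ p.*2) <= 1 / 200.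
  by apply: le_trans Mde; rewrite ler_peMl.
rewrite [(34 / 10 * K) ^+ p]exprMn mulrC; apply: le_trans (_ : K ^+ p * (101 / 100 * (10 / 3) ^+ p +
   p%:R * (1 / 625) * (301 / 100)) <= _); last first.
  by rewrite ler_wpM2l//; move: A2 A3 p0; move: ((10 / 3) ^+ p) ((34 / 10) ^+ p) (p%:R : R) => x y z; lra.
have c10 : 0 <= c1 by rewrite mulr_ge0// exprn_ge0// divr_ge0.
have c20 : 0 <= c2.
  apply: mulr_ge0; [exact: Kp0|apply: mulr_ge0; [exact: p0|]].
  by apply: divr_ge0; [exact: ler01|exact: ler0n].
have f1 := ler_wpM2l c10 Mde; have f2 := ler_wpM2l c20 Mde'; have f3 := ler_wpM2l c10 MT.
have f4 := ler_wpM2l p0 A.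
have -> : K ^+ p * (101 / 100 * (10 / 3) ^+ p + p%:R * (1 / 625) * (301 / 100)) =
  101 / 100 * c1 + 301 / 100 * c2 by rewrite /c1 /c2; ring.
move: f1 f2 f3 f4 B c10 c20; rewrite Erh2 pE.
set m := mean (fun w => nsq (V w) ^+ p); set md := mean (fun w => de w ^+ p.*2).
set mr := mean rhs; set mt := mean (fun w => \tr (D w ^+ p.*2)).
have -> : c1 / 64 ^+ p * mt = c1 * (mt / 64 ^+ p) by ring.
move: (mt / 64 ^+ p) => s.
have -> : (c1 * 2 ^+ p.*2 + c2) * md = c1 * (2 ^+ p.*2 * md) + c2 * md by ring.
move: (2 ^+ p.*2 * md) => y.
clearbody m md mr mt rhs rh2 c1 c2; move: (q.+1%:R : R) => N; lra.
Qed.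

End WeakVariance.

(** * Moments of subsampled Gram matrices *)

Section GramBound.
Variables (R : realFieldType) (a b : nat) (M : 'M[R]_(a, b)) (L : R).
Hypothesis L0 : 0 <= L.
Hypothesis ML : forall v, nsq (M^T *m (M *m v)) <= L ^+ 2 * nsq v.

Lemma nsq_mul_le_gram v : nsq (M *m v) <= L * nsq v.
Proof.
have := cauchy_schwarz v (M^T *m (M *m v)).
rewrite dotc_mulmx trmxK -/(nsq _) => h.
rewrite -(@ler_pXn2r _ 2)// ?nnegrE ?mulr_ge0 ?nsq_ge0//; apply: le_trans h _.
rewrite exprMn [nsq v ^+ 2]expr2 mulrA [leRHS]mulrC ler_wpM2l ?nsq_ge0//.
Qed.

(** Duality: [|M^T u|^2 = <u, M M^T u> <= |u| |M (M^T u)|], where the bound for [M] is applied to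
    [M^T u] and a factor is divided out. *)
Lemma nsq_trmul_le_gram u : nsq (M^T *m u) <= L * nsq u.
Proof.
have [->|y0] := eqVneq (nsq (M^T *m u)) 0; first by rewrite mulr_ge0 ?nsq_ge0.
have y1 : 0 < nsq (M^T *m u) by rewrite lt_neqAle eq_sym y0 nsq_ge0.
have := cauchy_schwarz u (M *m (M^T *m u)).
rewrite dotc_mulmx -/(nsq _) => h.
rewrite -(ler_pM2l y1) -expr2; apply: le_trans h _.
apply: le_trans (ler_wpM2l (nsq_ge0 u) (nsq_mul_le_gram (M^T *m u))) _.
by rewrite le_eqVlt; apply/orP; left; apply/eqP; ring.
Qed.

End GramBound.

Section RealSetting.
Context {d : measure_display} {T : measurableType d} {R : realType}.
Variable P : probability T R.
Variable G : set T.
Hypotheses (mG : measurable G) (PG : P G = 1%E).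
Variables (m : nat) (C : 'I_m -> set (set T)).
Hypothesis m0 : (0 < m)%N.
Hypothesis Cm : forall i, <<s C i >> `<=` measurable.
Hypothesis Cind : mutually_independent P (fun i => <<s C i >>).
Local Notation adapted := (adapted G).
Local Notation mean := (mean P).
Local Notation mxmean := (mxmean P).
Local Notation bounded_mx := (mx_in_subalg (@bounded_rv d T R)).

Lemma mxmean_mul a b c e (M : 'M[R]_(a, b)) (F : T -> 'M[R]_(b, c)) (N : 'M[R]_(c, e)) :
  bounded_mx F -> mxmean (fun w => M *m F w *m N) = M *m mxmean F *m N.
Proof.
move=> bF; apply/matrixP => i j; rewrite !mxE.
rewrite (_ : (fun w => _) = (fun w => \sum_k (\sum_l M i l * F w l k) * N k j)); last first.
  by apply/funext => w; rewrite !mxE; apply: eq_bigr => k _; rewrite mxE.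
have bi k : bounded_rv (fun w => \sum_l M i l * F w l k).
  by apply: bounded_rv_sum => l _; apply: bounded_rvZ; exact: bF.
rewrite mean_sum => [|k _]; last by apply: bounded_rvM => //; exact: bounded_rv_cst.
apply: eq_bigr => k _; rewrite (_ : (fun w => _) =
  (fun w => N k j * \sum_l M i l * F w l k)); last by apply/funext => w; rewrite mulrC.
rewrite meanZ// mulrC !mxE; congr (_ * _); rewrite mean_sum => [|l _].
  by apply: eq_bigr => l _; rewrite meanZ ?mxE//; exact: bF.
by apply: bounded_rvZ; exact: bF.
Qed.

Variables (p : 'I_m -> nat) (n s : nat).
Variables (Br : forall l, T -> 'M[R]_(p l, n)) (E : 'M[R]_(n, s)) (Lam Gam : R).
Hypothesis hBr : forall l, mx_in_subalg (adapted (C l)) (Br l).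
Hypothesis EE : E^T *m E = 1%:M.
Hypotheses (Lam0 : 0 < Lam) (Gam0 : 0 < Gam).
Hypothesis BrLam : forall l w v,
  nsq ((Br l w *m E)^T *m (Br l w *m E *m v)) <= Lam ^+ 2 * nsq v.

Definition gram_part l w : 'M[R]_n := m%:R^-1 *: ((Br l w)^T *m Br l w).
Hypothesis EW : \sum_l mxmean (gram_part l) = 1%:M.
Local Notation Z l w := (E^T *m gram_part l w *m E).
Local Notation K := (Lam / m%:R).
Local Notation g := (Gam / m%:R).

Let mr0 : 0 < m%:R :> R. Proof. by rewrite ltr0n. Qed.
Let mV0 : 0 <= m%:R^-1 :> R. Proof. by rewrite invr_ge0 ltW. Qed.
Let K0 : 0 < K. Proof. by rewrite divr_gt0. Qed.

Lemma adapted_gram l : mx_in_subalg (adapted (C l)) (gram_part l).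
Proof.
have Qa := adapted_alg (T := T) (R := R) G (C l).
have h := mx_subalgZ Qa (fun_subalg_cst Qa m%:R^-1)
  (mx_subalgM Qa (mx_subalgT (@hBr l)) (@hBr l)).
by move=> i j; exact: (h i j).
Qed.

Lemma adapted_mul l a b (M : 'M[R]_(a, n)) (N : 'M[R]_(n, b)) :
  mx_in_subalg (adapted (C l)) (fun w => M *m gram_part l w *m N).
Proof.
have Qa := adapted_alg (T := T) (R := R) G (C l).
exact: (mx_subalgM Qa (mx_subalgM Qa (mx_subalg_cst Qa M) (adapted_gram l))
  (mx_subalg_cst Qa N)).
Qed.

Lemma sum_mxmean_gram a b (M : 'M[R]_(a, n)) (N : 'M[R]_(n, b)) :
  \sum_l mxmean (fun w => M *m gram_part l w *m N) = M *m N.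
Proof.
rewrite (eq_bigr (fun l => M *m mxmean (gram_part l) *m N)) => [|l _].
  by rewrite -mulmx_suml -mulmx_sumr EW mulmx1.
by apply: mxmean_mul => i j; have [] := adapted_gram l i j.
Qed.

Lemma ZE l w (v : 'cV[R]_s) : Z l w *m v = m%:R^-1 *: ((Br l w *m E)^T *m (Br l w *m E *m v)).
Proof. by rewrite /gram_part -scalemxAr -!scalemxAl trmx_mul !mulmxA. Qed.

Lemma dotc_ZE l w (v : 'cV[R]_s) : dotc v (Z l w *m v) = m%:R^-1 * nsq (Br l w *m E *m v).
Proof. by rewrite ZE dotcZr dotc_mulmx trmxK. Qed.

Lemma Zsym l w : (Z l w)^T = Z l w.
Proof. by rewrite /gram_part !trmx_mul trmxK linearZ/= trmx_mul trmxK mulmxA. Qed.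

Lemma ZK l w (v : 'cV[R]_s) : nsq (Z l w *m v) <= K * dotc v (Z l w *m v).
Proof.
rewrite dotc_ZE ZE nsqZ.
have := nsq_trmul_le_gram (ltW Lam0) (BrLam l w) (Br l w *m E *m v).
move=> /(ler_wpM2l (_ : 0 <= m%:R^-1 ^+ 2)) h; apply: le_trans (h _) _.
  by rewrite exprn_ge0.
by rewrite le_eqVlt; apply/orP; left; apply/eqP; ring.
Qed.

Lemma gram_trace_moment q : q%:R * K <= 1 / 50 ->
  mean (fun w => \tr ((\sum_l Z l w - 1) ^+ q.*2)) <= s%:R * (64 / 25 * q%:R * K) ^+ q.
Proof.
move=> qK; have EZ : \sum_l mxmean (fun w => Z l w) = 1 by rewrite sum_mxmean_gram EE.
have hZ l := adapted_mul l E^T E.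
exact: (trace_moment_bound mG PG Cm Cind hZ Zsym ZK EZ (ltW K0) qK).
Qed.

(** The weight [t l] is the energy of block [l] in the direction [e]. The operator bound [Lam] on
    the support gives [|X|^2 <= K t], while the column bound [Gam] controls [t] itself and, by
    Cauchy-Schwarz, every projection of [X]: this is how [Gam] becomes the weak variance. *)
Lemma cross_moment (e : 'cV[R]_n) q : let pp := q.+2 in
  E^T *m e = 0 -> nsq e = 1 -> (forall l w, nsq (Br l w *m e) <= Gam) ->
  pp%:R * K <= 1 / 50 -> q.+1%:R * g * 50 <= K -> pp%:R * g <= 1 / 2500 ->
  s%:R * (34 / 100) ^+ pp <= 1 / 3 :> R ->
  mean (fun w => nsq (\sum_l E^T *m gram_part l w *m e) ^+ pp) <= (34 / 10 * K) ^+ pp.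
Proof.
move=> pp Ee e1 BG h1 h2 h3 h4.
pose t l w := dotc e (gram_part l w *m e).
have tE l w : t l w = m%:R^-1 * nsq (Br l w *m e).
  by rewrite /t /gram_part -scalemxAl dotcZr -mulmxA dotc_mulmx trmxK.
have XE l w : E^T *m gram_part l w *m e = m%:R^-1 *: ((Br l w *m E)^T *m (Br l w *m e)).
  by rewrite /gram_part -scalemxAr -!scalemxAl trmx_mul !mulmxA.
have ht l : adapted (C l) (t l).
  have := adapted_mul l e^T e 0 0; apply: fun_subalg_ext => w.
  by rewrite /t /dotc mulmxA.
have Et : \sum_l mean (t l) = 1.
  rewrite -e1 /nsq /dotc -(sum_mxmean_gram e^T e) summxE; apply: eq_bigr => l _.
  by rewrite mxE; congr mean; apply/funext => w; rewrite /t /dotc mulmxA.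
have EZ : \sum_l mxmean (fun w => Z l w) = 1 by rewrite sum_mxmean_gram EE.
have EX : \sum_l mxmean (fun w => E^T *m gram_part l w *m e) = 0 by rewrite sum_mxmean_gram.
have g0 : 0 <= g by rewrite divr_ge0// ltW.
have tg l w : 0 <= t l w <= g.
  by rewrite tE mulr_ge0 ?nsq_ge0//= [g]mulrC ler_wpM2l.
have XK l w : nsq (E^T *m gram_part l w *m e) <= K * t l w.
  rewrite XE nsqZ tE.
  have := nsq_trmul_le_gram (ltW Lam0) (BrLam l w) (Br l w *m e).
  move=> /(ler_wpM2l (_ : 0 <= m%:R^-1 ^+ 2)) h; apply: le_trans (h _) _.
    by rewrite exprn_ge0.
  by rewrite le_eqVlt; apply/orP; left; apply/eqP; ring.
have Xg l w v : dotc (E^T *m gram_part l w *m e) v ^+ 2 <= g * dotc v (Z l w *m v).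
  rewrite dotc_ZE XE dotcZl -dotc_mulmx exprMn.
  have := cauchy_schwarz (Br l w *m e) (Br l w *m E *m v).
  have := ler_wpM2r (nsq_ge0 (Br l w *m E *m v)) (BG l w) => ha hb.
  have := ler_wpM2l (_ : 0 <= m%:R^-1 ^+ 2) (le_trans hb ha) => h.
  apply: le_trans (h _) _; first by rewrite exprn_ge0.
  by rewrite le_eqVlt; apply/orP; left; apply/eqP; ring.
have := weak_moment_bound mG PG Cm Cind (fun l => adapted_mul l E^T e)
  (fun l => adapted_mul l E^T E) ht EX EZ Et g0 K0 tg XK Xg Zsym ZK h1 h2 h3 h4.
apply: le_trans; rewrite le_eqVlt; apply/orP; left; apply/eqP.
by congr mean; apply/funext => w; rewrite /centered_sum subr0.
Qed.

End RealSetting.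

Local Open Scope complex_scope.

(** * Realification of complex matrices *)

Section Realification.
Variable R : realType.
Implicit Types (x y z : R[i]).

Lemma crealD x y : creal (x + y) = creal x + creal y. Proof. by case: x y => [? ?] []. Qed.
Lemma cimagD x y : cimag (x + y) = cimag x + cimag y. Proof. by case: x y => [? ?] []. Qed.
Lemma crealN x : creal (- x) = - creal x. Proof. by case: x. Qed.
Lemma cimagN x : cimag (- x) = - cimag x. Proof. by case: x. Qed.
Lemma crealM x y : creal (x * y) = creal x * creal y - cimag x * cimag y.
Proof. by case: x y => [? ?] []. Qed.
Lemma cimagM x y : cimag (x * y) = creal x * cimag y + cimag x * creal y.
Proof. by case: x y => [? ?] []. Qed.
Lemma creal_conj x : creal (cconj x) = creal x. Proof. by case: x. Qed.
Lemma cimag_conj x : cimag (cconj x) = - cimag x. Proof. by case: x. Qed.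
Lemma creal_real (a : R) : creal a%:C = a. Proof. by []. Qed.
Lemma cimag_real (a : R) : cimag a%:C = 0. Proof. by []. Qed.

Definition cE := (crealD, cimagD, crealN, cimagN, crealM, cimagM, creal_conj, cimag_conj,
  creal_real, cimag_real).

Lemma cplx_eq x y : creal x = creal y -> cimag x = cimag y -> x = y.
Proof. by case: x y => [a b] [a' b'] /= -> ->. Qed.

Lemma creal_sum (I : Type) (r : seq I) (P : pred I) (F : I -> R[i]) :
  creal (\sum_(i <- r | P i) F i) = \sum_(i <- r | P i) creal (F i).
Proof. exact: (big_morph (@creal R) crealD erefl). Qed.

Lemma cimag_sum (I : Type) (r : seq I) (P : pred I) (F : I -> R[i]) :
  cimag (\sum_(i <- r | P i) F i) = \sum_(i <- r | P i) cimag (F i).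
Proof. exact: (big_morph (@cimag R) cimagD erefl). Qed.

Lemma cconjK : involutive (@cconj R).
Proof. by case=> a b; rewrite /cconj /= opprK. Qed.

Lemma cconjD x y : cconj (x + y) = cconj x + cconj y.
Proof. by apply: cplx_eq; rewrite !cE; lra. Qed.

Lemma cconjM x y : cconj (x * y) = cconj x * cconj y.
Proof. by apply: cplx_eq; rewrite !cE; ring. Qed.

Lemma cconj_sum (I : Type) (r : seq I) (P : pred I) (F : I -> R[i]) :
  cconj (\sum_(i <- r | P i) F i) = \sum_(i <- r | P i) cconj (F i).
Proof. by apply: (big_morph (@cconj R) cconjD); apply: cplx_eq; rewrite /= ?oppr0. Qed.

Lemma cabs2_ge0 x : 0 <= cabs2 x.
Proof. by rewrite addr_ge0// sqr_ge0. Qed.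

Lemma cabs2M x y : cabs2 (x * y) = cabs2 x * cabs2 y.
Proof. by rewrite /cabs2 !cE; ring. Qed.

Lemma cabs2_conj x : cabs2 (cconj x) = cabs2 x.
Proof. by rewrite /cabs2 !cE; ring. Qed.

Lemma cmod_ge0 x : 0 <= cmod x. Proof. exact: sqrtr_ge0. Qed.

Lemma cmodM x y : cmod (x * y) = cmod x * cmod y.
Proof. by rewrite /cmod cabs2M sqrtrM// cabs2_ge0. Qed.

Lemma cmod_conj x : cmod (cconj x) = cmod x.
Proof. by rewrite /cmod cabs2_conj. Qed.

Lemma sqr_cmod x : cmod x ^+ 2 = cabs2 x.
Proof. by rewrite sqr_sqrtr// cabs2_ge0. Qed.

Lemma cmod_real (a : R) : 0 <= a -> cmod a%:C = a.
Proof. by move=> a0; rewrite /cmod /cabs2 !cE expr0n/= addr0 sqrtr_sqr ger0_norm. Qed.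

Lemma creal_le_cmod x : creal x <= cmod x.
Proof.
apply: le_trans (ler_norm _) _; rewrite -sqrtr_sqr ler_sqrt ?cabs2_ge0//.
by rewrite lerDl sqr_ge0.
Qed.

Lemma adjmxE p q (M : 'M[R[i]]_(p, q)) i j : adjmx M i j = cconj (M j i).
Proof. by rewrite mxE. Qed.

Lemma adjmxK p q (M : 'M[R[i]]_(p, q)) : adjmx (adjmx M) = M.
Proof. by apply/matrixP => i j; rewrite !mxE cconjK. Qed.

Lemma adjmxM p q k (M : 'M[R[i]]_(p, q)) (N : 'M[R[i]]_(q, k)) :
  adjmx (M *m N) = adjmx N *m adjmx M.
Proof.
apply/matrixP => i j; rewrite !mxE cconj_sum; apply: eq_bigr => l _.
by rewrite !mxE cconjM mulrC.
Qed.

Definition realify_vec k (v : 'cV[R[i]]_k) : 'cV[R]_(k + k) :=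
  col_mx (map_mx (@creal R) v) (map_mx (@cimag R) v).

Definition realify_mx p q (M : 'M[R[i]]_(p, q)) : 'M[R]_(p + p, q + q) :=
  block_mx (map_mx (@creal R) M) (- map_mx (@cimag R) M)
           (map_mx (@cimag R) M) (map_mx (@creal R) M).

Definition complexify_vec k (u : 'cV[R]_(k + k)) : 'cV[R[i]]_k :=
  \col_i (usubmx u i 0 +i* dsubmx u i 0).

Lemma complexify_vecK k (u : 'cV[R]_(k + k)) : realify_vec (complexify_vec u) = u.
Proof.
rewrite /realify_vec -[RHS]vsubmxK; congr col_mx; apply/colP => i;
  by rewrite mxE [complexify_vec u i 0]mxE.
Qed.

Lemma realify_vec_inj k : injective (@realify_vec k).
Proof.
move=> u v /eq_col_mx[/matrixP ur /matrixP ui]; apply/colP => i.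
by apply: cplx_eq; [have := ur i 0|have := ui i 0]; rewrite !mxE.
Qed.

Lemma map_creal_mul p q k (M : 'M[R[i]]_(p, q)) (N : 'M[R[i]]_(q, k)) :
  map_mx (@creal R) (M *m N) = map_mx (@creal R) M *m map_mx (@creal R) N -
    map_mx (@cimag R) M *m map_mx (@cimag R) N.
Proof.
apply/matrixP => i j; rewrite !mxE creal_sum -sumrB; apply: eq_bigr => l _.
by rewrite !mxE crealM.
Qed.

Lemma map_cimag_mul p q k (M : 'M[R[i]]_(p, q)) (N : 'M[R[i]]_(q, k)) :
  map_mx (@cimag R) (M *m N) = map_mx (@creal R) M *m map_mx (@cimag R) N +
    map_mx (@cimag R) M *m map_mx (@creal R) N.
Proof.
apply/matrixP => i j; rewrite !mxE cimag_sum -big_split; apply: eq_bigr => l _.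
by rewrite !mxE cimagM.
Qed.

Lemma realify_mulmx p q k (M : 'M[R[i]]_(p, q)) (N : 'M[R[i]]_(q, k)) :
  realify_mx (M *m N) = realify_mx M *m realify_mx N.
Proof.
rewrite /realify_mx mulmx_block map_creal_mul map_cimag_mul !mulmxN !mulNmx opprD.
by rewrite [in RHS]addrC [X in _ = block_mx _ _ _ X]addrC; congr block_mx; rewrite // addrC.
Qed.

Lemma realify_mulmx_vec p q (M : 'M[R[i]]_(p, q)) (v : 'cV[R[i]]_q) :
  realify_vec (M *m v) = realify_mx M *m realify_vec v.
Proof.
by rewrite /realify_vec mul_block_col map_creal_mul map_cimag_mul mulNmx [X in col_mx _ X = _]addrC.
Qed.

Lemma realify_adj p q (M : 'M[R[i]]_(p, q)) : realify_mx (adjmx M) = (realify_mx M)^T.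
Proof.
rewrite /realify_mx tr_block_mx; congr block_mx; apply/matrixP => i j; rewrite !mxE.
all: by case: (M j i) => a b /=; rewrite ?opprK.
Qed.

Lemma realify_vecD k (u v : 'cV[R[i]]_k) :
  realify_vec (u + v) = realify_vec u + realify_vec v.
Proof.
rewrite /realify_vec add_col_mx; congr col_mx; apply/matrixP => i j; rewrite !mxE.
  exact: crealD. exact: cimagD.
Qed.

Lemma realify_vecN k (v : 'cV[R[i]]_k) : realify_vec (- v) = - realify_vec v.
Proof.
rewrite /realify_vec opp_col_mx; congr col_mx; apply/matrixP => i j; rewrite !mxE.
  exact: crealN. exact: cimagN.
Qed.

Lemma realify_mx1 k : realify_mx (1%:M : 'M[R[i]]_k) = 1%:M.
Proof.
rewrite /realify_mx (scalar_mx_block k k); congr block_mx; apply/matrixP => i j; rewrite !mxE.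
all: by case: (i == j); rewrite //= ?mulr1n ?mulr0n ?oppr0.
Qed.

(** Real part of the Hermitian inner product, which is all that the duality arguments use. *)
Definition rdot k (u v : 'cV[R[i]]_k) : R := dotc (realify_vec u) (realify_vec v).

Lemma rdotE k (u v : 'cV[R[i]]_k) : rdot u v = \sum_i creal (cconj (u i 0) * v i 0).
Proof.
rewrite /rdot /realify_vec /dotc tr_col_mx mul_row_col !mxE -big_split/=.
by apply: eq_bigr => i _; rewrite !mxE !cE; ring.
Qed.

Lemma rdot_adj p q (A : 'M[R[i]]_(p, q)) u v : rdot u (A *m v) = rdot (adjmx A *m u) v.
Proof. by rewrite /rdot !realify_mulmx_vec realify_adj dotc_mulmx. Qed.

Lemma l2normE k (v : 'cV[R[i]]_k) : l2norm v = Num.sqrt (nsq (realify_vec v)).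
Proof.
rewrite /nsq -/(rdot v v) rdotE /l2norm; congr Num.sqrt; apply: eq_bigr => i _.
by rewrite /cabs2 !cE; ring.
Qed.

Lemma sqr_l2norm k (v : 'cV[R[i]]_k) : l2norm v ^+ 2 = nsq (realify_vec v).
Proof. by rewrite l2normE sqr_sqrtr// nsq_ge0. Qed.

Lemma l2norm_ge0 k (v : 'cV[R[i]]_k) : 0 <= l2norm v.
Proof. by rewrite l2normE sqrtr_ge0. Qed.

Lemma realify_vec0 k : realify_vec (0 : 'cV[R[i]]_k) = 0.
Proof.
by apply/colP => i; rewrite mxE; case: splitP => j _; rewrite !mxE.
Qed.

Lemma l2norm0 k : l2norm (0 : 'cV[R[i]]_k) = 0.
Proof. by rewrite l2normE realify_vec0 /nsq /dotc mulmx0 mxE sqrtr0. Qed.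

Lemma l2norm_le0 k (v : 'cV[R[i]]_k) : l2norm v <= 0 -> v = 0.
Proof.
move=> v0; have l0 : l2norm v = 0 by apply/eqP; rewrite eq_le v0 l2norm_ge0.
apply: realify_vec_inj; apply/eqP; rewrite realify_vec0 -nsq_eq0 -sqr_l2norm l0.
by rewrite expr0n.
Qed.

Lemma rdot_le k (u v : 'cV[R[i]]_k) : rdot u v <= l2norm u * l2norm v.
Proof.
apply: le_trans (ler_norm _) _; rewrite -sqrtr_sqr !l2normE -sqrtrM ?nsq_ge0//.
by rewrite ler_sqrt ?cauchy_schwarz// mulr_ge0// nsq_ge0.
Qed.

Lemma l2normD k (u v : 'cV[R[i]]_k) : l2norm (u + v) <= l2norm u + l2norm v.
Proof.
rewrite -(@ler_pXn2r _ 2)// ?nnegrE ?addr_ge0 ?l2norm_ge0//.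
rewrite sqr_l2norm realify_vecD nsqD sqrrD -!sqr_l2norm; have := rdot_le u v.
by rewrite /rdot mulr2n; lra.
Qed.

Lemma l2normN k (u : 'cV[R[i]]_k) : l2norm (- u) = l2norm u.
Proof. by rewrite !l2normE realify_vecN nsqN. Qed.

Lemma l2normB k (u v : 'cV[R[i]]_k) : l2norm (u - v) <= l2norm u + l2norm v.
Proof. by rewrite -(l2normN v) l2normD. Qed.

Lemma l2normZ k (c : R[i]) (u : 'cV[R[i]]_k) : l2norm (c *: u) = cmod c * l2norm u.
Proof.
rewrite /l2norm /cmod -sqrtrM ?cabs2_ge0//; congr Num.sqrt; rewrite mulr_sumr.
by apply: eq_bigr => i _; rewrite mxE cabs2M.
Qed.

Lemma l2norm_sum k (I : Type) (r : seq I) (P : pred I) (F : I -> 'cV[R[i]]_k) :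
  l2norm (\sum_(i <- r | P i) F i) <= \sum_(i <- r | P i) l2norm (F i).
Proof.
elim/big_ind2: _ => [|a b c e ab ce|//].
  by rewrite l2norm0.
by apply: le_trans (l2normD _ _) _; apply: lerD.
Qed.

End Realification.

(** * Deterministic recovery from a dual certificate *)

Lemma mulmx_inj_unit (F : fieldType) n (M : 'M[F]_n) :
  (forall v : 'cV_n, M *m v = 0 -> v = 0) -> M \in unitmx.
Proof.
move=> inj; rewrite -unitmx_tr -row_free_unit -kermx_eq0; apply/eqP/row_matrixP => i.
rewrite row0; apply: trmx_inj; rewrite trmx0; apply: inj; apply: trmx_inj.
by rewrite trmx_mul trmxK trmx0 -row_mul mulmx_ker row0.
Qed.

Lemma mulmx_sum_cols (F : comNzRingType) m n (A : 'M[F]_(m, n)) (h : 'cV_n) :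
  A *m h = \sum_i h i 0 *: col i A.
Proof.
apply/colP => k; rewrite mxE summxE; apply: eq_bigr => i _.
by rewrite !mxE mulrC.
Qed.

Section Restriction.
Variables (R : realType) (n : nat) (S : {set 'I_n}).

Lemma adjPSE i (j : 'I_#|S|) : adjmx (PS S) i j = (i == enum_val j)%:R :> R[i].
Proof. by rewrite !mxE; apply: cplx_eq; rewrite !cE; case: eqP => _ //=; rewrite oppr0. Qed.

Lemma restrSE p (A : 'M[R[i]]_(p, n)) k j : restrS S A k j = A k (enum_val j).
Proof.
rewrite mxE (bigD1 (enum_val j))//= adjPSE eqxx mulr1 big1 ?addr0// => i ij.
by rewrite adjPSE (negPf ij) mulr0.
Qed.

Lemma PS_mulE (h : 'cV[R[i]]_n) j : (PS S *m h) j 0 = h (enum_val j) 0.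
Proof.
rewrite mxE (bigD1 (enum_val j))//= mxE eqxx mul1r big1 ?addr0// => i ij.
by rewrite mxE (negPf ij) mul0r.
Qed.

Lemma adjPS_mul_in (v : 'cV[R[i]]_#|S|) j : (adjmx (PS S) *m v) (enum_val j) 0 = v j 0.
Proof.
rewrite mxE (bigD1 j)//= adjPSE eqxx mul1r big1 ?addr0// => k kj.
by rewrite adjPSE (inj_eq enum_val_inj) eq_sym (negPf kj) mul0r.
Qed.

Lemma adjPS_mul_notin (v : 'cV[R[i]]_#|S|) i : i \notin S -> (adjmx (PS S) *m v) i 0 = 0.
Proof.
move=> iS; rewrite mxE big1// => k _; rewrite adjPSE; case: eqP => [ik|_]; last by rewrite mul0r.
by rewrite ik enum_valP in iS.
Qed.

Lemma restrS_mul_PS p (A : 'M[R[i]]_(p, n)) (h : 'cV[R[i]]_n) :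
  restrS S A *m (PS S *m h) = \sum_(i in S) h i 0 *: col i A.
Proof.
rewrite big_enum_val/= mulmx_sum_cols; apply: eq_bigr => j _; rewrite PS_mulE.
by congr (_ *: _); apply/colP => k; rewrite !mxE -restrSE mxE.
Qed.

End Restriction.

Section DualCertificate.
Variables (R : realType) (N n : nat) (A : 'M[R[i]]_(N, n)) (S : {set 'I_n}).
Variables (r : 'I_#|S| -> R) (sigma : 'I_#|S| -> R[i]).
Local Notation Q := (restrS S A).
Local Notation s := (\col_j sigma j : 'cV[R[i]]_#|S|).
Local Notation x := (adjmx (PS S) *m \col_j ((r j)%:C * sigma j)).
Hypothesis r0 : forall j, 0 < r j.
Hypothesis s1 : forall j, cabs2 (sigma j) = 1.
Hypothesis Qinj : forall v : 'cV[R[i]]_#|S|, l2norm v ^+ 2 <= 2 * l2norm (Q *m v) ^+ 2.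
Hypothesis cert : forall i, i \notin S -> exists u : 'cV[R[i]]_#|S|,
  [/\ adjmx Q *m Q *m u = adjmx Q *m col i A, l2norm u <= 2 &
    cmod ((adjmx u *m s) 0 0) <= 9 / 10].

Definition offl1 (h : 'cV[R[i]]_n) : R := \sum_(i | i \notin S) cmod (h i 0).

Lemma offl1_ge0 h : 0 <= offl1 h.
Proof. by apply: sumr_ge0 => i _; exact: cmod_ge0. Qed.

Lemma rdot_gram (v : 'cV[R[i]]_#|S|) : rdot v (adjmx Q *m Q *m v) = l2norm (Q *m v) ^+ 2.
Proof. by rewrite -mulmxA rdot_adj adjmxK /rdot sqr_l2norm. Qed.

(** The system is solved in real coordinates, where [Qinj] makes the realified Gram matrix
    injective, and the solution is carried back. *)
Lemma gram_solution (b : 'cV[R[i]]_#|S|) : exists y, adjmx Q *m Q *m y = b.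
Proof.
have U : realify_mx (adjmx Q *m Q) \in unitmx.
  apply: mulmx_inj_unit => v; rewrite -[v]complexify_vecK -realify_mulmx_vec => h.
  have := rdot_gram (complexify_vec v); rewrite /rdot h /dotc mulmx0 mxE => q0.
  have := Qinj (complexify_vec v); rewrite -q0 mulr0 => v0.
  have -> : complexify_vec v = 0.
    by apply: l2norm_le0; rewrite -(@ler_pXn2r _ 2)// ?nnegrE ?l2norm_ge0// expr0n.
  exact: realify_vec0.
exists (complexify_vec (invmx (realify_mx (adjmx Q *m Q)) *m realify_vec b)).
by apply: realify_vec_inj; rewrite realify_mulmx_vec complexify_vecK mulKVmx.
Qed.

Lemma l2norm_sign : l2norm s = Num.sqrt #|S|%:R.
Proof.
rewrite /l2norm; congr Num.sqrt; rewrite (eq_bigr (fun=> 1)) ?sumr_const ?card_ord//.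
by move=> j _; rewrite mxE s1.
Qed.

Lemma l2norm_le_sqrt2 k l (u : 'cV[R[i]]_k) (v : 'cV[R[i]]_l) :
  l2norm u ^+ 2 <= 2 * l2norm v ^+ 2 -> l2norm u <= Num.sqrt 2 * l2norm v.
Proof.
move=> h; rewrite -(@ler_pXn2r _ 2)// ?nnegrE ?mulr_ge0 ?sqrtr_ge0 ?l2norm_ge0//.
by rewrite exprMn (sqr_sqrtr (ler0n R 2)).
Qed.

(* rho = A_S (A_S^* A_S)^-1 s *)
Lemma dual_certificate : exists rho : 'cV[R[i]]_N,
  [/\ l2norm rho <= Num.sqrt 2 * Num.sqrt #|S|%:R,
      forall j, (adjmx A *m rho) (enum_val j) 0 = sigma j &
      forall i, i \notin S -> cmod ((adjmx A *m rho) i 0) <= 9 / 10].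
Proof.
have [y Yy] := gram_solution s; exists (Q *m y); split.
(* [|Q y|^2 = <y, s> <= |y| |s|] and [|y| <= sqrt 2 |Q y|]; a factor [|Q y|] is then divided out. *)
- have [->|q0] := eqVneq (l2norm (Q *m y)) 0; first by rewrite mulr_ge0// sqrtr_ge0.
  have q1 : 0 < l2norm (Q *m y) by rewrite lt_neqAle eq_sym q0 l2norm_ge0.
  have := rdot_gram y; rewrite Yy => h.
  have := rdot_le y s; rewrite h l2norm_sign => h1.
  have := l2norm_le_sqrt2 (Qinj y) => h2.
  rewrite -(ler_pM2l q1) -expr2; apply: le_trans h1 _.
  rewrite mulrA ler_wpM2r ?sqrtr_ge0//; apply: le_trans h2 _.
  by rewrite mulrC.
- move=> j; have -> : (adjmx A *m (Q *m y)) (enum_val j) 0 = (adjmx Q *m (Q *m y)) j 0.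
    by rewrite !mxE; apply: eq_bigr => k _; rewrite !adjmxE restrSE.
  by rewrite mulmxA Yy mxE.
(* By symmetry of the Gram matrix the inverse moves from [s] to the column [i], so the entry of the
   certificate is [<u, s>], the quantity bounded in [cert]. *)
- move=> i iS; have [u [Yu _ us]] := cert iS.
  have -> : (adjmx A *m (Q *m y)) i 0 = (adjmx u *m s) 0 0.
    have -> : (adjmx A *m (Q *m y)) i 0 = (adjmx (col i A) *m (Q *m y)) 0 0.
      rewrite [LHS]mxE [RHS]mxE; apply: eq_bigr => k _; congr (_ * _).
      by rewrite !adjmxE mxE.
    have -> : adjmx (col i A) *m (Q *m y) = adjmx (adjmx Q *m col i A) *m y.
      by rewrite adjmxM adjmxK mulmxA.
    by rewrite -Yu adjmxM -mulmxA adjmxM adjmxK Yy.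
  exact: us.
Qed.

Lemma l1norm_split (h : 'cV[R[i]]_n) :
  l1norm h = \sum_j cmod (h (enum_val (j : 'I_#|S|)) 0) + offl1 h.
Proof.
rewrite /l1norm (bigID (mem S))/=; congr (_ + _).
by rewrite big_enum_val.
Qed.

(** Subgradient inequality for [A^* rho], which equals the signs on [S] and has modulus at most
    [9/10] elsewhere: a tenth of the mass of [h] off [S] is left over. The pairing [<rho, A h>]
    vanishes in the noiseless case and otherwise costs the norm of [rho]. *)
Lemma l1norm_gain (h : 'cV[R[i]]_n) :
  offl1 h / 10 <= l1norm (x + h) - l1norm x +
    Num.sqrt 2 * Num.sqrt #|S|%:R * l2norm (A *m h).
Proof.
have [rho [nrho vin vout]] := dual_certificate.
have cs1 j : cmod (sigma j) = 1 by rewrite /cmod s1 sqrtr1.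
have hx : l1norm x = \sum_j r j.
  rewrite l1norm_split /offl1 [X in _ + X]big1 => [|i iS]; last first.
    by rewrite adjPS_mul_notin// cmod_real.
  rewrite addr0; apply: eq_bigr => j _; rewrite adjPS_mul_in mxE cmodM cs1 mulr1.
  by rewrite cmod_real// ltW.
have dual : rdot rho (A *m h) = \sum_j creal (cconj (sigma j) * h (enum_val j) 0) +
   \sum_(i | i \notin S) creal (cconj ((adjmx A *m rho) i 0) * h i 0).
  rewrite rdot_adj rdotE (bigID (mem S))/=; congr (_ + _).
  by rewrite big_enum_val/=; apply: eq_bigr => j _; rewrite vin.
have low : - (Num.sqrt 2 * Num.sqrt #|S|%:R * l2norm (A *m h)) <= rdot rho (A *m h).
  rewrite lerNl; have := rdot_le (- rho) (A *m h).
  rewrite l2normN /rdot realify_vecN dotcNl => h1; apply: le_trans h1 _.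
  by rewrite ler_wpM2r ?l2norm_ge0.
have inS : \sum_j r j + \sum_j creal (cconj (sigma j) * h (enum_val j) 0) <=
    \sum_j cmod ((x + h) (enum_val (j : 'I_#|S|)) 0).
  rewrite -big_split/=; apply: ler_sum => j _; rewrite [(x + h) _ 0]mxE adjPS_mul_in mxE.
  have := creal_le_cmod (cconj (sigma j) * ((r j)%:C * sigma j + h (enum_val j) 0)).
  rewrite cmodM cmod_conj cs1 mul1r; apply: le_trans.
  rewrite mulrDr crealD lerD2r !cE.
  have := s1 j; rewrite /cabs2 => e.
  rewrite le_eqVlt; apply/orP; left; apply/eqP; rewrite -[LHS]mulr1 -e; ring.
have outS : offl1 h / 10 <= offl1 h -
    \sum_(i | i \notin S) creal (cconj ((adjmx A *m rho) i 0) * h i 0).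
  rewrite /offl1 mulr_suml -sumrB; apply: ler_sum => i iS.
  have := creal_le_cmod (cconj ((adjmx A *m rho) i 0) * h i 0).
  rewrite cmodM cmod_conj => h1.
  have := ler_wpM2r (cmod_ge0 (h i 0)) (vout i iS); lra.
have off : offl1 (x + h) = offl1 h.
  by apply: eq_bigr => i iS; rewrite mxE adjPS_mul_notin// add0r.
rewrite [l1norm (x + h)]l1norm_split hx off.
move: low inS outS; rewrite dual; lra.
Qed.

(** [g] is the least squares coefficient of [A h] on the columns of [S], so [|Q g| <= |A h|]. It
    differs from the restriction of [h] by a combination of the vectors [u i] of norm at most 2;
    together with the part of [h] off [S] this accounts for the factor 3. *)
Lemma l2norm_on_support (h : 'cV[R[i]]_n) :
  l2norm h <= Num.sqrt 2 * l2norm (A *m h) + 3 * offl1 h.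
Proof.
have cert' i : exists u : 'cV[R[i]]_#|S|, i \notin S ->
   adjmx Q *m Q *m u = adjmx Q *m col i A /\ l2norm u <= 2.
  have [iS|iS] := boolP (i \in S); first by exists 0.
  by have [u [? ? _]] := cert iS; exists u.
have {cert'} [u hu] := boolp.choice cert'.
pose hS := PS S *m h; pose g := hS + \sum_(i | i \notin S) h i 0 *: u i.
have Yg : adjmx Q *m Q *m g = adjmx Q *m (A *m h).
  rewrite /g mulmxDr mulmx_sumr.
  have -> : \sum_(i | i \notin S) adjmx Q *m Q *m (h i 0 *: u i) =
      adjmx Q *m \sum_(i | i \notin S) h i 0 *: col i A.
    rewrite mulmx_sumr; apply: eq_bigr => i iS.
    by rewrite -!scalemxAr (hu i iS).1.
  rewrite -mulmxA restrS_mul_PS -mulmxDr (mulmx_sum_cols A h) [in RHS](bigID (mem S))//=.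
have gA : l2norm (Q *m g) <= l2norm (A *m h).
  have [->|q0] := eqVneq (l2norm (Q *m g)) 0; first exact: l2norm_ge0.
  have q1 : 0 < l2norm (Q *m g) by rewrite lt_neqAle eq_sym q0 l2norm_ge0.
  rewrite -(ler_pM2l q1) -expr2 -rdot_gram Yg rdot_adj adjmxK; exact: rdot_le.
have g2 := l2norm_le_sqrt2 (Qinj g).
have sqrt20 : 0 <= Num.sqrt 2 :> R by exact: sqrtr_ge0.
have gA2 := ler_wpM2l sqrt20 gA.
have hSg : l2norm hS <= l2norm g + 2 * offl1 h.
  have -> : hS = g - \sum_(i | i \notin S) h i 0 *: u i by rewrite /g addrK.
  apply: le_trans (l2normB _ _) _; rewrite lerD2l.
  apply: le_trans (l2norm_sum _ _ _) _; rewrite /offl1 mulr_sumr; apply: ler_sum => i iS.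
  by rewrite l2normZ mulrC ler_wpM2r ?cmod_ge0//; exact: (hu i iS).2.
have hh : l2norm h <= l2norm hS + offl1 h.
  rewrite -(@ler_pXn2r _ 2)// ?nnegrE ?addr_ge0 ?l2norm_ge0 ?offl1_ge0//.
  have nn : 0 <= l2norm hS * offl1 h by rewrite mulr_ge0 ?l2norm_ge0 ?offl1_ge0.
  suff : l2norm h ^+ 2 <= l2norm hS ^+ 2 + offl1 h ^+ 2 by rewrite sqrrD mulr2n; lra.
  rewrite /l2norm !sqr_sqrtr; try by apply: sumr_ge0 => i _; exact: cabs2_ge0.
  rewrite (bigID (mem S))/= big_enum_val/=; apply: lerD.
    by rewrite le_eqVlt; apply/orP; left; apply/eqP; apply: eq_bigr => j _; rewrite PS_mulE.
  rewrite /offl1; apply: le_trans (_ : \sum_(i | i \notin S) cmod (h i 0) ^+ 2 <= _).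
    by apply: ler_sum => i _; rewrite sqr_cmod.
  have sq (I : Type) (l : seq I) (P : pred I) (F : I -> R) : (forall i, 0 <= F i) ->
      \sum_(i <- l | P i) F i ^+ 2 <= (\sum_(i <- l | P i) F i) ^+ 2.
    move=> F0; elim: l => [|i l IH]; first by rewrite !big_nil expr0n.
    rewrite !big_cons; case: (P i) => //.
    have := F0 i; have : 0 <= \sum_(j <- l | P j) F j by exact: sumr_ge0.
    move: IH; move: (\sum_(j <- l | P j) F j) (\sum_(j <- l | P j) F j ^+ 2) => a b h1 a0 f0.
    by have := mulr_ge0 a0 f0; rewrite sqrrD mulr2n; lra.
  by apply: sq => i; exact: cmod_ge0.
lra.
Qed.

Lemma support_l1_minimal (w : 'cV[R[i]]_n) : A *m w = A *m x -> l1norm x <= l1norm w.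
Proof.
move=> wx; have := l1norm_gain (w - x); rewrite [x + _]addrC subrK mulmxBr wx subrr l2norm0 mulr0.
by have := offl1_ge0 (w - x); lra.
Qed.

(** Both [x] and [z] are feasible, so [|A h| <= 2 eta]. The gain inequality bounds the mass off [S]
    by [20 sqrt 2 sqrt |S| eta]; with [sqrt 2 <= 71/50] the total is [(2.84 + 85.2 sqrt |S|) eta],
    rounded up. *)
Lemma l1_recovery_error (e : 'cV[R[i]]_N) (eta : R) (z : 'cV[R[i]]_n) :
  l2norm e <= eta -> l2norm (A *m x + e - A *m z) <= eta -> l1norm z <= l1norm x ->
  l2norm (x - z) <= (3 + 100 * Num.sqrt #|S|%:R) * eta.
Proof.
move=> he hz zx; set h := z - x.
have -> : l2norm (x - z) = l2norm h by rewrite -l2normN opprB.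
have Ah : l2norm (A *m h) <= 2 * eta.
  have -> : A *m h = e - (A *m x + e - A *m z).
    by rewrite /h mulmxBr opprB [RHS]addrC opprD addrA subrK.
  by have := l2normB e (A *m x + e - A *m z); lra.
have := l1norm_gain h; have := l2norm_on_support h.
have -> : x + h = z by rewrite /h addrC subrK.
have s20 : 0 <= Num.sqrt 2 :> R := sqrtr_ge0 _.
have s2 : Num.sqrt 2 <= 71 / 50 :> R.
  by rewrite -(@ler_pXn2r _ 2)// ?nnegrE ?sqr_sqrtr//; lra.
have sS : 0 <= Num.sqrt #|S|%:R :> R := sqrtr_ge0 _.
have e0 : 0 <= eta by apply: le_trans he; exact: l2norm_ge0.
have A0 := l2norm_ge0 (A *m h).
have h1 : Num.sqrt 2 * l2norm (A *m h) <= 71 / 50 * (2 * eta) by exact: ler_pM.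
have h2 := ler_wpM2r sS h1; have h3 := mulr_ge0 sS e0 => h4 h5.
have key (lz lx q o lh s2' a' : R) : s2' * a' <= 71 / 50 * (2 * eta) ->
    s2' * a' * q <= 71 / 50 * (2 * eta) * q -> 0 <= q * eta -> lz <= lx ->
    lh <= s2' * a' + 3 * o -> o / 10 <= lz - lx + s2' * q * a' ->
    lh <= (3 + 100 * q) * eta.
  by clear -e0; lra.
exact: key h1 h2 h3 zx h4 h5.
Qed.

End DualCertificate.

(** * Random signs *)

Section CircleLaw.
Import numFieldNormedType.Exports.
Context {d : measure_display} {T : measurableType d} {R : realType}.
Variable P : probability T R.
Variables (X : T -> R) (c F : R -> R).
Hypothesis mX : measurable_fun setT X.
Hypothesis cc : continuous c.
Hypothesis c1 : forall t, -1 <= c t.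
Hypothesis F1 : forall t, is_derive (t : R) (1 : R) F (c t).
Hypothesis Fper : F (pi *+ 2) = F 0.
Hypothesis law : forall A, measurable A -> P (X @^-1` A) =
  (lebesgue_measure [set t : R | (0 <= t < pi *+ 2)%R /\ A (c t)] * ((pi *+ 2)^-1)%:E)%E.

Let pi20 : 0 < pi *+ 2 :> R. Proof. by rewrite mulrn_wgt0// pi_gt0. Qed.
Let mc : measurable_fun setT c. Proof. exact: continuous_measurable_fun. Qed.
Local Notation U := (uniform_prob pi20).

Lemma circle_law_uniform A : measurable A -> P (X @^-1` A) = U (c @^-1` A).
Proof.
move=> mA; have mcA : measurable (c @^-1` A) by rewrite -[X in measurable X]setTI; exact: mc.
rewrite law//.
have -> : U (c @^-1` A) = (\int[U]_x (\1_(c @^-1` A) x)%:E)%E.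
  by rewrite integral_indic// setIT.
have mi : measurable_fun setT (fun x => (\1_(c @^-1` A) x)%:E : \bar R).
  exact/measurable_EFinP/measurable_indic.
rewrite integral_uniform//.
rewrite subr0 muleC; congr (_ * _)%E.
(* The law refers to a half-open turn and the uniform measure to a closed interval; they differ by a
   null endpoint. *)
rewrite -integral_itv_bndo_bndc; last exact: measurable_funTS.
rewrite integral_indic//; congr lebesgue_measure; apply/seteqP; split => t /=.
  by move=> [t2 At]; split => //; rewrite in_itv.
by move=> [At]; rewrite in_itv.
Qed.

(** This expresses that [X] has mean zero. Adding 1 and truncating makes the integrand nonnegative
    everywhere, as the change of variables requires; the truncation is inactive on values of [c].
    The primitive [t + F t] grows by [2 pi] over one turn. *)
Lemma integral_circle_law : (\int[P]_w (Num.max 0 (1 + X w))%:E = 1)%E.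
Proof.
pose f (y : R) : \bar R := (Num.max 0 (1 + y))%:E.
have mf : measurable_fun setT f.
  apply/measurable_EFinP; apply: measurable_maxr; first exact: measurable_cst.
  exact: measurable_funD.
have f0 y : (0 <= f y)%E by rewrite lee_fin le_max lexx.
have -> : (\int[P]_w (Num.max 0 (1 + X w))%:E = \int[pushforward P X]_y f y)%E.
  by rewrite ge0_integral_pushforward.
rewrite (eq_measure_integral (pushforward U c)); last first.
  by move=> A mA _; exact: circle_law_uniform.
rewrite ge0_integral_pushforward// preimage_setT integral_uniform; first last.
- by move=> t; exact: f0.
- exact: measurableT_comp.
rewrite subr0.
have -> : (\int[lebesgue_measure]_(x in `[0%R, (pi *+ 2)%R]) (f \o c) x =
   \int[lebesgue_measure]_(x in `[0%R, (pi *+ 2)%R]) (1 + c x)%:E)%E.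
  apply: eq_integral => x _; rewrite /f /=; congr EFin; apply/max_idPr.
  by have := c1 x; lra.
pose H t := t + F t.
have dH t : is_derive (t : R) (1 : R) H (1 + c t) by exact: is_deriveD.
have cH : continuous H.
  by move=> t; apply/differentiable_continuous/derivable1_diffP; exact: ex_derive.
rewrite (@continuous_FTC2 _ _ H)//.
- rewrite /H Fper -EFinB -EFinM; congr EFin.
  by rewrite add0r addrK mulVf// gt_eqF.
- by apply: continuous_subspaceT => t; apply: continuousD; [exact: cvg_cst|exact: cc].
- split.
  + by move=> t _; exact: ex_derive.
  + by apply: cvg_at_right_filter; exact: cH.
  + by apply: cvg_at_left_filter; exact: cH.
- by move=> t _; rewrite derive1E; exact: derive_val.
Qed.

End CircleLaw.

Section SignSequences.
Context {d : measure_display} {T : measurableType d} {R : realType}.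
Variable P : probability T R.

Lemma prob_one_of_null (A : set T) : measurable A -> P (~` A) = 0%E -> P A = 1%E.
Proof.
by move=> mA h; have := probability_setC P (measurableC mA); rewrite setCK h sube0.
Qed.

Lemma prob_one_setC (A : set T) : measurable A -> P A = 1%E -> P (~` A) = 0%E.
Proof. by move=> mA h; rewrite (probability_setC P mA) h subee. Qed.

Lemma prob_one_setI (A B : set T) : measurable A -> measurable B ->
  P A = 1%E -> P B = 1%E -> P (A `&` B) = 1%E.
Proof.
move=> mA mB A1 B1; apply: prob_one_of_null; first exact: measurableI.
apply/eqP; rewrite -measure_le0 setCI.
apply: le_trans (measureU2 _ _ _) _; [exact: measurableC|exact: measurableC|].
have hA := prob_one_setC mA A1; have hB := prob_one_setC mB B1.
by rewrite [X in (X + _)%E]hA [X in (_ + X)%E]hB adde0.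
Qed.

Lemma measurable_eq_cst (f : T -> R) (a : R) : measurable_fun setT f ->
  measurable [set w | f w = a].
Proof.
move=> mf; have := measurable_fun_eqr mf (measurable_cst a).
move=> /(_ measurableT [set true] I); rewrite setTI; congr measurable.
by apply/seteqP; split => w /= => [/eqP|->]//; rewrite eqxx.
Qed.

Lemma measurable_eq_cplx (X : T -> R[i]) (a : R[i]) : measurable_cplx X ->
  measurable [set w | X w = a].
Proof.
move=> [mr mi]; rewrite [X in measurable X](_ : _ =
  [set w | creal (X w) = creal a] `&` [set w | cimag (X w) = cimag a]).
  by apply: measurableI; exact: measurable_eq_cst.
apply/seteqP; split => w /=; first by move=> ->.
by move=> [? ?]; exact: cplx_eq.
Qed.

Lemma measurable_unit_modulus (X : T -> R[i]) : measurable_cplx X ->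
  measurable [set w | cabs2 (X w) = 1].
Proof.
move=> [mr mi]; apply: measurable_eq_cst.
by apply: measurable_funD; exact: measurable_funX.
Qed.

Lemma one_neq_opp1 (z : R[i]) : z = 1 -> z = -1 -> False.
Proof.
move=> -> /(congr1 (@creal R)); rewrite crealN /= => h.
by have {}h : (1 : R) = -1 := h; have : (1 : R) < 0; [lra|rewrite ltr10].
Qed.

Lemma prob_two_point (X : T -> R[i]) : measurable_cplx X ->
  P [set w | X w = 1] = (2^-1)%:E -> P [set w | X w = -1] = (2^-1)%:E ->
  P ([set w | X w = 1] `|` [set w | X w = -1]) = 1%E.
Proof.
move=> mX p1 p2.
set U1 := [set w | X w = 1] in p1 *; set U2 := [set w | X w = -1] in p2 *.
have h : P (U1 `|` U2) = (P U1 + P U2)%E.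
  apply: measureU; try exact: measurable_eq_cplx.
  by apply/seteqP; split => w //= -[/one_neq_opp1 h /h].
by rewrite h p1 p2 -EFinD; congr EFin; lra.
Qed.

Definition uniform_on_circle (X : T -> R[i]) : Prop := forall E, borelC E ->
  P (X @^-1` E) = (lebesgue_measure [set t : R | (0 <= t < pi *+ 2)%R /\ E (expi t)] *
      ((pi *+ 2)^-1)%:E)%E.

Lemma borelC_creal (A : set R) : measurable A -> borelC ((@creal R) @^-1` A).
Proof. by move=> mA; apply: sub_sigma_algebra; exists A; split => //; left. Qed.

Lemma borelC_cimag (A : set R) : measurable A -> borelC ((@cimag R) @^-1` A).
Proof. by move=> mA; apply: sub_sigma_algebra; exists A; split => //; right. Qed.

HB.instance Definition _ := isPointed.Build R[i] 0.

Lemma borelC_cabs2 (A : set R) : measurable A -> borelC ((@cabs2 R) @^-1` A).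
Proof.
move=> mA; pose gens := [set E : set R[i] | exists A : set R, measurable A /\
                 (E = (@creal R) @^-1` A \/ E = (@cimag R) @^-1` A)].
have mr : measurable_fun setT (@creal R : g_sigma_algebraType gens -> R).
  by move=> _ B mB; rewrite setTI; exact: borelC_creal.
have mi : measurable_fun setT (@cimag R : g_sigma_algebraType gens -> R).
  by move=> _ B mB; rewrite setTI; exact: borelC_cimag.
have m2 : measurable_fun setT (@cabs2 R : g_sigma_algebraType gens -> R).
  by apply: measurable_funD; exact: measurable_funX.
by have := m2 measurableT A mA; rewrite setTI.
Qed.

Lemma circle_unit_modulus (X : T -> R[i]) : uniform_on_circle X ->
  P [set w | cabs2 (X w) <> 1] = 0%E.
Proof.
move=> hX; have h := hX _ (borelC_cabs2 (measurableC (measurable_set1 (1 : R)))).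
have -> : [set w | cabs2 (X w) <> 1] = X @^-1` (@cabs2 R @^-1` ~` [set 1]) by [].
rewrite h [X in lebesgue_measure X](_ : _ = set0) ?measure0 ?mul0e//.
apply/seteqP; split => t //= -[_]; apply; rewrite /cabs2/=.
by rewrite cos2Dsin2.
Qed.

(** The modulus of a sign is one only almost surely; the value 1 off [G] makes it one at every
    point, as [strong_moment_bound] demands. *)
Definition fix_sign (G : set T) (X : T -> R[i]) (w : T) : R[i] :=
  if w \in G then X w else 1.

Lemma creal_fix_sign G X w : creal (fix_sign G X w) =
  creal (X w) * \1_G w + (1 - \1_G w).
Proof.
by rewrite /fix_sign indicE; case: (w \in G); rewrite /= ?mulr1 ?mulr0 ?subrr ?addr0 ?add0r ?subr0.
Qed.

Lemma cimag_fix_sign G X w : cimag (fix_sign G X w) = cimag (X w) * \1_G w.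
Proof. by rewrite /fix_sign indicE; case: (w \in G); rewrite /= ?mulr1 ?mulr0. Qed.

Section FixSign.
Variables (G : set T) (X : T -> R[i]).
Hypotheses (mG : measurable G) (PG : P G = 1%E) (mX : measurable_cplx X).
Hypothesis X1 : forall w, G w -> cabs2 (X w) = 1.

Lemma fix_sign_modulus w : cabs2 (fix_sign G X w) = 1.
Proof.
rewrite /fix_sign; case: ifPn => [/set_mem/X1//|_].
by rewrite /cabs2 /= expr0n/= addr0 expr1n.
Qed.

Lemma bounded_fix_sign :
  bounded_rv (fun w => creal (fix_sign G X w)) /\ bounded_rv (fun w => cimag (fix_sign G X w)).
Proof.
have m1 : measurable_fun setT (\1_G : T -> R) by exact: measurable_indic.
have bnd (a b : R) : a ^+ 2 + b ^+ 2 = 1 -> `|a| <= 1.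
  move=> ab; rewrite -(@ler_pXn2r _ 2)// ?nnegrE// expr1n real_normK ?num_real//.
  by have := sqr_ge0 b; lra.
split; split.
- rewrite (_ : (fun w => _) = (fun w => creal (X w) * \1_G w + (1 - \1_G w))).
    apply: measurable_funD; first by apply: measurable_funM => //; exact: mX.1.
    by apply: measurable_funB => //; exact: measurable_cst.
  by apply/funext => w; exact: creal_fix_sign.
- by exists 1 => w; apply: (bnd _ (cimag (fix_sign G X w))); exact: fix_sign_modulus.
- rewrite (_ : (fun w => _) = (fun w => cimag (X w) * \1_G w)).
    by apply: measurable_funM => //; exact: mX.2.
  by apply/funext => w; exact: cimag_fix_sign.
- exists 1 => w; apply: (bnd _ (creal (fix_sign G X w))); rewrite addrC; exact: fix_sign_modulus.
Qed.

Lemma mean_fix_sign_circle : uniform_on_circle X ->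
  mean P (fun w => creal (fix_sign G X w)) = 0 /\ mean P (fun w => cimag (fix_sign G X w)) = 0.
Proof.
move=> hX; have [br bi] := bounded_fix_sign.
have key (f : R[i] -> R) : measurable_fun setT (fun w => f (X w)) ->
   bounded_rv (fun w => f (fix_sign G X w)) -> (forall z, cabs2 z = 1 -> -1 <= f z) ->
   (\int[P]_w (Num.max 0 (1 + f (X w)))%:E = 1)%E ->
   mean P (fun w => f (fix_sign G X w)) = 0.
  move=> mf bf f1 If.
  have : mean P (fun w => 1 + f (fix_sign G X w)) = 1.
    transitivity (mean P (fun w => Num.max 0 (1 + f (X w)))); last by rewrite /mean /Rintegral If.
    apply: (eq_mean_as mG PG).
    - by apply: measurable_funD => //; exact: bf.1.
    - apply: measurable_maxr; first exact: measurable_cst.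
      exact: measurable_funD.
    - move=> w Gw; rewrite /fix_sign mem_set//; apply/esym/max_idPr.
      by have := f1 (X w) (X1 Gw); lra.
  rewrite meanD//; last exact: bounded_rv_cst.
  by rewrite mean_cst; lra.
have bnd (a b : R) : a ^+ 2 + b ^+ 2 = 1 -> -1 <= a.
  move=> ab; have : 0 <= 1 - a ^+ 2 by have := sqr_ge0 b; lra.
  by move=> h; rewrite leNgt; apply/negP => a1; nra.
split; apply: key.
- exact: mX.1.
- exact: br.
- by move=> z; rewrite /cabs2; exact: bnd.
- apply: (@integral_circle_law _ _ _ P _ (@cos R) (@sin R)) => //.
  + exact: mX.1.
  + exact: continuous_cos.
  + by move=> t; exact: cos_geN1.
  + by rewrite sin2pi sin0.
  + by move=> A mA; exact: (hX _ (borelC_creal mA)).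
- exact: mX.2.
- exact: bi.
- by move=> z; rewrite /cabs2 addrC; exact: bnd.
- apply: (@integral_circle_law _ _ _ P _ (@sin R) (fun t => - cos t)) => //.
  + exact: mX.2.
  + exact: continuous_sin.
  + by move=> t; exact: sin_geN1.
  + by move=> t; have := is_deriveN (is_derive_cos t); rewrite opprK.
  + by rewrite cos2pi cos0.
  + by move=> A mA; exact: (hX _ (borelC_cimag mA)).
Qed.

Lemma mean_fix_sign_two_point :
  P [set w | X w = 1] = (2^-1)%:E -> P [set w | X w = -1] = (2^-1)%:E ->
  mean P (fun w => creal (fix_sign G X w)) = 0 /\ mean P (fun w => cimag (fix_sign G X w)) = 0.
Proof.
move=> p1 p2; have [br bi] := bounded_fix_sign.
have m1 := measurable_eq_cplx 1 mX; have m2 := measurable_eq_cplx (-1) mX.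
set U1 := [set w | X w = 1] in p1 m1; set U2 := [set w | X w = -1] in p2 m2.
have PU : P (U1 `|` U2) = 1%E by exact: prob_two_point.
have mU : measurable (U1 `|` U2) by exact: measurableU.
have PGU : P (G `&` (U1 `|` U2)) = 1%E by exact: prob_one_setI.
have mGU := measurableI _ _ mG mU.
have disj w : U1 w -> U2 w -> False by exact: one_neq_opp1.
split.
- transitivity (mean P (fun w => \1_U1 w - \1_U2 w)).
    apply: (eq_mean_as mGU PGU); first exact: br.1.
      by apply: measurable_funB; exact: measurable_indic.
    move=> w [Gw Uw]; rewrite /fix_sign mem_set// !indicE.
    case: Uw => Uw.
      by rewrite (mem_set Uw) memNset => [|/(disj w Uw)//]; rewrite Uw subr0.
    by rewrite (mem_set Uw) memNset => [|/(fun u => disj w u Uw)//]; rewrite Uw crealN sub0r.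
  rewrite meanB; try exact: bounded_rv_indic.
  suff -> : mean P (\1_U1) = mean P (\1_U2) by rewrite subrr.
  by apply: EFin_inj; rewrite !mean_indic// p1 p2.
- rewrite -[RHS](mean_cst P); apply: (eq_mean_as mGU PGU); first exact: bi.1.
    exact: measurable_cst.
  move=> w [Gw Uw]; rewrite /fix_sign mem_set//.
  by case: Uw => /= ->; rewrite ?cimagN //= oppr0.
Qed.

End FixSign.

End SignSequences.

(** * The dual certificate of a random sensing matrix *)

Section Generators.
Context {d : measure_display} {T : measurableType d} {R : realType}.

Lemma measurable_fun_alg d' (T' : measurableType d') :
  fun_subalg (fun f : T' -> R => measurable_fun setT f).
Proof.
split=> [c|f g|f g]; [exact: measurable_cst|exact: measurable_funD|exact: measurable_funM].
Qed.

Lemma measurable_fun_inv d' (T' : measurableType d') (f : T' -> R) :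
  measurable_fun setT f -> measurable_fun setT (fun x => (f x)^-1).
Proof.
move=> mf; rewrite (_ : (fun x => _) = (fun x => f x * (f x ^+ 2) `^ (-1))).
  apply: measurable_funM => //.
  exact: (measurableT_comp (measurable_powR (-1)) (measurable_funX 2 mf)).
apply/funext => x; rewrite powR_inv1 ?sqr_ge0//.
have [->|f0] := eqVneq (f x) 0; first by rewrite invr0 mul0r.
by rewrite expr2 invfM mulrA divff// mul1r.
Qed.

(** The generating family is named because [adapted] takes generators; [<<s gen_sets f >>] unfolds
    to [gen_sigma f], so the independence hypotheses apply as they are. *)
Definition gen_sets (I : Type) (f : I -> T -> R) : set (set T) :=
  [set E | exists (i : I) (A : set R), measurable A /\ E = f i @^-1` A].

Lemma gen_sets_measurable (I : Type) (f : I -> T -> R) :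
  (forall i, measurable_fun setT (f i)) -> <<s gen_sets f >> `<=` measurable.
Proof.
move=> mf; apply: smallest_sub; first exact: sigma_algebra_measurable.
by move=> E [i [A [mA ->]]]; rewrite -[X in measurable X]setTI; exact: mf.
Qed.

Lemma measurable_gen_sets (I : Type) (f : I -> T -> R) i :
  measurable_fun setT (f i : g_sigma_algebraType (gen_sets f) -> R).
Proof. by move=> _ A mA; rewrite setTI; apply: sub_sigma_algebra; exists i, A. Qed.

End Generators.

Section ComplexEntries.
Variables (R : realType) (A : Type) (Q : (A -> R) -> Prop).
Hypothesis Qalg : fun_subalg Q.

Definition cmx_in a b (F : A -> 'M[R[i]]_(a, b)) : Prop :=
  forall i j, Q (fun x => creal (F x i j)) /\ Q (fun x => cimag (F x i j)).

Lemma cmx_in_realify a b (F : A -> 'M[R[i]]_(a, b)) :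
  cmx_in F -> mx_in_subalg Q (fun x => realify_mx (F x)).
Proof.
move=> QF i j.
have ext (f g : A -> R) : (forall x, f x = g x) -> Q f -> Q g by exact: fun_subalg_ext.
case: (split_ordP i) => k ->; case: (split_ordP j) => l ->.
- by apply: ext (QF k l).1 => x; rewrite block_mxEul mxE.
- by apply: ext (fun_subalgN Qalg (QF k l).2) => x; rewrite block_mxEur !mxE.
- by apply: ext (QF k l).2 => x; rewrite block_mxEdl mxE.
- by apply: ext (QF k l).1 => x; rewrite block_mxEdr mxE.
Qed.

Lemma cmx_in_complexify a (F : A -> 'cV[R]_(a + a)) :
  mx_in_subalg Q F -> cmx_in (fun x => complexify_vec (F x)).
Proof.
move=> QF i j; have ext (f g : A -> R) : (forall x, f x = g x) -> Q f -> Q g by exact: fun_subalg_ext.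
split.
  by apply: ext (QF (lshift a i) 0) => x; rewrite mxE /= mxE.
by apply: ext (QF (rshift a i) 0) => x; rewrite mxE /= mxE.
Qed.

Lemma cmx_in_sensing n m (p : 'I_m -> nat) (B : forall l, A -> 'M[R[i]]_(p l, n)) :
  (forall l, cmx_in (B l)) -> cmx_in (sensing B).
Proof.
move=> QB i j; pose c : R := (Num.sqrt m%:R)^-1.
have h := QB (tagnat.sig1 i) (tagnat.sig2 i) j.
have E x : sensing B x i j = c%:C * B (tagnat.sig1 i) x (tagnat.sig2 i) j by rewrite !mxE.
have ext (f g : A -> R) : (forall x, f x = g x) -> Q f -> Q g by exact: fun_subalg_ext.
split.
- by apply: ext (fun_subalgZ Qalg c h.1) => x; rewrite E !cE mul0r subr0.
- by apply: ext (fun_subalgZ Qalg c h.2) => x; rewrite E !cE mul0r addr0.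
Qed.

End ComplexEntries.

Section RealifyMore.
Variable R : realType.

Lemma realify_mxZ p q (c : R) (M : 'M[R[i]]_(p, q)) :
  realify_mx (c%:C *: M) = c *: realify_mx M.
Proof.
rewrite /realify_mx scale_block_mx; congr block_mx; apply/matrixP => i j; rewrite !mxE !cE; ring.
Qed.

Lemma realify_mxD p q (M N : 'M[R[i]]_(p, q)) :
  realify_mx (M + N) = realify_mx M + realify_mx N.
Proof.
rewrite /realify_mx add_block_mx; congr block_mx; apply/matrixP => i j; rewrite !mxE !cE; ring.
Qed.

Lemma realify_mx0 p q : realify_mx (0 : 'M[R[i]]_(p, q)) = 0.
Proof.
rewrite /realify_mx -[RHS]submxK; congr block_mx; apply/matrixP => i j; rewrite !mxE/= ?oppr0//.
Qed.

Lemma realify_mx_sum (I : Type) (r : seq I) (P : pred I) p q (F : I -> 'M[R[i]]_(p, q)) :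
  realify_mx (\sum_(i <- r | P i) F i) = \sum_(i <- r | P i) realify_mx (F i).
Proof. exact: (big_morph _ (@realify_mxD p q) (realify_mx0 p q)). Qed.

Lemma sensing_gram T n m (p : 'I_m -> nat) (B : forall l, T -> 'M[R[i]]_(p l, n)) w :
  (0 < m)%N ->
  (realify_mx (sensing B w))^T *m realify_mx (sensing B w) =
  \sum_l m%:R^-1 *: ((realify_mx (B l w))^T *m realify_mx (B l w)).
Proof.
move=> m0; rewrite -realify_adj -realify_mulmx.
have -> : adjmx (sensing B w) *m sensing B w =
    \sum_l (m%:R^-1)%:C *: (adjmx (B l w) *m B l w).
  rewrite /sensing -scalemxAr.
  have -> : adjmx (((Num.sqrt (m%:R))^-1)%:C *: (\mxcol_l (B l w))) =
      ((Num.sqrt (m%:R : R))^-1)%:C *: \mxrow_l adjmx (B l w).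
    by apply/matrixP => i j; rewrite !mxE cconjM; congr (_ * _); apply: cplx_eq; rewrite /= ?oppr0.
  rewrite -scalemxAl scalerA mul_mxrow_mxcol -scaler_sumr; congr (_ *: _).
  rewrite -rmorphM/=; congr (_%:C).
  by rewrite -expr2 exprVn sqr_sqrtr// ler0n.
rewrite realify_mx_sum; apply: eq_bigr => l _.
by rewrite realify_mxZ realify_mulmx realify_adj.
Qed.

End RealifyMore.

(** * Measurable solution of the Gram system *)

Section GramSolve.
Variables (R : realType) (k q : nat).
Implicit Types (Y : 'M[R]_k) (V : 'cV[R]_k).

(** A polynomial condition on the entries, hence measurable; by [nsq_mul_trace_pow] it bounds the
    operator norm of [Y - 1] by [1/2] for symmetric [Y]. *)
Definition near_identity Y : bool := \tr ((Y - 1%:M) ^+ q.+1.*2) < (4%:R^-1) ^+ q.+1.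

Lemma near_identity_dev Y v : Y^T = Y -> near_identity Y ->
  nsq ((Y - 1%:M) *m v) <= 4%:R^-1 * nsq v.
Proof.
move=> Ys near; have Ds : (Y - 1%:M)^T = Y - 1%:M by rewrite linearB/= Ys trmx1.
have h := nsq_mul_trace_pow q v Ds.
have v0 := nsq_ge0 v.
rewrite -(@ler_pXn2r _ q.+1)// ?nnegrE ?nsq_ge0 ?mulr_ge0//.
apply: le_trans h _; rewrite exprMn mulrC ler_wpM2r ?exprn_ge0//; exact: ltW.
Qed.

Lemma near_identity_nsq Y v : Y^T = Y -> near_identity Y -> nsq v <= 4 * nsq (Y *m v).
Proof.
move=> Ys near; have := near_identity_dev v Ys near.
have {2}-> : v = Y *m v - (Y - 1%:M) *m v by rewrite mulmxBl mul1mx opprB addrC subrK.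
have := nsqB_le (Y *m v) ((Y - 1%:M) *m v).
have {1}-> : Y *m v - (Y - 1%:M) *m v = v by rewrite mulmxBl mul1mx opprB addrC subrK.
have -> : Y *m v - (Y - 1%:M) *m v = v by rewrite mulmxBl mul1mx opprB addrC subrK.
move: (nsq v) (nsq (Y *m v)) (nsq (_ *m v)) => a b c; lra.
Qed.

Lemma near_identity_dotc Y v : Y^T = Y -> near_identity Y -> nsq v <= 2 * dotc v (Y *m v).
Proof.
move=> Ys near; have h := near_identity_dev v Ys near.
have -> : Y *m v = v + (Y - 1%:M) *m v by rewrite mulmxBl mul1mx addrC subrK.
rewrite dotcDr -/(nsq v).
have := cauchy_schwarz v ((Y - 1%:M) *m v); have := nsq_ge0 v.
move: h; move: (nsq v) (nsq (_ *m v)) (dotc _ _) => a b c h1 a0 h2.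
have h3 : c ^+ 2 <= (a / 2) ^+ 2.
  have := ler_wpM2l a0 h1; rewrite exprMn; lra.
have : - (a / 2) <= c; last by lra.
rewrite leNgt; apply/negP => h4; have h5 : a / 2 < - c by lra.
have : (a / 2) ^+ 2 < (- c) ^+ 2 by rewrite ltr_pXn2r// ?nnegrE; lra.
by rewrite sqrrN ltNge h3.
Qed.

(** Cramer's rule where [Y] is close to 1 and zero elsewhere: the result is measurable and, for
    symmetric [Y], of norm at most [2 |V|] without any exceptional event, so its moments can be
    taken over the whole space. *)
Definition gram_solve Y V : 'cV[R]_k :=
  if near_identity Y then (\det Y)^-1 *: (\adj Y *m V) else 0.

Lemma gram_solveK Y V : Y^T = Y -> near_identity Y -> Y *m gram_solve Y V = V.
Proof.
move=> Ys near; rewrite /gram_solve near.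
have Yu : Y \in unitmx.
  apply: mulmx_inj_unit => v Yv; have := near_identity_nsq v Ys near.
  rewrite Yv /nsq {2}/dotc mulmx0 mxE mulr0 -/(nsq v) => h.
  by apply/eqP; rewrite -nsq_eq0 eq_le h nsq_ge0.
rewrite -scalemxAr mulmxA mul_mx_adj mul_scalar_mx scalerA mulVf ?scale1r//.
by rewrite -unitfE; move: Yu; rewrite unitmxE.
Qed.

Lemma nsq_gram_solve_le Y V : Y^T = Y -> nsq (gram_solve Y V) <= 4 * nsq V.
Proof.
move=> Ys; have [near|far] := boolP (near_identity Y).
  by have := near_identity_nsq (gram_solve Y V) Ys near; rewrite gram_solveK.
by rewrite /gram_solve (negPf far) /nsq {1}/dotc mulmx0 mxE mulr_ge0// nsq_ge0.
Qed.

Lemma measurable_gram_solve d (T : measurableType d) (Y : T -> 'M[R]_k) (V : T -> 'cV[R]_k) :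
  mx_in_subalg (fun f : T -> R => measurable_fun setT f) Y ->
  mx_in_subalg (fun f : T -> R => measurable_fun setT f) V ->
  mx_in_subalg (fun f : T -> R => measurable_fun setT f) (fun x => gram_solve (Y x) (V x)).
Proof.
have ma := @measurable_fun_alg R d T => mY mV i j.
rewrite (_ : (fun x => _) = (fun x => if near_identity (Y x) then
  (\det (Y x))^-1 * (\adj (Y x) *m V x) i j else 0)); last first.
  by apply/funext => x; rewrite /gram_solve; case: ifP; rewrite mxE.
apply: measurable_fun_ifT.
- apply: measurable_fun_ltr; last exact: measurable_cst.
  apply: (mx_subalg_tr ma); apply: (mx_subalgX ma); apply: (mx_subalgB ma) => //.
- apply: measurable_funM.
    by apply: measurable_fun_inv; exact: (mx_subalg_det ma).
  by apply: (mx_subalgM ma) => //; exact: (mx_subalg_adj ma).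
- exact: measurable_cst.
Qed.

End GramSolve.

(** * Moments of sign sums with random coefficients *)

Section SignMoments.
Context {d : measure_display} {T : measurableType d} {R : realType}.
Variable P : probability T R.
Variable G : set T.
Hypotheses (mG : measurable G) (PG : P G = 1%E).

(** Each product of a conjugate coefficient and a sign is a plane vector of mean zero and constant
    length [|u j|], so Rademacher and Steinhaus signs are both covered by [strong_moment_bound]. *)
Lemma sign_moment k (C : 'I_k -> set (set T)) (X : T -> 'I_k -> R[i]) q :
  (forall j, <<s C j >> `<=` measurable) ->
  mutually_independent P (fun j => <<s C j >>) ->
  (forall j, adapted G (C j) (fun w => creal (X w j)) /\
     adapted G (C j) (fun w => cimag (X w j))) ->
  (forall j, mean P (fun w => creal (X w j)) = 0 /\ mean P (fun w => cimag (X w j)) = 0) ->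
  (forall j w, cabs2 (X w j) = 1) ->
  forall u : 'cV[R[i]]_k,
  mean P (fun w => cabs2 ((adjmx u *m \col_j X w j) 0 0) ^+ q) <=
  (q%:R * nsq (realify_vec u)) ^+ q.
Proof.
move=> Cm Cind hX X0 X1 u.
pose F j w : 'cV[R]_(1 + 1) := realify_vec (\col_(_ < 1) (cconj (u j 0) * X w j)).
have FE j w a : F j w a 0 = if (a < 1)%N then
    creal (u j 0) * creal (X w j) + cimag (u j 0) * cimag (X w j) else
    creal (u j 0) * cimag (X w j) + - cimag (u j 0) * creal (X w j).
  rewrite /F; case: (split_ordP a) => b ->.
    by rewrite (ord1 b) col_mxEu !mxE /= !cE; ring.
  by rewrite (ord1 b) col_mxEd !mxE /= !cE; ring.
have hF j : mx_in_subalg (adapted G (C j)) (F j).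
  move=> a b; rewrite (ord1 b).
  have [hr hi] := hX j; have aa := adapted_alg (T := T) (R := R) G (C j).
  have ext (f g : T -> R) : (forall x, f x = g x) -> adapted G (C j) f -> adapted G (C j) g.
    by exact: fun_subalg_ext.
  have [a1|a1] := boolP (a < 1)%N.
    apply: ext (adaptedD (fun_subalgZ aa (creal (u j 0)) hr) (fun_subalgZ aa (cimag (u j 0)) hi)).
    by move=> w; rewrite FE a1.
  apply: ext (adaptedD (fun_subalgZ aa (creal (u j 0)) hi) (fun_subalgZ aa (- cimag (u j 0)) hr)).
  by move=> w; rewrite FE (negPf a1).
have F0 j : mxmean P (F j) = 0.
  apply/matrixP => a b; rewrite (ord1 b) !mxE.
  have [[br _] [bi _]] := hX j; have [hr hi] := X0 j.
  rewrite (_ : (fun w => _) = (fun w => if (a < 1)%N then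
    creal (u j 0) * creal (X w j) + cimag (u j 0) * cimag (X w j) else
    creal (u j 0) * cimag (X w j) + - cimag (u j 0) * creal (X w j))); last first.
    by apply/funext => w; exact: FE.
  have bz (c : R) (f : T -> R) : bounded_rv f -> bounded_rv (fun w => c * f w) by exact: bounded_rvZ.
  case: (a < 1)%N; rewrite (meanD P (bz _ _ _) (bz _ _ _)) ?(meanZ P _ br) ?(meanZ P _ bi)//.
    by rewrite hr hi !mulr0 addr0.
  by rewrite hr hi !mulr0 addr0.
have Fs j w : nsq (F j w) = cabs2 (u j 0).
  rewrite /F -sqr_l2norm /l2norm sqr_sqrtr.
    by rewrite big_ord1 mxE cabs2M cabs2_conj X1 mulr1.
  by apply: sumr_ge0 => i _; exact: cabs2_ge0.
have EF : \sum_j mxmean P (F j) = 0 by rewrite big1.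
have := strong_moment_bound mG PG Cm Cind hF EF F0 Fs q.
have -> : \sum_j cabs2 (u j 0) = nsq (realify_vec u).
  rewrite -sqr_l2norm sqr_sqrtr//.
  by apply: sumr_ge0 => i _; exact: cabs2_ge0.
apply: le_trans; rewrite le_eqVlt; apply/orP; left; apply/eqP; congr mean.
apply/funext => w; congr (_ ^+ _); rewrite /centered_sum subr0.
have -> : \sum_j F j w = realify_vec (adjmx u *m \col_j X w j).
  rewrite /F -(big_morph _ (@realify_vecD R 1) (@realify_vec0 R 1)); congr realify_vec.
  by apply/matrixP => a b; rewrite (ord1 a) (ord1 b) summxE mxE; apply: eq_bigr => j _; rewrite !mxE.
by rewrite -sqr_l2norm sqr_sqrtr ?big_ord1// cabs2_ge0.
Qed.

(* Conditioning on the coefficients, which are independent of the signs *)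
Lemma decoupled_sign_moment k (Cu Cs : set (set T)) (C : 'I_k -> set (set T))
   (X : T -> 'I_k -> R[i]) (u : T -> 'cV[R[i]]_k) q (b : T -> R) :
  <<s Cu >> `<=` measurable -> <<s Cs >> `<=` measurable ->
  (forall E F, <<s Cu >> E -> <<s Cs >> F -> P (E `&` F) = (P E * P F)%E) ->
  (forall j, <<s C j >> `<=` measurable) ->
  mutually_independent P (fun j => <<s C j >>) ->
  (forall j, adapted G (C j) (fun w => creal (X w j)) /\
     adapted G (C j) (fun w => cimag (X w j))) ->
  (forall j, adapted G Cs (fun w => creal (X w j)) /\
     adapted G Cs (fun w => cimag (X w j))) ->
  (forall j, mean P (fun w => creal (X w j)) = 0 /\ mean P (fun w => cimag (X w j)) = 0) ->
  (forall j w, cabs2 (X w j) = 1) ->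
  cmx_in (adapted G Cu) u -> bounded_rv b -> (forall w, nsq (realify_vec (u w)) <= b w) ->
  mean P (fun w => cabs2 ((adjmx (u w) *m \col_j X w j) 0 0) ^+ q) <=
  mean P (fun w => (q%:R * b w) ^+ q).
Proof.
move=> Cum Csm Cus Cm Cind hX hXs X0 X1 hu bb ub.
(* Two blocks only, coefficients and signs: reading the signs at a separate sample point freezes the
   coefficients, and [sign_moment] applies inside. *)
pose C2 (c : bool) := if c then Cu else Cs.
have C2m c : <<s C2 c >> `<=` measurable by case: c.
have C2ind : mutually_independent P (fun c => <<s C2 c >>).
  move=> E hE; rewrite big_bool /= -Cus; [|exact: (hE true)|exact: (hE false)].
  by congr (P _); apply/seteqP; split => [w h|w [h1 h2] [] _ //]; split; exact: h.
pose Fr (x : T * T * T) := \sum_j (creal (u x.1.1 j 0) * creal (X x.1.2 j) +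
  cimag (u x.1.1 j 0) * cimag (X x.1.2 j)).
pose Fi (x : T * T * T) := \sum_j (creal (u x.1.1 j 0) * cimag (X x.1.2 j) -
  cimag (u x.1.1 j 0) * creal (X x.1.2 j)).
have pa := polyadm_alg (R := R) G C2 false.
have pu j : polyadm3 G C2 false (fun x => creal (u x.1.1 j 0)) /\
    polyadm3 G C2 false (fun x => cimag (u x.1.1 j 0)).
  by have [h1 h2] := hu j 0; split; [exact: (polyadm0 (C := C2) (l := false) (k := true) isT h1)|
    exact: (polyadm0 (C := C2) (l := false) (k := true) isT h2)].
have pX j : polyadm3 G C2 false (fun x => creal (X x.1.2 j)) /\
    polyadm3 G C2 false (fun x => cimag (X x.1.2 j)).
  by have [h1 h2] := hXs j; split;
    [exact: (polyadm1 (C := C2) (l := false) h1)|exact: (polyadm1 (C := C2) (l := false) h2)].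
have pr : polyadm3 G C2 false Fr.
  apply: (fun_subalg_sum pa) => j _; have [ur ui] := pu j; have [xr xi] := pX j.
  exact: (fun_subalgD pa (fun_subalgM pa ur xr) (fun_subalgM pa ui xi)).
have pi : polyadm3 G C2 false Fi.
  apply: (fun_subalg_sum pa) => j _; have [ur ui] := pu j; have [xr xi] := pX j.
  exact: (fun_subalgB pa (fun_subalgM pa ur xi) (fun_subalgM pa ui xr)).
have pF := fun_subalgX pa q (fun_subalgD pa (fun_subalgX pa 2 pr) (fun_subalgX pa 2 pi)).
have FE w0 w1 w2 : cabs2 ((adjmx (u w0) *m \col_j X w1 j) 0 0) =
    Fr (w0, w1, w2) ^+ 2 + Fi (w0, w1, w2) ^+ 2.
  rewrite /cabs2 mxE creal_sum cimag_sum /Fr /Fi /=; congr (_ ^+ 2 + _ ^+ 2).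
    by apply: eq_bigr => j _; rewrite !mxE !cE; ring.
  by apply: eq_bigr => j _; rewrite !mxE !cE; ring.
pose F w0 w1 := cabs2 ((adjmx (u w0) *m \col_j X w1 j) 0 0) ^+ q.
have pF' : polyadm G C2 false (fun w0 w1 _ => F w0 w1).
  have -> : (fun w0 w1 _ => F w0 w1) =
      (fun w0 w1 w2 => (Fr (w0, w1, w2) ^+ 2 + Fi (w0, w1, w2) ^+ 2) ^+ q).
    apply/funext => w0; apply/funext => w1; apply/funext => w2; rewrite /F.
    by rewrite (FE w0 w1 w2).
  exact: pF.
rewrite (mean_decouple mG PG C2m C2ind pF').
apply: mean_le.
- exact: (polyadm_bounded1 mG PG C2m C2ind (polyadm_swap pF')).
- by apply: bounded_rvX; exact: bounded_rvZ.
- move=> w; apply: le_trans (sign_moment q Cm Cind hX X0 X1 (u w)) _.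
  apply: lerXn2r; rewrite ?nnegrE ?mulr_ge0// ?nsq_ge0//.
    exact: le_trans (nsq_ge0 _) (ub w).
  by rewrite ler_wpM2l.
Qed.

End SignMoments.

Section AdaptedGenerators.
Context {d : measure_display} {T : measurableType d} {R : realType}.

Lemma adapted_gen_sets (G : set T) (I : Type) (f : I -> T -> R) i (u : T -> R) :
  bounded_rv u -> (forall w, G w -> u w = f i w) -> adapted G (gen_sets f) u.
Proof. by move=> bu uf; split => //; exists (f i) => //; exact: measurable_gen_sets. Qed.

Lemma bounded_rv_if (G : set T) (f : T -> R) (M : R) : measurable G ->
  measurable_fun setT f -> (forall w, G w -> `|f w| <= M) -> 0 <= M ->
  bounded_rv (fun w => if w \in G then f w else 0).
Proof.
move=> mG mf fM M0; split.
  rewrite (_ : (fun w => _) = (fun w => f w * \1_G w)).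
    by apply: measurable_funM => //; exact: measurable_indic.
  by apply/funext => w; rewrite indicE; case: (_ \in _); rewrite ?mulr1 ?mulr0.
exists M => w; case: ifPn => [/set_mem/fM//|_]; by rewrite normr0.
Qed.

End AdaptedGenerators.

(** * Restriction to the support in real coordinates *)

Section SupportFrame.
Variables (R : realType) (n : nat) (S : {set 'I_n}).

Definition support_frame : 'M[R]_(n + n, #|S| + #|S|) := realify_mx (adjmx (PS S)).
Local Notation E := support_frame.
Definition real_unit (i : 'I_n) : 'cV[R]_(n + n) := realify_vec (delta_mx i 0).
Local Notation e := real_unit.

Lemma support_frame_orthonormal : E^T *m E = 1%:M.
Proof.
rewrite /E -realify_adj adjmxK -realify_mulmx -realify_mx1; congr realify_mx.
apply/matrixP => j k; rewrite mxE (bigD1 (enum_val j))//= mxE eqxx mul1r adjPSE.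
rewrite big1 ?addr0 => [|i /negPf ij]; last by rewrite mxE ij mul0r.
by rewrite mxE (inj_eq enum_val_inj) eq_sym.
Qed.

Lemma support_frame_unit i : i \notin S -> E^T *m e i = 0.
Proof.
move=> iS; rewrite /E /e -realify_adj adjmxK -realify_mulmx_vec -realify_vec0; congr realify_vec.
apply/colP => j; rewrite PS_mulE !mxE; case: eqP => //= ij.
by rewrite -ij enum_valP in iS.
Qed.

Lemma nsq_real_unit i : nsq (e i) = 1.
Proof.
rewrite -sqr_l2norm sqr_sqrtr; last by apply: sumr_ge0 => j _; exact: cabs2_ge0.
rewrite (bigD1 i)//= big1 => [|j /negPf ji].
  by rewrite mxE !eqxx /cabs2 /= expr1n expr0n /= !addr0.
by rewrite mxE ji /cabs2 /= expr0n /= addr0.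
Qed.

Lemma mul_real_unit a (M : 'M[R[i]]_(a, n)) i :
  realify_mx M *m e i = realify_vec (col i M).
Proof. by rewrite -realify_mulmx_vec colE. Qed.

Lemma realify_restrS a (M : 'M[R[i]]_(a, n)) : realify_mx (restrS S M) = realify_mx M *m E.
Proof. by rewrite realify_mulmx. Qed.

Variable N : nat.
Implicit Type A : 'M[R[i]]_(N, n).

Definition support_gram A : 'M[R]_(#|S| + #|S|) :=
  (realify_mx A *m E)^T *m (realify_mx A *m E).
Definition cross_gram i A : 'cV[R]_(#|S| + #|S|) :=
  (realify_mx A *m E)^T *m (realify_mx A *m e i).

Lemma support_gram_sym A : (support_gram A)^T = support_gram A.
Proof. by rewrite /support_gram [LHS]trmx_mul trmxK. Qed.

Lemma support_gramE A v : support_gram A *m realify_vec v =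
  realify_vec (adjmx (restrS S A) *m restrS S A *m v).
Proof.
by rewrite /support_gram realify_mulmx_vec realify_mulmx realify_adj realify_restrS.
Qed.

Lemma cross_gramE i A : cross_gram i A = realify_vec (adjmx (restrS S A) *m col i A).
Proof.
by rewrite /cross_gram realify_mulmx_vec realify_adj realify_restrS mul_real_unit.
Qed.

Definition cert_coef q i A : 'cV[R[i]]_#|S| :=
  complexify_vec (gram_solve q (support_gram A) (cross_gram i A)).

Section Measurability.
Variables (U : Type) (Q : (U -> R) -> Prop) (A : U -> 'M[R[i]]_(N, n)).
Hypotheses (Qalg : fun_subalg Q) (QA : cmx_in Q A).

Lemma support_gram_in : mx_in_subalg Q (fun x => support_gram (A x)).
Proof.
have rA := mx_subalgM Qalg (cmx_in_realify Qalg QA) (mx_subalg_cst Qalg E).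
exact: (mx_subalgM Qalg (mx_subalgT rA) rA).
Qed.

Lemma cross_gram_in i : mx_in_subalg Q (fun x => cross_gram i (A x)).
Proof.
have rA := mx_subalgM Qalg (cmx_in_realify Qalg QA) (mx_subalg_cst Qalg E).
exact: (mx_subalgM Qalg (mx_subalgT rA)
  (mx_subalgM Qalg (cmx_in_realify Qalg QA) (mx_subalg_cst Qalg (e i)))).
Qed.

End Measurability.

Lemma measurable_cert_coef d (T : measurableType d) (A : T -> 'M[R[i]]_(N, n)) q i :
  cmx_in (fun f : T -> R => measurable_fun setT f) A ->
  cmx_in (fun f : T -> R => measurable_fun setT f) (fun x => cert_coef q i (A x)).
Proof.
move=> mA; have ma := @measurable_fun_alg R d T.
apply: cmx_in_complexify; apply: measurable_gram_solve.
  exact: support_gram_in. exact: cross_gram_in.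
Qed.

Lemma nsq_cert_coef q i A :
  nsq (realify_vec (cert_coef q i A)) <= 4 * nsq (cross_gram i A).
Proof. by rewrite complexify_vecK; apply: nsq_gram_solve_le; exact: support_gram_sym. Qed.

Lemma cert_coefK q i A : near_identity q (support_gram A) ->
  adjmx (restrS S A) *m restrS S A *m cert_coef q i A = adjmx (restrS S A) *m col i A.
Proof.
move=> near; apply: realify_vec_inj; rewrite -support_gramE -cross_gramE complexify_vecK.
by apply: gram_solveK => //; exact: support_gram_sym.
Qed.

Lemma near_identity_restrS q A v : near_identity q (support_gram A) ->
  l2norm v ^+ 2 <= 2 * l2norm (restrS S A *m v) ^+ 2.
Proof.
move=> near; have := near_identity_dotc (realify_vec v) (support_gram_sym A) near.
rewrite !sqr_l2norm realify_mulmx_vec realify_restrS /support_gram => h.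
apply: le_trans h _; rewrite ler_wpM2l//.
by rewrite -mulmxA dotc_mulmx trmxK.
Qed.

End SupportFrame.

(** [4 * 64/25] comes from the trace moment at the threshold of [near_identity]. [1360/81] is the
    product of [100/81] from the threshold on sign sums, 4 from [nsq_cert_coef] and [34/10] from the
    cross moment. *)
Lemma moment_constants (R : realFieldType) (x : R) : 0 <= x -> x <= 1 / 50 ->
  [/\ 0 <= 4 * (64 / 25 * x), 4 * (64 / 25 * x) <= 34 / 100 & 1360 / 81 * x <= 34 / 100].
Proof. by split; lra. Qed.

Lemma sum3_lt1 (R : realFieldType) (x y z : R) : 0 <= x -> 0 <= y -> 0 <= z ->
  x + y + z < 1 -> [/\ x < 1, y < 1 & z < 1].
Proof. by split; lra. Qed.

Lemma sum3_le (R : realFieldType) (x y z t : R) : x <= t -> y <= t -> z <= t ->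
  x + y + z <= 3 * t.
Proof. lra. Qed.

Lemma scaled_le1 (R : realFieldType) (x : R) : 100 / 81 * x <= 1 -> x <= 81 / 100.
Proof. lra. Qed.

Lemma scaled_le (R : realFieldType) (x : R) : x <= 1 / 100 -> 34 / 10 * x <= 34 / 100.
Proof. lra. Qed.

(** * Moments and good event for the sensing matrix *)

Section Certificate.
Context {d : measure_display} {T : measurableType d} {R : realType}.
Variables (P : probability T R) (n m : nat) (p : 'I_m -> nat) (S : {set 'I_n}).
Variables (B : forall l : 'I_m, T -> 'M[R[i]]_(p l, n)) (sg : T -> 'I_#|S| -> R[i]).
Variables (Lam Gam : R) (G : set T).
Hypotheses (mG : measurable G) (PG : P G = 1%E) (m0 : (0 < m)%N).
Hypotheses (Lam0 : 0 < Lam) (Gam0 : 0 < Gam).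
Hypothesis mB : forall l i j, measurable_cplx (fun w => B l w i j).
Hypothesis indB : mutually_independent P (fun l => sigma_mx (B l)).
Hypothesis isoB : forall i j : 'I_n,
  cexpect P (fun w => (adjmx (sensing B w) *m sensing B w) i j) = (i == j)%:R.
Hypothesis boundB : forall w, G w -> forall l,
  opnorm22_le (adjmx (restrS S (B l w)) *m restrS S (B l w)) Lam /\
  colnorm12_sq_le (B l w) Gam.
Hypothesis msg : forall j, measurable_cplx (fun w => sg w j).
Hypothesis indsg : mutually_independent P (fun j => sigma_cplx (fun w => sg w j)).
Hypothesis sg1 : forall w, G w -> forall j, cabs2 (sg w j) = 1.
Hypothesis sg0 : forall j, mean P (fun w => creal (fix_sign G (fun w => sg w j) w)) = 0 /\
  mean P (fun w => cimag (fix_sign G (fun w => sg w j) w)) = 0.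
Hypothesis indBsg : independent2 P (sigma_mx (sensing B)) (sigma_vec sg).

Local Notation bounded_mx := (mx_in_subalg (@bounded_rv d T R)).

(* Modification on a null set, after which the almost sure bounds hold surely *)
Definition fix_mx l w : 'M[R[i]]_(p l, n) := if w \in G then B l w else 0.
Definition fix_sg w j := fix_sign G (fun w => sg w j) w.
Local Notation A w := (sensing fix_mx w).
Local Notation Br := (fun l w => realify_mx (fix_mx l w)).

Definition entry a b (M : 'M[R[i]]_(a, b)) (k : 'I_a * 'I_b * bool) : R :=
  if k.2 then creal (M k.1.1 k.1.2) else cimag (M k.1.1 k.1.2).
Local Notation CB := (fun l => gen_sets (fun k w => entry (B l w) k)).
Local Notation CA := (gen_sets (fun k w => entry (sensing B w) k)).
Local Notation Csg := (gen_sets (fun (c : 'I_#|S| * bool) w =>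
  if c.2 then creal (sg w c.1) else cimag (sg w c.1))).
Local Notation Cs := (fun j => gen_sets (fun (b : bool) w =>
  if b then creal (sg w j) else cimag (sg w j))).

Lemma fix_mx_on l w : G w -> fix_mx l w = B l w.
Proof. by move=> Gw; rewrite /fix_mx mem_set. Qed.

Lemma sensing_fix_on w : G w -> A w = sensing B w.
Proof. by move=> Gw; rewrite /sensing; congr (_ *: _); apply/matrixP => i j; rewrite !mxE fix_mx_on. Qed.

Lemma sqr_le_col l w i j : G w -> cabs2 (B l w i j) <= Gam.
Proof.
move=> Gw; have [_ /(_ j)] := boundB Gw l; apply: le_trans.
rewrite sqr_sqrtr; last by apply: sumr_ge0 => k _; exact: cabs2_ge0.
rewrite (bigD1 i)//= mxE lerDl; apply: sumr_ge0 => k _; exact: cabs2_ge0.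
Qed.

(** A crude bound that avoids square roots; it is used only to establish boundedness. *)
Lemma norm_le_of_sqr (x M : R) : x ^+ 2 <= M -> `|x| <= 1 + M.
Proof.
move=> xM; have h0 := sqr_ge0 (`|x| - 1); move: h0 xM; rewrite -[x ^+ 2]real_normK ?num_real//.
move: `|x| (normr_ge0 x) => y y0; rewrite sqrrB1; have := sqr_ge0 y; lra.
Qed.

Lemma fix_mx_adapted l : cmx_in (adapted G (CB l)) (fix_mx l).
Proof.
move=> i j; have [mr mi] := @mB l i j.
have G1 : 0 <= 1 + Gam by rewrite addr_ge0// ltW.
have br w : G w -> `|creal (B l w i j)| <= 1 + Gam.
  move=> /sqr_le_col => /(_ l i j) h; apply: norm_le_of_sqr; apply: le_trans h.
  by rewrite lerDl sqr_ge0.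
have bi w : G w -> `|cimag (B l w i j)| <= 1 + Gam.
  move=> /sqr_le_col => /(_ l i j) h; apply: norm_le_of_sqr; apply: le_trans h.
  by rewrite lerDr sqr_ge0.
split.
- apply: (adapted_gen_sets (i := (i, j, true))) => [|w Gw]; last by rewrite fix_mx_on.
  have := bounded_rv_if mG mr br G1; congr bounded_rv; apply/funext => w.
  by rewrite /fix_mx; case: ifP; rewrite ?mxE.
- apply: (adapted_gen_sets (i := (i, j, false))) => [|w Gw]; last by rewrite fix_mx_on.
  have := bounded_rv_if mG mi bi G1; congr bounded_rv; apply/funext => w.
  by rewrite /fix_mx; case: ifP; rewrite ?mxE.
Qed.

Lemma CB_measurable l : <<s CB l >> `<=` measurable.
Proof.
apply: gen_sets_measurable => -[[i j] b]; have [mr mi] := @mB l i j.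
by case: b.
Qed.

Lemma Br_adapted l : mx_in_subalg (adapted G (CB l)) (Br l).
Proof. by apply: cmx_in_realify; [exact: adapted_alg|exact: fix_mx_adapted]. Qed.

Lemma A_bounded : cmx_in (@bounded_rv d T R) (fun w => A w).
Proof.
apply: (cmx_in_sensing bounded_rv_alg) => l i j.
by have [[h1 _] [h2 _]] := @fix_mx_adapted l i j.
Qed.

Lemma measurable_sensing : cmx_in (fun f : T -> R => measurable_fun setT f) (sensing B).
Proof.
apply: (cmx_in_sensing (measurable_fun_alg T)) => l i j; exact: mB.
Qed.

Lemma sum_gram_part w : \sum_l gram_part Br l w = (realify_mx (A w))^T *m realify_mx (A w).
Proof. by rewrite (sensing_gram fix_mx w m0). Qed.

Lemma measurable_cmx_gram a b (F : T -> 'M[R[i]]_(a, b)) :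
  cmx_in (fun f : T -> R => measurable_fun setT f) F ->
  cmx_in (fun f : T -> R => measurable_fun setT f) (fun w => adjmx (F w) *m F w).
Proof.
move=> mF i j; have ma := measurable_fun_alg (R := R) T; split.
- rewrite (_ : (fun w => _) = (fun w => \sum_k (creal (F w k i) * creal (F w k j) +
    cimag (F w k i) * cimag (F w k j)))).
    apply: (fun_subalg_sum ma) => k _; apply: measurable_funD; apply: measurable_funM.
    exact: (mF k i).1. exact: (mF k j).1. exact: (mF k i).2. exact: (mF k j).2.
  by apply/funext => w; rewrite mxE creal_sum; apply: eq_bigr => k _; rewrite adjmxE !cE; ring.
- rewrite (_ : (fun w => _) = (fun w => \sum_k (creal (F w k i) * cimag (F w k j) -
    cimag (F w k i) * creal (F w k j)))).
    apply: (fun_subalg_sum ma) => k _; apply: measurable_funB; apply: measurable_funM.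
    exact: (mF k i).1. exact: (mF k j).2. exact: (mF k i).2. exact: (mF k j).1.
  by apply/funext => w; rewrite mxE cimag_sum; apply: eq_bigr => k _; rewrite adjmxE !cE; ring.
Qed.

(** Isotropy is given for [B] in complex form. The modification on a null set leaves the means
    unchanged, and the four blocks of the realified identity are the real and imaginary parts of the
    hypothesis. *)
Lemma mean_gram : \sum_l mxmean P (gram_part Br l) = 1%:M.
Proof.
have mM := measurable_cmx_gram measurable_sensing.
have mM' := measurable_cmx_gram (fun i j => conj (A_bounded i j).1.1 (A_bounded i j).2.1).
pose M w := adjmx (A w) *m A w.
have bA := cmx_in_realify bounded_rv_alg A_bounded.
have bM : bounded_mx (fun w => realify_mx (M w)).
  have := mx_subalgM bounded_rv_alg (mx_subalgT bA) bA; congr mx_in_subalg.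
  by apply/funext => w; rewrite /M realify_mulmx realify_adj.
have bl l : bounded_mx (gram_part Br l).
  by move=> i j; have [] := adapted_gram Br_adapted l i j.
transitivity (mxmean P (fun w => realify_mx (M w))).
  apply/matrixP => i j; rewrite summxE [RHS]mxE.
  rewrite (eq_bigr (fun l => mean P (fun w => gram_part Br l w i j))) => [|l _]; last by rewrite mxE.
  rewrite -mean_sum => [|l _]; last exact: bl.
  by congr mean; apply/funext => w; rewrite realify_mulmx realify_adj -sum_gram_part summxE.
have mr (a b : 'I_n) : mean P (fun w => creal (M w a b)) = (a == b)%:R.
  transitivity (mean P (fun w => creal ((adjmx (sensing B w) *m sensing B w) a b))).
    apply: (eq_mean_as mG PG); [exact: (mM' a b).1|exact: (mM a b).1|].
    by move=> w Gw; rewrite /M sensing_fix_on.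
  by have /(congr1 (@creal R)) := isoB a b; case: eqP.
have mi (a b : 'I_n) : mean P (fun w => cimag (M w a b)) = 0.
  transitivity (mean P (fun w => cimag ((adjmx (sensing B w) *m sensing B w) a b))).
    apply: (eq_mean_as mG PG); [exact: (mM' a b).2|exact: (mM a b).2|].
    by move=> w Gw; rewrite /M sensing_fix_on.
  by have /(congr1 (@cimag R)) := isoB a b; case: eqP.
rewrite -(realify_mx1 R n); apply/matrixP => i j; rewrite mxE.
have m1 (a b : 'I_n) : cimag ((a == b)%:R : R[i]) = 0 by case: eqP.
have bi (a b : 'I_n) : bounded_rv (fun w => cimag (M w a b)).
  have := bM (rshift n a) (lshift n b); congr bounded_rv; apply/funext => w.
  by rewrite block_mxEdl mxE.
have m1r (a b : 'I_n) : creal ((a == b)%:R : R[i]) = (a == b)%:R by case: eqP.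
case: (split_ordP i) => a ->; case: (split_ordP j) => b ->.
- rewrite block_mxEul !mxE m1r -[RHS]mr; congr mean; apply/funext => w.
  by rewrite block_mxEul mxE.
- rewrite block_mxEur !mxE m1 -(mi a b) -(meanN P (bi a b)); congr mean; apply/funext => w.
  by rewrite block_mxEur !mxE.
- rewrite block_mxEdl !mxE m1 -[RHS](mi a b); congr mean; apply/funext => w.
  by rewrite block_mxEdl mxE.
- rewrite block_mxEdr !mxE m1r -[RHS]mr; congr mean; apply/funext => w.
  by rewrite block_mxEdr mxE.
Qed.

Lemma gram_partE w : \sum_l (support_frame R S)^T *m gram_part Br l w *m support_frame R S =
  support_gram S (A w).
Proof.
by rewrite -mulmx_suml -mulmx_sumr sum_gram_part /support_gram trmx_mul !mulmxA.
Qed.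

Lemma cross_partE i w : \sum_l (support_frame R S)^T *m gram_part Br l w *m real_unit R i =
  cross_gram S i (A w).
Proof.
by rewrite -mulmx_suml -mulmx_sumr sum_gram_part /cross_gram trmx_mul !mulmxA.
Qed.

Lemma Br_frame_le l w v :
  nsq ((Br l w *m support_frame R S)^T *m (Br l w *m support_frame R S *m v)) <= Lam ^+ 2 * nsq v.
Proof.
rewrite -[v]complexify_vecK -realify_restrS -realify_adj -!realify_mulmx_vec -!sqr_l2norm.
rewrite -exprMn; apply: lerXn2r; rewrite ?nnegrE ?mulr_ge0 ?l2norm_ge0//; first exact: ltW.
rewrite /fix_mx; case: ifPn => [/set_mem Gw|_].
  by have [h _] := boundB Gw l; rewrite mulmxA; exact: h.
by rewrite /restrS !mul0mx mulmx0 l2norm0 mulr_ge0 ?l2norm_ge0// ltW.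
Qed.

Lemma Br_unit_le l w i : nsq (Br l w *m real_unit R i) <= Gam.
Proof.
rewrite mul_real_unit -sqr_l2norm /fix_mx; case: ifPn => [/set_mem Gw|_].
  by have [_ h] := boundB Gw l; exact: h.
have -> : col i (0 : 'M[R[i]]_(p l, n)) = 0 by apply/matrixP => a b; rewrite !mxE.
by rewrite l2norm0 expr0n ltW.
Qed.

Local Notation K := (Lam / m%:R).
Local Notation g := (Gam / m%:R).

Lemma support_trace_moment q : q%:R * K <= 1 / 50 ->
  mean P (fun w => \tr ((support_gram S (A w) - 1%:M) ^+ q.*2)) <=
  (#|S| + #|S|)%:R * (64 / 25 * q%:R * K) ^+ q.
Proof.
move=> qK.
have := gram_trace_moment mG PG m0 CB_measurable indB Br_adapted
  (@support_frame_orthonormal R n S) Lam0 Br_frame_le mean_gram qK.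
by under eq_fun do rewrite gram_partE.
Qed.

Lemma cross_vector_moment i q : let pp := q.+2 in i \notin S ->
  pp%:R * K <= 1 / 50 -> q.+1%:R * g * 50 <= K -> pp%:R * g <= 1 / 2500 ->
  (#|S| + #|S|)%:R * (34 / 100) ^+ pp <= 1 / 3 :> R ->
  mean P (fun w => nsq (cross_gram S i (A w)) ^+ pp) <= (34 / 10 * K) ^+ pp.
Proof.
move=> pp iS h1 h2 h3 h4.
have := cross_moment mG PG m0 CB_measurable indB Br_adapted
  (@support_frame_orthonormal R n S) Lam0 Gam0 Br_frame_le mean_gram
  (support_frame_unit R iS) (nsq_real_unit R i) (fun l w => Br_unit_le l w i) h1 h2 h3 h4.
by under eq_fun do rewrite cross_partE.
Qed.

Lemma CA_measurable : <<s CA >> `<=` measurable.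
Proof.
apply: gen_sets_measurable => -[[i j] b]; have [mr mi] := measurable_sensing i j.
by case: b.
Qed.

Lemma Csg_measurable : <<s Csg >> `<=` measurable.
Proof. by apply: gen_sets_measurable => -[j b]; have [mr mi] := msg j; case: b. Qed.

Lemma Cs_measurable j : <<s Cs j >> `<=` measurable.
Proof. by apply: gen_sets_measurable => b; have [mr mi] := msg j; case: b. Qed.

Lemma cross_gram_bounded i : bounded_rv (fun w => nsq (cross_gram S i (A w))).
Proof.
have h := cross_gram_in (S := S) bounded_rv_alg A_bounded i.
exact: (fun_subalg_dotc bounded_rv_alg h h).
Qed.

(** On [G] the coefficients coincide with the same formula at the unmodified [sensing B], which is
    measurable for the sigma-algebra independent of the signs. The modified matrix involves [G] and
    need not be measurable for it. *)
Lemma cert_coef_adapted q i : cmx_in (adapted G CA) (fun w => cert_coef S q i (A w)).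
Proof.
have [_ [M hM]] := cross_gram_bounded i.
have bnd w j : cabs2 (cert_coef S q i (A w) j 0) <= 4 * M.
  apply: le_trans (_ : nsq (realify_vec (cert_coef S q i (A w))) <= _).
    rewrite -sqr_l2norm sqr_sqrtr; last by apply: sumr_ge0 => k _; exact: cabs2_ge0.
    by rewrite (bigD1 j)//= lerDl; apply: sumr_ge0 => k _; exact: cabs2_ge0.
  apply: le_trans (nsq_cert_coef _ _ _ _) _; rewrite ler_wpM2l//.
  exact: le_trans (ler_norm _) (hM w).
have mA := measurable_cert_coef (S := S) q i (fun a b => conj (A_bounded a b).1.1 (A_bounded a b).2.1).
have mA' : cmx_in (fun f : g_sigma_algebraType CA -> R => measurable_fun setT f)
    (fun w => cert_coef S q i (sensing B w)).
  apply: (measurable_cert_coef (S := S) (T := g_sigma_algebraType CA)) => a b; split.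
    exact: (measurable_gen_sets (f := fun k w => entry (sensing B w) k) (a, b, true)).
  exact: (measurable_gen_sets (f := fun k w => entry (sensing B w) k) (a, b, false)).
move=> j k; rewrite (ord1 k); split.
- split.
    split; first exact: (mA j 0).1.
    exists (1 + 4 * M) => w; apply: norm_le_of_sqr; apply: le_trans (bnd w j).
    by rewrite lerDl sqr_ge0.
  exists (fun w => creal (cert_coef S q i (sensing B w) j 0)); first exact: (mA' j 0).1.
  by move=> w Gw; rewrite sensing_fix_on.
- split.
    split; first exact: (mA j 0).2.
    exists (1 + 4 * M) => w; apply: norm_le_of_sqr; apply: le_trans (bnd w j).
    by rewrite lerDr sqr_ge0.
  exists (fun w => cimag (cert_coef S q i (sensing B w) j 0)); first exact: (mA' j 0).2.
  by move=> w Gw; rewrite sensing_fix_on.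
Qed.

Lemma fix_sg_adapted j :
  (adapted G (Cs j) (fun w => creal (fix_sg w j)) /\
   adapted G (Cs j) (fun w => cimag (fix_sg w j))) /\
  (adapted G Csg (fun w => creal (fix_sg w j)) /\
   adapted G Csg (fun w => cimag (fix_sg w j))).
Proof.
have [br bi] := bounded_fix_sign mG (msg j) (fun w Gw => sg1 Gw j).
have on w : G w -> fix_sg w j = sg w j by move=> Gw; rewrite /fix_sg /fix_sign mem_set.
split; split.
- by apply: (adapted_gen_sets (i := true)) => // w /on ->.
- by apply: (adapted_gen_sets (i := false)) => // w /on ->.
- by apply: (adapted_gen_sets (i := (j, true))) => // w /on ->.
- by apply: (adapted_gen_sets (i := (j, false))) => // w /on ->.
Qed.

Definition off_support q i w : R :=
  cabs2 ((adjmx (cert_coef S q i (A w)) *m \col_j fix_sg w j) 0 0).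

Lemma off_support_moment q i k :
  mean P (fun w => off_support q i w ^+ k) <=
  mean P (fun w => (k%:R * (4 * nsq (cross_gram S i (A w)))) ^+ k).
Proof.
apply: (decoupled_sign_moment mG PG k CA_measurable Csg_measurable indBsg Cs_measurable indsg
  (fun j => (fix_sg_adapted j).1) (fun j => (fix_sg_adapted j).2) sg0 _
  (cert_coef_adapted q i) (bounded_rvZ 4 (cross_gram_bounded i))) => [j w|w].
  exact: (fix_sign_modulus (fun w Gw => sg1 Gw j)).
exact: nsq_cert_coef.
Qed.

Lemma off_support_bounded q i : bounded_rv (off_support q i).
Proof.
have hu j : bounded_rv (fun w => creal (cert_coef S q i (A w) j 0)) /\
    bounded_rv (fun w => cimag (cert_coef S q i (A w) j 0)).
  by have [[h1 _] [h2 _]] := cert_coef_adapted q i j 0.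
have hs j : bounded_rv (fun w => creal (fix_sg w j)) /\ bounded_rv (fun w => cimag (fix_sg w j)).
  by have [[[h1 _] [h2 _]] _] := fix_sg_adapted j.
have E w : off_support q i w = (\sum_j (creal (cert_coef S q i (A w) j 0) * creal (fix_sg w j) +
     cimag (cert_coef S q i (A w) j 0) * cimag (fix_sg w j))) ^+ 2 +
   (\sum_j (creal (cert_coef S q i (A w) j 0) * cimag (fix_sg w j) -
     cimag (cert_coef S q i (A w) j 0) * creal (fix_sg w j))) ^+ 2.
  rewrite /off_support /cabs2 mxE creal_sum cimag_sum; congr (_ ^+ 2 + _ ^+ 2);
    by apply: eq_bigr => j _; rewrite !mxE !cE; ring.
rewrite (funext E : off_support q i = _).
have h1 j : true -> bounded_rv (fun w => creal (cert_coef S q i (A w) j 0) * creal (fix_sg w j) +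
     cimag (cert_coef S q i (A w) j 0) * cimag (fix_sg w j)).
  have [ur ui] := hu j; have [sr si] := hs j => _.
  by apply: bounded_rvD; exact: bounded_rvM.
have h2 j : true -> bounded_rv (fun w => creal (cert_coef S q i (A w) j 0) * cimag (fix_sg w j) -
     cimag (cert_coef S q i (A w) j 0) * creal (fix_sg w j)).
  have [ur ui] := hu j; have [sr si] := hs j => _.
  by apply: bounded_rvD; [|apply: bounded_rvN]; exact: bounded_rvM.
exact: (bounded_rvD (bounded_rvX 2 (bounded_rv_sum (index_enum _) h1))
  (bounded_rvX 2 (bounded_rv_sum (index_enum _) h2))).
Qed.

(** Three powers, each scaled so that its threshold is 1, are added into a single nonnegative [f]
    with mean at most [3 n (34/100)^pp]; one Markov inequality at level 1 then controls all of them.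
    The condition on [#|S| + #|S|] bounds the real dimension of the support block by [n]. *)
Lemma certificate_event q eps : let pp := q.+2 in
  pp%:R * K <= 1 / 50 -> q.+1%:R * g * 50 <= K -> pp%:R * g <= 1 / 2500 ->
  (#|S| + #|S| <= n)%N -> eps < 1 -> 3 * n%:R * (34 / 100) ^+ pp <= eps ->
  exists Gf : set T, [/\ measurable Gf, ((1 - eps)%:E <= P Gf)%E & forall w, Gf w ->
    [/\ forall j, cabs2 (sg w j) = 1, near_identity q.+1 (support_gram S (sensing B w)) &
     forall i, i \notin S -> nsq (cross_gram S i (sensing B w)) <= 1 /\
       cabs2 ((adjmx (cert_coef S q.+1 i (sensing B w)) *m \col_j sg w j) 0 0) <= 81 / 100]].
Proof.
move=> pp h1 h2 h3 hn e1 he.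
have n0 : 0 <= n%:R :> R by [].
have K0 : 0 < K by rewrite divr_gt0// ltr0n.
have h4 : (#|S| + #|S|)%:R * (34 / 100) ^+ pp <= 1 / 3 :> R.
  have : (#|S| + #|S|)%:R * (34 / 100) ^+ pp <= n%:R * (34 / 100) ^+ pp :> R.
    by apply: ler_wpM2r; rewrite ?ler_nat// exprn_ge0.
  by move: he; rewrite -mulrA; move: (_ * _) (n%:R * _) => x y; lra.
have K1 : K <= 1 / 100.
  have : 2 * K <= pp%:R * K by rewrite ler_wpM2r ?ler_nat// ltW.
  by move: h1; move: (pp%:R * K) K => x y; lra.
have tr0 w : 0 <= \tr ((support_gram S (A w) - 1%:M) ^+ pp.*2).
  by apply: mxtr_even_ge0; rewrite linearB/= support_gram_sym trmx1.
have bY := support_gram_in (S := S) bounded_rv_alg A_bounded.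
have btr : bounded_rv (fun w => \tr ((support_gram S (A w) - 1%:M) ^+ pp.*2)).
  apply: (mx_subalg_tr bounded_rv_alg); apply: (mx_subalgX bounded_rv_alg).
  by apply: (mx_subalgB bounded_rv_alg) => //; exact: (mx_subalg_cst bounded_rv_alg).
pose f1 w := 4 ^+ pp * \tr ((support_gram S (A w) - 1%:M) ^+ pp.*2).
pose f2 w := \sum_(i | i \notin S) nsq (cross_gram S i (A w)) ^+ pp.
pose f3 w := \sum_(i | i \notin S) (100 / 81 * off_support q.+1 i w) ^+ pp.
have o0 i w : 0 <= off_support q.+1 i w by exact: cabs2_ge0.
have bf1 : bounded_rv f1 by exact: bounded_rvZ.
have bf2 : bounded_rv f2.
  by apply: bounded_rv_sum => i _; apply: bounded_rvX; exact: cross_gram_bounded.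
have bf3i i : bounded_rv (fun w => (100 / 81 * off_support q.+1 i w) ^+ pp).
  by apply: bounded_rvX; apply: bounded_rvZ; exact: off_support_bounded.
have bf3 : bounded_rv f3 by apply: bounded_rv_sum => i _.
have f10 w : 0 <= f1 w by rewrite mulr_ge0// exprn_ge0.
have f20 w : 0 <= f2 w by apply: sumr_ge0 => i _; rewrite exprn_ge0// nsq_ge0.
have f30 w : 0 <= f3 w by apply: sumr_ge0 => i _; rewrite exprn_ge0// mulr_ge0.
pose a : R := (34 / 100) ^+ pp.
have a0 : 0 <= a by rewrite exprn_ge0.
have pow_le (x : R) : 0 <= x -> x <= 34 / 100 -> x ^+ pp <= a.
  by move=> x0 x1; apply: lerXn2r; rewrite ?nnegrE.
have pK0 : 0 <= pp%:R * K by rewrite mulr_ge0// ltW.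
have [mc1 mc2 mc3] := moment_constants pK0 h1.
have m1 : mean P f1 <= n%:R * a.
  rewrite /f1 meanZ//; have := ler_wpM2l (_ : 0 <= 4 ^+ pp) (support_trace_moment h1).
  move=> /(_ (exprn_ge0 _ _)) h; apply: le_trans (h _) _ => //.
  rewrite mulrCA -exprMn; apply: ler_pM => //.
  - by rewrite exprn_ge0// -[64 / 25 * _ * _]mulrA.
  - by rewrite ler_nat.
  - by rewrite -[64 / 25 * _ * _]mulrA; exact: pow_le.
have mi i : i \notin S -> mean P (fun w => nsq (cross_gram S i (A w)) ^+ pp) <= (34 / 10 * K) ^+ pp.
  by move=> iS; exact: cross_vector_moment.
have sum_le (F : 'I_n -> R) : (forall i, i \notin S -> F i <= a) ->
    \sum_(i | i \notin S) F i <= n%:R * a.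
  move=> Fa; apply: le_trans (ler_sum _ Fa) _.
  by rewrite sumr_const -[leLHS]mulr_natl ler_wpM2r// ler_nat -[leqRHS]card_ord max_card.
have m2 : mean P f2 <= n%:R * a.
  rewrite mean_sum => [|i _]; last by apply: bounded_rvX; exact: cross_gram_bounded.
  apply: sum_le => i iS; apply: le_trans (mi i iS) _; apply: pow_le.
    by rewrite mulr_ge0// ltW.
  exact: scaled_le.
have m3 : mean P f3 <= n%:R * a.
  rewrite mean_sum => [|i _]; last exact: bf3i.
  apply: sum_le => i iS.
  rewrite (_ : (fun w => _) = (fun w => (100 / 81) ^+ pp * off_support q.+1 i w ^+ pp)); last first.
    by apply/funext => w; rewrite exprMn.
  rewrite meanZ; last by apply: bounded_rvX; exact: off_support_bounded.
  (* The single factor [pp] produced by the signs meets a cross moment that has none, so smallness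
     of [pp%:R * K] suffices. *)
  have := off_support_moment q.+1 i pp.
  rewrite (_ : (fun w => (pp%:R * _) ^+ pp) = (fun w => (pp%:R * 4) ^+ pp *
     nsq (cross_gram S i (A w)) ^+ pp)); last by apply/funext => w; rewrite -exprMn mulrA.
  rewrite meanZ; last by apply: bounded_rvX; exact: cross_gram_bounded.
  have := ler_wpM2l (_ : 0 <= (pp%:R * 4) ^+ pp) (mi i iS).
  move=> /(_ (exprn_ge0 _ _)) ha hb; have {ha hb} := le_trans hb (ha _).
  move=> /(_ (mulr_ge0 (ler0n R pp) (ler0n R 4))) hc.
  have := ler_wpM2l (_ : 0 <= (100 / 81) ^+ pp) hc => /(_ (exprn_ge0 _ _)) hd.
  apply: le_trans (hd _) _ => //; rewrite -!exprMn; apply: pow_le.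
    by rewrite !mulr_ge0// ltW.
  rewrite (_ : 100 / 81 * (pp%:R * 4 * (34 / 10 * K)) = 1360 / 81 * (pp%:R * K)); last by move: (pp%:R : R) (Lam / m%:R) => x y; field.
  exact: mc3.
pose f w := f1 w + f2 w + f3 w.
have bf : bounded_rv f by apply: bounded_rvD => //; exact: bounded_rvD.
have f0 w : 0 <= f w by rewrite !addr_ge0.
have mf : mean P f <= eps.
  rewrite /f (meanD P (bounded_rvD bf1 bf2) bf3) (meanD P bf1 bf2); apply: le_trans he.
  by rewrite -/a -[3 * _ * _]mulrA; exact: sum3_le.
have Pf := prob_ge_le_mean P bf f0 ltr01.
set F1 := [set w | 1 <= f w] in Pf.
have mF1 : measurable F1.
  rewrite -[X in measurable X]setTI.
  have := @measurable_fun_ler _ _ _ setT (fun=> 1) f (measurable_cst _) bf.1.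
  by move=> /(_ measurableT [set true]); apply.
exists (G `&` ~` F1); split.
- by apply: measurableI => //; exact: measurableC.
- have mX : measurable (G `&` ~` F1) by apply: measurableI => //; exact: measurableC.
  have h : (P (~` (G `&` ~` F1)) <= eps%:E)%E.
    rewrite setCI setCK; apply: le_trans (measureU2 _ _ _) _ => //; first exact: measurableC.
    have hG := prob_one_setC mG PG.
    rewrite [X in (X + _)%E]hG add0e; apply: le_trans Pf _.
    by rewrite divr1 lee_fin.
  have := probability_setC P (measurableC mX); rewrite setCK => ->.
  by rewrite EFinB leeB.
- move=> w [Gw /negP]; rewrite -ltNge => fw1.
  have [g1 g2 g3] := sum3_lt1 (f10 w) (f20 w) (f30 w) fw1; rewrite -(sensing_fix_on Gw); split.
  + exact: sg1.
  + rewrite /near_identity exprVn -[X in _ < X]mul1r ltr_pdivlMr ?exprn_gt0//.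
    by rewrite mulrC.
  + move=> i iS.
    have le1 (F : 'I_n -> R) : (forall i, 0 <= F i) -> \sum_(i | i \notin S) F i ^+ pp < 1 -> F i <= 1.
      move=> F0 hF; rewrite leNgt; apply/negP => Fi1.
      have : F i ^+ pp <= \sum_(i | i \notin S) F i ^+ pp.
        rewrite (bigD1 i)//= lerDl; apply: sumr_ge0 => j _; exact: exprn_ge0.
      have Fp : 1 < F i ^+ pp by rewrite exprn_egt1.
      by move=> /(lt_le_trans Fp) h; have := lt_trans h hF; rewrite ltxx.
    split; first by apply: (le1 (fun i => nsq (cross_gram S i (A w)))) => // k; exact: nsq_ge0.
    have c0 : 0 <= 100 / 81 :> R by [].
    have := le1 _ (fun k => mulr_ge0 c0 (o0 k w)) g3.
    rewrite /off_support.
    have -> : \col_j fix_sg w j = \col_j sg w j.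
      by apply/colP => j; rewrite !mxE /fix_sg /fix_sign mem_set.
    exact: scaled_le1.
Qed.

End Certificate.

(** * Probability of the good event *)

(** [1 + x <= exp x] at [-1/8] gives [7/8], which is squared three times and rounded down to
    [153/200], [117/200] and [34/100]. *)
Lemma expR_ge_inv34 (R : realType) : 34 / 100 <= expR (-1) :> R.
Proof.
have h : 7 / 8 <= expR (- (1 / 8)) :> R by apply: le_trans (expR_ge1Dx _); lra.
have -> : -1 = 2%:R * (2%:R * (2%:R * - (1 / 8))) :> R by field.
rewrite !expRM_natl.
have step (a b y : R) : 0 <= a -> b <= a ^+ 2 -> a <= y -> b <= y ^+ 2.
  by move=> a0 ba ay; apply: le_trans ba _; apply: lerXn2r; rewrite ?nnegrE// (le_trans a0).
apply: (step (117 / 200)); [lra|lra|].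
apply: (step (153 / 200)); [lra|lra|].
by apply: (step (7 / 8)) => //; lra.
Qed.

(* q.+2 is the integer part of ln x plus one. *)
Lemma moment_order (R : realType) (x : R) : 3 < x -> exists q : nat,
  [/\ q.+2%:R <= 2 * ln x, q.+1%:R <= ln x & x * (34 / 100) ^+ q.+2 <= 1].
Proof.
move=> x3; have x0 : 0 < x by lra.
pose L := ln x.
(* From [x > 3] and [e <= 100/34 < 3]; this makes the integer part of [L] positive. *)
have L1 : 1 <= L.
  rewrite -(expRK 1) /L ler_ln ?posrE ?expR_gt0//.
  have := expR_ge_inv34 R; have := expR_gt0 (1 : R).
  have : expR 1 * expR (-1) = 1 :> R by rewrite -expRD subrr expR0.
  by move: (expR 1) (expR (-1)) => a b ab a0 b0; have := ler_wpM2l (ltW a0) b0; lra.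
have L0 : 0 <= L by lra.
have := truncn_itv L0; set k := Num.truncn L => /andP[k1 k2].
have k0 : (0 < k)%N.
  by rewrite lt0n; apply/eqP => k0; move: k2; rewrite k0; lra.
(* The order [k + 1] lies strictly above [L], so that [(34/100)^(k+1) <= exp (- L) = 1 / x], and it
   is at most [2 L] because [1 <= L]. *)
exists k.-1; rewrite !prednK//; split => //.
  by rewrite -natr1 -/L; lra.
rewrite -(lnK (x := x)) ?posrE// -/L.
have h : (34 / 100) ^+ k.+1 <= expR (- L).
  apply: le_trans (_ : expR (-1) ^+ k.+1 <= _).
    by apply: lerXn2r; rewrite ?nnegrE ?expR_ge0// expR_ge_inv34.
  by rewrite -expRM_natl ler_expR mulrN1 lerN2 ltW.
apply: le_trans (ler_wpM2l (expR_ge0 L) h) _.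
by rewrite -expRD subrr expR0.
Qed.

Section Event.
Context {d : measure_display} {T : measurableType d} {R : realType}.
Variables (P : probability T R) (n m : nat) (p : 'I_m -> nat) (S : {set 'I_n}).
Variables (B : forall l : 'I_m, T -> 'M[R[i]]_(p l, n)) (sg : T -> 'I_#|S| -> R[i]).
Variables (Lam Gam eps : R).
Hypothesis sensB : sensing_setting P S B Lam Gam.
Hypothesis rsa : random_sign_assumption P B sg.

Lemma random_sign_modulus : exists G : set T, [/\ measurable G, P G = 1%E &
  forall w, G w -> forall j, cabs2 (sg w j) = 1].
Proof.
have one j : exists G : set T, [/\ measurable G, P G = 1%E & forall w, G w -> cabs2 (sg w j) = 1].
  have [[[msg [p12 _]]|[msg [circ _]]] _] := rsa.
    have [p1 p2] := p12 j.
    exists ([set w | sg w j = 1] `|` [set w | sg w j = -1]); split.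
    - by apply: measurableU; exact: (measurable_eq_cplx _ (msg j)).
    - exact: (prob_two_point (msg j)).
    - by move=> w []/= ->; rewrite /cabs2 /= ?oppr0 ?sqrrN expr1n expr0n addr0.
  exists [set w | cabs2 (sg w j) = 1]; split => //.
    exact: (measurable_unit_modulus (msg j)).
  apply: prob_one_of_null; first exact: (measurable_unit_modulus (msg j)).
  exact: (circle_unit_modulus (X := fun w => sg w j) (circ j)).
have {one} [F hF] := boolp.choice one.
suff [G [mG PG GF]] : exists G : set T, [/\ measurable G, P G = 1%E &
    forall w, G w -> forall j, j \in enum 'I_#|S| -> F j w].
  exists G; split => // w Gw j; have [_ _ ->//] := hF j.
  by apply: GF => //; rewrite mem_enum.
elim: (enum _) => [|j l [G [mG PG GF]]].
  by exists setT; split => //; exact: probability_setT.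
have [mF PF _] := hF j; exists (F j `&` G); split.
- exact: measurableI.
- exact: prob_one_setI.
- by move=> w [Fw Gw] i; rewrite inE => /orP[/eqP ->//|]; exact: GF.
Qed.

Lemma sure_bounds : exists G : set T, [/\ measurable G, P G = 1%E & forall w, G w ->
  (forall l, opnorm22_le (adjmx (restrS S (B l w)) *m restrS S (B l w)) Lam /\
     colnorm12_sq_le (B l w) Gam) /\ (forall j, cabs2 (sg w j) = 1)].
Proof.
have [_ [_ [_ [_ [_ [_ [N [mN N0 hN]]]]]]]] := sensB.
have [G [mG PG hG]] := random_sign_modulus.
have mC : measurable (~` N) by exact: measurableC.
exists (~` N `&` G); split.
- exact: measurableI.
- by apply: prob_one_setI => //; apply: prob_one_of_null => //; rewrite setCK.
- move=> w [Nw Gw]; split; last exact: hG.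
  by apply: contrapT => h; apply: Nw; exact: hN.
Qed.

Lemma mean_fix_sign G : measurable G -> P G = 1%E ->
  (forall w, G w -> forall j, cabs2 (sg w j) = 1) ->
  forall j, mean P (fun w => creal (fix_sign G (fun w => sg w j) w)) = 0 /\
    mean P (fun w => cimag (fix_sign G (fun w => sg w j) w)) = 0.
Proof.
move=> mG PG hG j; have [[[msg [p12 _]]|[msg [circ _]]] _] := rsa.
  have [p1 p2] := p12 j.
  exact: (mean_fix_sign_two_point mG PG (msg j) (fun w Gw => hG w Gw j) p1 p2).
exact: (mean_fix_sign_circle mG PG (msg j) (fun w Gw => hG w Gw j) (circ j)).
Qed.

Hypothesis S2 : (#|S| * 2 <= n)%N.
Hypothesis eps01 : 0 < eps < 1.
Hypothesis LamGam : 50 * Gam * ln (3 * n%:R / eps) <= Lam.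
Hypothesis mLam : 100 * Lam * ln (3 * n%:R / eps) <= m%:R.

(** Origin of 50 and 100: the order [p] is at most [2 L], so [100 K L <= 1] gives [p K <= 1/50];
    [50 g L <= K] gives [(p - 1) g <= K / 50], and with [K <= 1/100] also
    [p g <= 2 K / 50 <= 1/2500]. *)
Lemma recovery_event : exists G : set T, [/\ measurable G, ((1 - eps)%:E <= P G)%E &
  forall w, G w ->
  [/\ (forall j, cabs2 (sg w j) = 1),
   (forall v : 'cV[R[i]]_#|S|, l2norm v ^+ 2 <= 2 * l2norm (restrS S (sensing B w) *m v) ^+ 2) &
   (forall i, i \notin S -> exists u : 'cV[R[i]]_#|S|,
    [/\ adjmx (restrS S (sensing B w)) *m restrS S (sensing B w) *m u =
        adjmx (restrS S (sensing B w)) *m col i (sensing B w), l2norm u <= 2 &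
      cmod ((adjmx u *m \col_j sg w j) 0 0) <= 9 / 10])]].
Proof.
have [[n1 m1 _] [mB [indB [isoB [Lam0 [Gam0 _]]]]]] := sensB.
have [G [mG PG hG]] := sure_bounds.
have sg0 := mean_fix_sign mG PG (fun w Gw => (hG w Gw).2).
have [[e0 e1] m0] := (andP eps01, m1 : (0 < m)%N).
have mr0 : 0 < m%:R :> R by rewrite ltr0n.
have x3 : 3 < 3 * n%:R / eps.
  rewrite ltr_pdivlMr// ltr_pM2l//; apply: lt_le_trans e1 _.
  by rewrite ler1n.
have [q [q1 q2 q3]] := moment_order x3.
move: q1 q2 q3 LamGam mLam; set x := 3 * n%:R / eps in x3 *; set L := ln x => q1 q2 q3 LG mL.
have [msg indsg] : (forall j, measurable_cplx (fun w => sg w j)) /\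
    mutually_independent P (fun j => sigma_cplx (fun w => sg w j)).
  by have [[[? [_ ?]]|[? [_ ?]]] _] := rsa.
have indBsg := rsa.2.
have L1 : 1 <= L by apply: le_trans q2; rewrite ler1n.
have L0 : 0 < L by lra.
pose K := Lam / m%:R; pose g := Gam / m%:R.
have K0 : 0 < K by rewrite divr_gt0.
have g0 : 0 < g by rewrite divr_gt0.
have KL : 100 * K * L <= 1.
  have -> : 100 * K * L = 100 * Lam * L / m%:R by rewrite /K; field; rewrite gt_eqF.
  by rewrite ler_pdivrMr// mul1r.
have gK : 50 * g * L <= K.
  have -> : 50 * g * L = 50 * Gam * L / m%:R by rewrite /g; field; rewrite gt_eqF.
  by rewrite /K ler_pM2r ?invr_gt0.
have h1 : q.+2%:R * K <= 1 / 50.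
  have := ler_wpM2r (ltW K0) q1; move: KL; rewrite -mulrA [K * L]mulrC -[2 * L * K]mulrA.
  move: (L * K) (_ * K) => a b; lra.
have h2 : q.+1%:R * g * 50 <= K.
  have := ler_wpM2r (ltW g0) q2; move: gK; rewrite -mulrA [g * L]mulrC.
  move: (L * g) (_ * g) => a b; lra.
have h3 : q.+2%:R * g <= 1 / 2500.
  have K1 : K <= 1 / 100.
    have : K * 1 <= K * L by rewrite ler_wpM2l// ltW.
    by move: KL; rewrite -mulrA; move: (K * L) => a; lra.
  have := ler_wpM2r (ltW g0) q1; move: gK; rewrite -mulrA [g * L]mulrC -[2 * L * g]mulrA.
  move: K1; move: (L * g) (_ * g) (K) => a b c; lra.
have hn : (#|S| + #|S| <= n)%N by move: S2; rewrite muln2 addnn.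
have he : 3 * n%:R * (34 / 100) ^+ q.+2 <= eps.
  have := ler_wpM2l (ltW e0) q3.
  by rewrite mulr1 mulrA /x [eps * _]mulrC divfK ?gt_eqF.
have [Gf [mGf PGf hGf]] := certificate_event mG PG m0 Lam0 Gam0 mB indB isoB
  (fun w Gw => (hG w Gw).1) msg indsg (fun w Gw => (hG w Gw).2) sg0 indBsg h1 h2 h3 hn e1 he.
exists Gf; split => // w /hGf[s1 near cert]; split => //.
  by move=> v; exact: near_identity_restrS near.
move=> i iS; have [c1 c2] := cert i iS.
exists (cert_coef S q.+1 i (sensing B w)); split.
- exact: cert_coefK.
- rewrite -(@ler_pXn2r _ 2)// ?nnegrE ?l2norm_ge0// sqr_l2norm.
  apply: le_trans (nsq_cert_coef _ _ _ _) _; move: c1; move: (nsq _) => y; lra.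
- rewrite -(@ler_pXn2r _ 2)// ?nnegrE ?cmod_ge0// sqr_cmod; apply: le_trans c2 _.
  by rewrite le_eqVlt; apply/orP; left; apply/eqP; field.
Qed.

End Event.

Unset Implicit Arguments.
Set Strict Implicit.
Set Printing Implicit Defensive.

Theorem mainTheorem7 (R : realType) :
  (exists c1 c2 C1 C2 : R, [/\ 0 < c1, 0 < c2, 0 < C1, 0 < C2 &
    forall (n m : nat) (p : 'I_m -> nat) (S : {set 'I_n})
      (d : measure_display) (T : measurableType d) (P : probability T R)
      (B : forall l : 'I_m, T -> 'M[R[i]]_(p l, n)) (Lam Gam : R)
      (r : 'I_#|S| -> R) (sg : T -> 'I_#|S| -> R[i]) (eta eps : R),
    sensing_setting P S B Lam Gam ->
    (#|S| * 2 <= n)%N ->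
    (forall j, 0 < r j) ->
    random_sign_assumption P B sg ->
    0 < eps < 1 ->
    c1 * Gam * ln (3 * n%:R / eps) <= Lam ->
    c2 * Lam * ln (3 * n%:R / eps) <= m%:R ->
    exists G : set T, [/\ measurable G, ((1 - eps)%:E <= P G)%E &
      forall w, G w ->
      forall (e : 'cV[R[i]]_(\sum_l p l)), l2norm e <= eta ->
      forall z : 'cV[R[i]]_n,
        qBP_minimizer (sensing B w) (sensing B w *m signal r sg w + e) eta z ->
        l2norm (signal r sg w - z) <= (C1 + C2 * Num.sqrt (#|S|%:R)) * eta]])
  /\
  (forall (n m : nat) (p : 'I_m -> nat) (S : {set 'I_n})
      (d : measure_display) (T : measurableType d) (P : probability T R)
      (B : forall l : 'I_m, T -> 'M[R[i]]_(p l, n)) (Lam Gam : R)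
      (r : 'I_#|S| -> R) (sg : T -> 'I_#|S| -> R[i]) (eps : R),
    sensing_setting P S B Lam Gam ->
    (#|S| * 2 <= n)%N ->
    (forall j, 0 < r j) ->
    random_sign_assumption P B sg ->
    0 < eps < 1 ->
    50 * Gam * ln (3 * n%:R / eps) <= Lam ->
    100 * Lam * ln (3 * n%:R / eps) <= m%:R ->
    exists G : set T, [/\ measurable G, ((1 - eps)%:E <= P G)%E &
      forall w, G w ->
        BP_minimizer (sensing B w) (sensing B w *m signal r sg w) (signal r sg w) /\
        forall z : 'cV[R[i]]_n,
          BP_minimizer (sensing B w) (sensing B w *m signal r sg w) z ->
          z = signal r sg w]).

Proof.
have l2B k (a b : 'cV[R[i]]_k) : l2norm (a - b) <= 0 -> a = b.
  by move=> /l2norm_le0/eqP; rewrite subr_eq0 => /eqP.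
split.
- exists 50, 100, 3, 100; split => //.
  move=> n m p S d T P B Lam Gam r sg eta eps sensB S2 r0 rsa eps01 LG mL.
  have [G [mG PG hG]] := recovery_event sensB rsa S2 eps01 LG mL.
  exists G; split => // w /hG[s1 Qinj cert] e he z [zfeas zmin].
  apply: (l1_recovery_error r0 s1 Qinj cert he zfeas); apply: zmin.
  by rewrite addrC addKr.
- move=> n m p S d T P B Lam Gam r sg eps sensB S2 r0 rsa eps01 LG mL.
  have [G [mG PG hG]] := recovery_event sensB rsa S2 eps01 LG mL.
  exists G; split => // w /hG[s1 Qinj cert].
  have xmin := support_l1_minimal r0 s1 Qinj cert.
  split; first by split.
  move=> z [zfeas zmin]; apply/esym/l2B.
  have n0 : l2norm (0 : 'cV[R[i]]_(\sum_l p l)) <= 0 by rewrite l2norm0.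
  have zx : l1norm z <= l1norm (signal r sg w) by exact: zmin.
  (* Uniqueness is the error estimate at noise level zero: a minimizer satisfies the constraint
     exactly and has no larger norm than the signal. *)
  have := l1_recovery_error r0 s1 Qinj cert n0 _ zx; rewrite mulr0; apply.
  by rewrite -zfeas addr0 subrr l2norm0.
Qed.
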